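(* Let $n\ge 1$. A permutation $\pi\in\mathfrak{S}_n$ is meandric if and only if $(M(\pi))^2\equiv M(\pi)\pmod 2$.
   Context: The matrix $M(\pi)$: for $\pi\in\mathfrak{S}_n$, $M(\pi)=(m_{i,j})_{1\le i,j\le n}$ is the symmetric $n\times n$ matrix over the field $\mathsf{GF}(2)$ with $m_{i,i}=0$ and, for $i<j$, $m_{i,j}=m_{j,i}=1$ if $\pi(i)>\pi(j)$ and $m_{i,j}=m_{j,i}=0$ if $\pi(i)<\pi(j)$. Meanders: a meander of order $n$ is a triple $(\mathcal{D},\{m_0,m_1,p_0,p_1\},\{\mu,\ell\})$ where $\mathcal{D}$ is a 2-dimensional (closed) disk; $m_0,m_1,p_0,p_1$ are four distinct points of $\partial\mathcal{D}$ such that some connected component of $\partial\mathcal{D}\setminus\{m_0,p_0\}$ contains both $m_1$ and $p_1$; and $\mu,\ell:[0,1]\to\mathcal{D}$ are smooth proper embeddings with $\mu(0)=m_0$, $\mu(1)=m_1$, $\ell(0)=p_0$, $\ell(1)=p_1$, such that the curves $\mu$ and $\ell$ intersect transversely, in exactly $n$ points. Meandric permutations: label the $n$ intersection points of $\mu$ and $\ell$ by $1,\dots,n$ in the order they are met moving along $\ell$ from $p_0$ to $p_1$. The permutation of the meander is $\pi\in\mathfrak{S}_n$ where $\pi(k)$ is the label of the $k$-th intersection point met moving along $\mu$ from $m_0$ to $m_1$. A permutation is meandric if it is the permutation of some meander of order $n$. *)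

(* Defs.v *)
From mathcomp Require Import all_boot all_order all_algebra all_fingroup.
From mathcomp Require Import all_classical all_reals all_analysis.

Set Implicit Arguments.
Unset Strict Implicit.
Unset Printing Implicit Defensive.

Import Order.TTheory GRing.Theory Num.Theory.
Import numFieldNormedType.Exports.

Local Open Scope ring_scope.
Local Open Scope card_scope.
Local Open Scope classical_set_scope.

(* Permutations act on 'I_n = {0, .., n-1}; all indices and labels are the
   usual ones shifted by one. *)
Definition inversion_mx (n : nat) (pi : 'S_n) : 'M['F_2]_n :=
  \matrix_(i < n, j < n)
    if (i < j)%N then (pi j < pi i)%N%:R
    else if (j < i)%N then (pi i < pi j)%N%:R
    else 0.

Section Plane.
Variable R : realType.

(* The library norm on R * R is the sup norm, whose balls are squares, hence
   the explicit Euclidean equations. *)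
Definition disk (c : R * R) (r : R) : set (R * R) :=
  [set x | (x.1 - c.1) ^+ 2 + (x.2 - c.2) ^+ 2 <= r ^+ 2].

Definition disk_boundary (c : R * R) (r : R) : set (R * R) :=
  [set x | (x.1 - c.1) ^+ 2 + (x.2 - c.2) ^+ 2 = r ^+ 2].

(* A curve [0, 1] -> R^2 is represented by a function on the whole line of
   which only the restriction to [0, 1] matters; a map on [0, 1] is smooth iff
   it is the restriction of a smooth map on R. *)
Definition smooth (g : R -> R * R) : Prop :=
  forall (k : nat) (t : R), derivable (g^`(k)) t 1.

(* An injective immersion of the compact interval [0, 1] is automatically a
   homeomorphism onto its image.  "Proper" means that exactly the endpoints of
   the interval are sent to the boundary of the disk. *)
Record proper_embedding (c : R * R) (r : R) (g : R -> R * R) : Prop := {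
  pe_smooth : smooth g;
  pe_inj : {in `[0, 1]%R &, injective g};
  pe_immersion : forall t : R, t \in `[0, 1]%R -> derive1 g t != 0;
  pe_disk : forall t : R, t \in `[0, 1]%R -> disk c r (g t);
  pe_proper : forall t : R,
    t \in `[0, 1]%R -> (disk_boundary c r (g t) <-> t = 0 \/ t = 1) }.

Definition intersection (g h : R -> R * R) : set (R * R) :=
  (g @` `[0, 1]) `&` (h @` `[0, 1]).

(* At each common point the two tangent lines span the plane. *)
Definition transverse (g h : R -> R * R) : Prop :=
  forall s t : R, s \in `[0, 1]%R -> t \in `[0, 1]%R -> g s = h t ->
  forall w : R * R, exists a b : R, w = a *: derive1 g s + b *: derive1 h t.

Record meander (n : nat) := Meander {
  center : R * R;
  radius : R;
  m0 : R * R;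
  m1 : R * R;
  p0 : R * R;
  p1 : R * R;
  mu : R -> R * R;
  ell : R -> R * R;
  radius_gt0 : 0 < radius;
  m0_bnd : disk_boundary center radius m0;
  m1_bnd : disk_boundary center radius m1;
  p0_bnd : disk_boundary center radius p0;
  p1_bnd : disk_boundary center radius p1;
  points_uniq : uniq [:: m0; m1; p0; p1];
  m1_p1_component :
    let B := disk_boundary center radius `\` [set m0; p0] in
    exists2 x, B x & connected_component B x m1 /\ connected_component B x p1;
  mu_embedding : proper_embedding center radius mu;
  ell_embedding : proper_embedding center radius ell;
  mu_0 : mu 0 = m0;
  mu_1 : mu 1 = m1;
  ell_0 : ell 0 = p0;
  ell_1 : ell 1 = p1;
  mu_ell_transverse : transverse mu ell;
  mu_ell_card : intersection mu ell #= `I_n }.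

(* P lists the points of X in the order in which they are met moving along g. *)
Definition met_in_order (n : nat) (g : R -> R * R) (X : set (R * R))
    (P : 'I_n -> R * R) : Prop :=
  range P = X /\
  exists t : 'I_n -> R,
    [/\ forall i, t i \in `[0, 1]%R,
        forall i j : 'I_n, (i < j)%N -> t i < t j &
        forall i, P i = g (t i)].

(* P i is the intersection point with label i, and Q k is the k-th point met
   along mu. *)
Definition is_perm_of_meander (n : nat) (m : meander n) (pi : 'S_n) : Prop :=
  exists P Q : 'I_n -> R * R,
    [/\ met_in_order (ell m) (intersection (mu m) (ell m)) P,
        met_in_order (mu m) (intersection (mu m) (ell m)) Q &
        forall k : 'I_n, Q k = P (pi k)].

Definition meandric (n : nat) (pi : 'S_n) : Prop :=
  exists m : meander n, is_perm_of_meander m pi.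

End Plane.

Arguments meandric R {n} pi.

(* Main.v *)
(** Forward direction. For a meander the map (s, t) |-> mu s - ell t on the
    unit square vanishes exactly at the crossings, to first order. Dividing it
    by the product of its linear parts there (with complex multiplication on
    the plane) leaves a nowhere zero map, which has a continuous angle.
    Expressing the angles of the chords of mu and ell through that angle along
    the lines through the crossings and along the four sides of the square,
    where the disk confines mu s - ell t to a half plane, gives linear relations
    between the crossing signs. As the signs are odd, these relations modulo 4
    determine the parities of pi i and of the counts #{r < i | pi r < pi j} that
    make up the entries of the square of the inversion matrix.

    Converse. If M^2 = M, then pi preserves parity and the arcs
    {pi k, pi (k+1)} with k of fixed parity are pairwise noncrossing. Drawing
    the even arcs above and the odd arcs below a diameter of a disk, as bumps
    whose heights grow fast enough with their width, gives a smooth mu. *)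
From HB Require Import structures.
Require Import Defs.
From mathcomp Require Import all_boot all_order all_algebra all_fingroup.
From mathcomp Require Import all_classical all_reals all_analysis.
From mathcomp Require Import ring lra zify.

Set Implicit Arguments.
Unset Strict Implicit.
Unset Printing Implicit Defensive.

Import numFieldNormedType.Exports.
Import Order.TTheory GRing.Theory Num.Theory.

Local Open Scope ring_scope.
Local Open Scope classical_set_scope.

(** * Arguments of plane vectors *)

Section Plane.
Variable R : realType.
Implicit Types (z w u v : R * R) (a b c t th ph : R).

(** All topology is carried by continuous angles on the square, so integers read off at different
    points can be compared. On the horizontal line through a crossing, [mu s - ell t] is a multiple
    of a chord of [mu]; cancelling one scalar factor writes the chord as the quotient times the
    remaining linear parts. On vertical lines the same holds for chords of [ell]. Where two such
    lines meet, the quotient cancels. What survives are the jumps of the arguments of the linear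
    parts, multiples of [2 pi] weighted by crossing signs, that is, signed counts of crossings in
    quadrants. A sum of signs has the parity of its number of terms, and these sums carry a factor
    2, so modulo 4 they become plain counts. The obstacle of the converse is nested arcs. Each bump
    moves horizontally only in the middle half of its time, when it has at least half its full
    height; an inner arc can share an abscissa with an outer one only then, and multiplying the
    height by 4 per unit of width leaves room below. *)

Definition det z w : R := z.1 * w.2 - z.2 * w.1.
Definition dot z w : R := z.1 * w.1 + z.2 * w.2.

Definition isarg z th : Prop :=
  exists2 r, 0 < r & z = (r * cos th, r * sin th).

Lemma isarg_neq0 z th : isarg z th -> z != 0.
Proof.
move=> [r r0 ->]; apply/eqP => -[/eqP + /eqP].
rewrite !mulf_eq0 (gt_eqF r0)/= => /eqP c0 /eqP s0.
by have := cos2Dsin2 th; rewrite c0 s0 expr0n addr0 => /eqP; rewrite eq_sym oner_eq0.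
Qed.

(** Vectors at an acute angle differ in argument by less than [pi / 2], where the arctangent
    recovers the difference without a choice of branch. *)
Lemma isarg_step z w th : isarg z th -> 0 < dot z w ->
  isarg w (th + atan (det z w / dot z w)).
Proof.
move=> [r r0 zE]; set D := dot z w => D0; set a := atan _.
have ca0 : 0 < cos a by rewrite cos_gt0_pihalf// atan_gtNpi2 atan_ltpi2.
have sa : sin a = det z w / D * cos a.
  by rewrite -[det z w / D](@atanK R) /tan divfK// gt_eqF.
exists (D / (cos a * r)); first by rewrite divr_gt0// mulr_gt0.
have cs := cos2Dsin2 th.
have DE : D = r * (cos th * w.1 + sin th * w.2) by rewrite /D /dot zE/=; ring.
have dE : det z w = r * (cos th * w.2 - sin th * w.1) by rewrite /det zE/=; ring.
rewrite sinD cosD sa.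
have nz : [/\ D != 0, cos a != 0 & r != 0] by rewrite !gt_eqF.
case: nz => nD na nr.
have -> : D / (cos a * r) * (cos th * cos a - sin th * (det z w / D * cos a)) =
  (cos th * D - sin th * det z w) / r by field; rewrite nr na nD.
have -> : D / (cos a * r) * (sin th * cos a + cos th * (det z w / D * cos a)) =
  (sin th * D + cos th * det z w) / r by field; rewrite nr na nD.
rewrite DE dE; case: w {D D0 a ca0 sa DE dE nD na} => w1 w2 /=.
congr pair.
  have -> : (cos th * (r * (cos th * w1 + sin th * w2)) - sin th * (r * (cos th * w2 - sin th * w1))) / r = (cos th ^+ 2 + sin th ^+ 2) * w1 by field.
  by rewrite cs mul1r.
have -> : (sin th * (r * (cos th * w1 + sin th * w2)) + cos th * (r * (cos th * w2 - sin th * w1))) / r = (cos th ^+ 2 + sin th ^+ 2) * w2 by field.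
by rewrite cs mul1r.
Qed.

(** Every nonzero vector is at an acute angle to one of the four unit vectors along the axes. *)
Lemma isarg_exists z : z != 0 -> exists th, isarg z th.
Proof.
move=> z0.
have i0 : isarg (1, 0) 0 by exists 1 => //; rewrite cos0 sin0 mulr1 mulr0.
have i1 : isarg (0, 1) (pi / 2) by exists 1 => //; rewrite cos_pihalf sin_pihalf mulr1 mulr0.
have i2 : isarg (-1, 0) pi by exists 1 => //; rewrite cospi sinpi !mul1r.
have i3 : isarg (0, -1) (- (pi / 2)).
  by exists 1 => //; rewrite cosN sinN cos_pihalf sin_pihalf !mul1r.
have [z1|z1|z1] := ltgtP z.1 0; last 1 first.
- have [z2|z2|z2] := ltgtP z.2 0.
  + by eexists; apply: isarg_step i3 _; rewrite /dot/= mul0r add0r mulN1r oppr_gt0.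
  + by eexists; apply: isarg_step i1 _; rewrite /dot/= mul0r add0r mul1r.
  + by case/negP: z0; apply/eqP; case: z z1 z2 => ? ? /= -> ->.
- by eexists; apply: isarg_step i2 _; rewrite /dot/= mul0r addr0 mulN1r oppr_gt0.
- by eexists; apply: isarg_step i0 _; rewrite /dot/= mul0r addr0 mul1r.
Qed.

Definition cmul z w : R * R := (z.1 * w.1 - z.2 * w.2, z.1 * w.2 + z.2 * w.1).
Definition cone : R * R := (1, 0).

Lemma cmulA : associative cmul.
Proof. by move=> x y z; rewrite /cmul/=; congr pair; ring. Qed.
Lemma cmulC : commutative cmul.
Proof. by move=> x y; rewrite /cmul/=; congr pair; ring. Qed.
Lemma cmul1 : left_id cone cmul.
Proof. by case=> x y; rewrite /cmul/=; congr pair; ring. Qed.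
HB.instance Definition _ := Monoid.isComLaw.Build (R * R)%type cone cmul cmulA cmulC cmul1.

Lemma isarg_mul z w a b : isarg z a -> isarg w b -> isarg (cmul z w) (a + b).
Proof.
move=> [r r0 ->] [s s0 ->]; exists (r * s); first exact: mulr_gt0.
by rewrite /cmul/= cosD sinD; congr pair; ring.
Qed.

Lemma isarg_one : isarg cone 0.
Proof. by exists 1 => //; rewrite cos0 sin0 mulr1 mulr0. Qed.

Lemma isarg_prod (I : Type) (s : seq I) (P : pred I) (F : I -> R * R) (f : I -> R) :
  (forall i, P i -> isarg (F i) (f i)) ->
  isarg (\big[cmul/cone]_(i <- s | P i) F i) (\sum_(i <- s | P i) f i).
Proof.
move=> H; elim/big_rec2 : _; first exact: isarg_one.
by move=> i y1 y2 Pi; apply: isarg_mul; exact: H.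
Qed.

Lemma isarg_scale c z a : 0 < c -> isarg z a -> isarg (c *: z) a.
Proof.
move=> c0 [r r0 ->]; exists (c * r); first exact: mulr_gt0.
by rewrite -!mulrA.
Qed.

Lemma isarg_opp z a : isarg z a -> isarg (- z) (a + pi).
Proof.
by move=> [r r0 ->]; exists r => //; rewrite cosDpi sinDpi !mulrN.
Qed.

Lemma isarg_oppB z a : isarg z a -> isarg (- z) (a - pi).
Proof.
move=> [r r0 ->]; exists r => //.
by rewrite sinB cosB cospi sinpi !mulr0 subr0 addr0 !mulrN1 !mulrN.
Qed.

Lemma det_isarg z w a b : isarg z a -> isarg w b ->
  exists2 r, 0 < r & det z w = r * sin (b - a).
Proof.
move=> [r r0 ->] [s s0 ->]; exists (r * s); first exact: mulr_gt0.
by rewrite /det/= sinB; ring.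
Qed.

Lemma dot_isarg z w a b : isarg z a -> isarg w b ->
  exists2 r, 0 < r & dot z w = r * cos (b - a).
Proof.
move=> [r r0 ->] [s s0 ->]; exists (r * s); first exact: mulr_gt0.
by rewrite /dot/= cosB; ring.
Qed.

Lemma det_gt0_sin z w a b : isarg z a -> isarg w b ->
  (0 < det z w) = (0 < sin (b - a)).
Proof. by move=> /det_isarg h /h[r r0 ->]; rewrite pmulr_rgt0. Qed.

Lemma periodic_int (f : R -> R) : (forall x, f (x + 2 * pi) = f x) ->
  forall (k : int) x, f (x + 2 * pi * k%:~R) = f x.
Proof.
move=> pf k x; have pN n y : f (y + 2 * pi * n%:R) = f y.
  elim: n => [|n <-]; first by rewrite mulr0 addr0.
  by rewrite -[RHS]pf; congr f; rewrite -natr1; ring.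
case: k => n; first exact: pN.
rewrite NegzE -(pN n.+1 (_ + _)); congr f; rewrite mulrNz; ring.
Qed.

Lemma cos_int (k : int) (x : R) : cos (x + 2 * pi * k%:~R) = cos x.
Proof. by apply: periodic_int => y; rewrite mulr_natl cosD2pi. Qed.

Lemma sin_int (k : int) (x : R) : sin (x + 2 * pi * k%:~R) = sin x.
Proof. by apply: periodic_int => y; rewrite mulr_natl sinD2pi. Qed.

Lemma isarg_int z a (k : int) : isarg z a -> isarg z (a + 2 * pi * k%:~R).
Proof. by move=> [r r0 ->]; exists r => //; rewrite cos_int sin_int. Qed.

Lemma shift_int c x : exists k : int, c <= x + 2 * pi * k%:~R < c + 2 * pi.
Proof.
have p0 : 0 < 2 * pi :> R by rewrite mulr_gt0 ?pi_gt0.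
exists (- Num.floor ((x - c) / (2 * pi))).
have := Num.Theory.floor_itv ((x - c) / (2 * pi)); set k := Num.floor _.
rewrite ler_pdivlMr// ltr_pdivrMr// mulrNz rmorphD/= => /andP[h1 h2].
apply/andP; split; nra.
Qed.

(** Once [b] is shifted into [[a, a + 2 pi)], the difference has sine 0 because [det z z = 0] and
    positive cosine because [dot z z > 0]; only 0 remains. *)
Lemma isarg_uniq z a b : isarg z a -> isarg z b -> exists k : int, b = a + 2 * pi * k%:~R.
Proof.
move=> za zb.
have [k hk] := shift_int a b.
have zk := isarg_int k zb.
move: hk; set b' := b + _ in zk * => /andP[h1 h2].
have [r r0] := det_isarg za zk; have [s s0] := dot_isarg za zk.
set d := b' - a.
have -> : det z z = 0 by rewrite /det mulrC subrr.
move=> sE dE.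
have c0 : 0 < cos d.
  rewrite -(pmulr_rgt0 _ s0) -sE /dot -!expr2.
  have := isarg_neq0 za; rewrite lt_def addr_ge0 ?sqr_ge0// andbT.
  rewrite paddr_eq0 ?sqr_ge0// !sqrf_eq0; apply: contraNN => /andP[/eqP z1 /eqP z2].
  by apply/eqP; case: (z) z1 z2 => ? ? /= -> ->.
have s0' : sin d = 0 by move/eqP: dE; rewrite eq_sym mulf_eq0 gt_eqF//= => /eqP.
suff d0 : d = 0.
  exists (- k); rewrite mulrNz; move: d0; rewrite /d /b'; lra.
apply/eqP; apply: contraTT c0 => dN0; rewrite -leNgt.
have dd : 0 < d < 2 * pi by rewrite lt_def dN0/= /d; lra.
have [dp|dp|dp] := ltgtP d pi.
- have : 0 < sin d by rewrite sin_gt0_pi//; lra.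
  by rewrite s0' ltxx.
- have : 0 < sin (d - pi) by rewrite sin_gt0_pi//; lra.
  by rewrite sinB cospi s0' sinpi mul0r mulr0 subrr ltxx.
- by rewrite dp cospi lerN10.
Qed.

Lemma isarg_near z a b : isarg z a -> isarg z b -> `|b - a| < 2 * pi -> b = a.
Proof.
move=> za zb; have [k ->] := isarg_uniq za zb.
have p0 : 0 < 2 * pi :> R by rewrite mulr_gt0 ?pi_gt0.
rewrite addrAC subrr add0r normrM (gtr0_norm p0) -[ltRHS]mulr1 ltr_pM2l//.
rewrite -intr_norm -[1]/(1%:~R) ltr_int => k1.
have -> : k = 0 by lia.
by rewrite mulr0 addr0.
Qed.

End Plane.

(** * Continuous angles *)

Section Lift.
Variable R : realType.
Implicit Types (z w u v : R * R) (a b c t th ph : R).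

Lemma cont_all (T U : topologicalType) (f : T -> U) :
  (forall x, {for x, continuous f}) -> continuous f.
Proof. by []. Qed.

Section ContAt.
Variables (T : topologicalType) (x : T).
Implicit Types (f g : T -> R * R) (r : T -> R).

Lemma cont_fst f : {for x, continuous f} -> {for x, continuous (fun y => (f y).1)}.
Proof. by move=> h; apply: (@continuous_comp _ _ _ f fst); [exact: h|exact: cvg_fst]. Qed.

Lemma cont_snd f : {for x, continuous f} -> {for x, continuous (fun y => (f y).2)}.
Proof. by move=> h; apply: (@continuous_comp _ _ _ f snd); [exact: h|exact: cvg_snd]. Qed.

Lemma cont_pair r1 r2 : {for x, continuous r1} -> {for x, continuous r2} ->
  {for x, continuous (fun y => (r1 y, r2 y) : R * R)}.
Proof. by move=> h1 h2; apply: (@cvg_pair _ _ _ (nbhs x) (nbhs (r1 x)) (nbhs (r2 x))). Qed.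

Lemma cont_det f g : {for x, continuous f} -> {for x, continuous g} ->
  {for x, continuous (fun y => det (f y) (g y))}.
Proof.
by move=> hf hg; apply: continuousB; apply: continuousM;
  do ?[exact: cont_fst | exact: cont_snd].
Qed.

Lemma cont_dot f g : {for x, continuous f} -> {for x, continuous g} ->
  {for x, continuous (fun y => dot (f y) (g y))}.
Proof.
by move=> hf hg; apply: continuousD; apply: continuousM;
  do ?[exact: cont_fst | exact: cont_snd].
Qed.

Lemma cont_cmul f g : {for x, continuous f} -> {for x, continuous g} ->
  {for x, continuous (fun y => cmul (f y) (g y))}.
Proof.
move=> hf hg; apply: cont_pair; [apply: continuousB|apply: continuousD];
  apply: continuousM; do ?[exact: cont_fst | exact: cont_snd].
Qed.

Lemma cont_add r1 r2 : {for x, continuous r1} -> {for x, continuous r2} ->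
  {for x, continuous (fun y => r1 y + r2 y)}.
Proof. by move=> h1 h2; exact: continuousD. Qed.

Lemma cont_mul r1 r2 : {for x, continuous r1} -> {for x, continuous r2} ->
  {for x, continuous (fun y => r1 y * r2 y)}.
Proof. by move=> h1 h2; exact: continuousM. Qed.

Lemma cont_opp r : {for x, continuous r} -> {for x, continuous (fun y => - r y)}.
Proof. by move=> h; exact: continuousN. Qed.

Lemma cont_div r1 r2 : {for x, continuous r1} -> {for x, continuous r2} -> r2 x != 0 ->
  {for x, continuous (fun y => r1 y / r2 y)}.
Proof. by move=> h1 h2 n0; apply: continuousM => //; exact: continuousV. Qed.

Lemma cont_atan r : {for x, continuous r} -> {for x, continuous (fun y => atan (r y))}.
Proof.
by move=> h; apply: (@continuous_comp _ _ _ r atan) => //; exact: continuous_atan.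
Qed.

Lemma cont_sum (I : Type) (s : seq I) (P : pred I) (F : I -> T -> R) :
  (forall i, P i -> {for x, continuous (F i)}) ->
  {for x, continuous (fun y => \sum_(i <- s | P i) F i y)}.
Proof.
move=> h; elim: s => [|i s IH].
  by under [X in {for x, continuous X}]funext do rewrite big_nil; exact: cst_continuous.
under [X in {for x, continuous X}]funext do rewrite big_cons.
case: ifPn => Pi //; by apply: continuousD => //; exact: h.
Qed.

Lemma cont_prod (I : Type) (s : seq I) (P : pred I) (F : I -> T -> R * R) :
  (forall i, P i -> {for x, continuous (F i)}) ->
  {for x, continuous (fun y => \big[@cmul R/cone R]_(i <- s | P i) F i y)}.
Proof.
move=> h; elim: s => [|i s IH].
  by under [X in {for x, continuous X}]funext do rewrite big_nil; exact: cst_continuous.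
under [X in {for x, continuous X}]funext do rewrite big_cons.
case: ifPn => Pi //; by apply: cont_cmul => //; exact: h.
Qed.

End ContAt.

(** The data are controlled on [[0, 1]] only; composing with this retraction gives lifts that are
    continuous on the whole line. *)
Definition clamp (s : R) : R := Num.max 0 (Num.min 1 s).

Lemma clamp_itv s : clamp s \in `[0, 1]%R.
Proof.
rewrite in_itv/= /clamp le_max lexx/= ge_max ler01/= ge_min lexx//.
Qed.

Lemma clamp_id s : s \in `[0, 1]%R -> clamp s = s.
Proof.
by rewrite in_itv/= => /andP[s0 s1]; rewrite /clamp min_r// max_r.
Qed.

Lemma clamp_continuous : continuous clamp.
Proof.
move=> s.
have h1 : {for s, continuous ((fun=> 1 : R) \min id)}.
  by apply: continuous_min; [exact: cst_continuous|exact: cvg_id].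
by have := continuous_max (@cst_continuous _ _ (0 : R) s) h1.
Qed.

Lemma lift_const (f : R -> R) c : continuous f ->
  (forall s, s \in `[0, 1]%R -> exists k : int, f s = c + 2 * pi * k%:~R) ->
  forall s t, s \in `[0, 1]%R -> t \in `[0, 1]%R -> f s = f t.
Proof.
move=> cf fc.
have p0 : 0 < 2 * pi :> R by rewrite mulr_gt0 ?pi_gt0.
have aux s t : s \in `[0, 1]%R -> t \in `[0, 1]%R -> s <= t -> f s = f t.
  move=> s01 t01 st; have [k fs] := fc _ s01; have [l ft] := fc _ t01.
  apply/eqP; apply: contraT => fst.
  have kl : k != l by apply: contraNneq fst => kl; rewrite fs ft kl.
  (* A value halfway between two admissible ones: attaining it would make an even integer equal to
     an odd one. *)
  pose v := c + 2 * pi * ((Num.min k l)%:~R + 2^-1).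
  have [||x xst fx] := @IVT R f s t v st.
  - by apply: continuous_subspaceT.
  - rewrite /v fs ft; have [lkl|lkl] := leP k l.
    + have : k + 1 <= l by lia.
      rewrite -(ler_int R) rmorphD/= => h.
      rewrite min_l ?max_r ?lerD2l ?ler_pM2l// ?ler_int//; apply/andP; split; lra.
    + have : l + 1 <= k by lia.
      rewrite -(ler_int R) rmorphD/= => h.
      rewrite min_r ?max_l ?lerD2l ?ler_pM2l// ?ler_int//; last 2 first. 
        exact: ltW. exact: ltW.
      apply/andP; split; lra.
  have x01 : x \in `[0, 1]%R by move: s01 t01 xst; rewrite !in_itv/=; lra.
  have [m fm] := fc _ x01.
  have E : 2 * pi * m%:~R = 2 * pi * ((Num.min k l)%:~R + 2^-1) :> R.
    by move: fx; rewrite fm /v; lra.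
  have := congr1 (fun r : R => r * 2) (mulfI (lt0r_neq0 p0) E); rewrite mulrDl mulVf// => h.
  have : (m * 2 = Num.min k l * 2 + 1)%R.
    by apply: (@intr_inj R); rewrite rmorphD !rmorphM/= h.
  lia.
move=> s t s01 t01; have [st|/ltW st] := leP s t; first exact: aux.
by symmetry; exact: aux.
Qed.

Lemma halfplane_lift (g : R -> R * R) w c :
  (forall s, s \in `[0, 1]%R -> {for s, continuous g}) ->
  (forall s, s \in `[0, 1]%R -> 0 < det w (g s)) -> isarg w c ->
  exists2 y : R -> R, continuous y &
    forall s, s \in `[0, 1]%R -> isarg (g s) (y s) /\ c < y s < c + pi.
Proof.
move=> cg dg wc.
(* [w'] is [w] turned by a right angle, so [dot w' (g s) = det w (g s)] is positive and [isarg_step]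
   applies from [w']. *)
pose w' : R * R := (- w.2, w.1).
have wc' : isarg w' (c + pi / 2).
  case: wc => r r0 wE; exists r => //.
  by rewrite /w' wE/= sinDpihalf cosDpihalf mulrN.
exists (fun s => c + pi / 2 + atan (det w' (g (clamp s)) / dot w' (g (clamp s)))).
  apply: cont_all => s; apply: cont_add; first exact: cst_continuous.
  have cc : {for s, continuous (g \o clamp)}.
    by apply: continuous_comp; [exact: clamp_continuous|exact/cg/clamp_itv].
  apply: cont_atan; apply: cont_div; [apply: cont_det => //|apply: cont_dot => //|].
  - exact: cst_continuous.
  - exact: cst_continuous.
  - rewrite gt_eqF//; have := dg _ (clamp_itv s).
    by rewrite /det /dot/=; lra.
move=> s s01; rewrite clamp_id//; split.
  apply: isarg_step => //; have := dg _ s01.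
  by rewrite /det /dot/=; lra.
set x := (X in atan X); have := atan_gtNpi2 x; have := atan_ltpi2 x; lra.
Qed.

Definition unit_square : set (R * R) := `[0, 1] `*` `[0, 1].

Lemma unit_square_compact : compact unit_square.
Proof. by apply: compact_setX; exact: segment_compact. Qed.

Definition clamp2 z : R * R := (clamp z.1, clamp z.2).

Lemma clamp2_unit_square z : unit_square (clamp2 z).
Proof. by split; exact: clamp_itv. Qed.

Lemma clamp2_id z : unit_square z -> clamp2 z = z.
Proof. by case: z => a b [/= a01 b01]; rewrite /clamp2/= !clamp_id. Qed.

Lemma clamp2_continuous : continuous clamp2.
Proof.
apply: cont_all => z; apply: cont_pair.
  by apply: (continuous_comp (f := fst)); [exact: cvg_fst|exact: clamp_continuous].
by apply: (continuous_comp (f := snd)); [exact: cvg_snd|exact: clamp_continuous].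
Qed.

Lemma unit_square_scale (c : R) z : 0 <= c <= 1 -> unit_square z -> unit_square (c *: z).
Proof.
case: z => a b c01 [/=]; rewrite !in_itv/= => a01 b01.
split; rewrite /= in_itv/=; apply/andP; split; rewrite /GRing.scale/=; nra.
Qed.

Lemma dot_gt0 z : z != 0 -> 0 < dot z z.
Proof.
case: z => a b z0; rewrite /dot/= -!expr2 lt_def addr_ge0 ?sqr_ge0// andbT.
rewrite paddr_eq0 ?sqr_ge0// !sqrf_eq0; apply: contraNN z0.
by move=> /andP[/eqP-> /eqP->].
Qed.

(** By continuity [g] takes values at an acute angle at any two points close to [x]; compactness of
    the square makes the closeness uniform. *)
Lemma uniform_angle (g : R * R -> R * R) : continuous g -> (forall z, g z != 0) ->
  exists2 e : R, 0 < e & forall z w, unit_square z -> `|z - w| < e -> 0 < dot (g z) (g w).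
Proof.
move=> cg g0.
have H x : unit_square x -> \forall x' \near x & e \near 0^'+,
    forall w, `|x' - w| < e -> 0 < dot (g x') (g w).
  move=> _.
  pose f (p : (R * R) * (R * R)) := dot (g p.1) (g p.2).
  have cf : {for (x, x), continuous f}.
    apply: cont_dot; apply: continuous_comp; do ?[exact: cvg_fst|exact: cvg_snd|exact: cg].
  have f0 : 0 < f (x, x) by exact: dot_gt0.
  have /nbhs_ballP[d /= d0 hd] : \forall p \near (x, x), 0 < f p.
    exact: (cvgr_gt (f (x, x)) cf).
  exists ([set x' | `|x - x'| < d / 2], [set e | e < d / 2]) => /=.
    split; first by apply/nbhs_ballP; exists (d / 2); rewrite /= ?divr_gt0// -ball_normE.
    by apply: nbhs_right_lt; rewrite divr_gt0.
  move=> [x' e] /= [x'd ed] w wd; apply: (hd (x', w)).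
  have d2 : d = d / 2 + d / 2 by rewrite -splitr.
  split; rewrite -ball_normE/=.
    by apply: lt_trans x'd _; rewrite ltr_pdivrMr// mulr_natr mulr2n ltrDl.
  rewrite d2; apply: le_lt_trans (ler_distD x' _ _) _.
  by rewrite ltrD// (lt_trans wd).
have HH : \forall e \near 0^'+, unit_square `<=` (fun x' => forall w, `|x' - w| < e -> 0 < dot (g x') (g w)).
  by apply: (proj1 (compact_near_coveringP _) unit_square_compact).
have : \forall e \near 0^'+, 0 < e /\ unit_square `<=` (fun x' => forall w, `|x' - w| < e -> 0 < dot (g x') (g w)).
  near=> e; split; [near: e; exact: nbhs_right_gt|by near: e].
move=> /filter_ex[e [e0 he]]; exists e => // z w zu; exact: he.
Unshelve. all: by end_near.
Qed.

(* Subdivide the segment from 0 to z finely enough that consecutive values of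
   g always make an acute angle, and add up the angles. *)
Lemma square_lift (g : R * R -> R * R) :
  (forall z, unit_square z -> {for z, continuous g}) -> (forall z, unit_square z -> g z != 0) ->
  exists2 th : R * R -> R, continuous th & forall z, unit_square z -> isarg (g z) (th z).
Proof.
move=> cg g0.
pose h := g \o clamp2.
have ch : continuous h.
  apply: cont_all => z; apply: continuous_comp; first exact: clamp2_continuous.
  exact/cg/clamp2_unit_square.
have h0 z : h z != 0 by exact/g0/clamp2_unit_square.
have [e e0 he] := uniform_angle ch h0.
have [a0 ha0] := isarg_exists (h0 0).
pose C := 2 / e.
have [N hN] : exists N : nat, 2 < N.+1%:R * e.
  exists (Num.truncn (2 / e)); rewrite -ltr_pdivrMr//; exact: truncnS_gt.
pose q k z := h ((k%:R / N.+1%:R) *: clamp2 z).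
have N0 : 0 < N.+1%:R :> R by [].
have qq k z : (k < N.+1)%N -> 0 < dot (q k z) (q k.+1 z).
  move=> kN; apply: he.
    apply: unit_square_scale; last exact: clamp2_unit_square.
    by rewrite divr_ge0//= ler_pdivrMr// mul1r ler_nat ltnW.
  rewrite -scalerBl -mulrBl -natr1 opprD addrA subrr add0r normrZ mulN1r normrN.
  rewrite ger0_norm ?invr_ge0// mulrC ltr_pdivrMr// mulrC.
  apply: le_lt_trans hN.
  have [] := clamp2_unit_square z; rewrite /= !in_itv/= => /andP[a1 a2] /andP[b1 b2].
  by rewrite prod_normE/= ge_max !ger0_norm//; apply/andP; split; lra.
pose th z := a0 + \sum_(0 <= k < N.+1) atan (det (q k z) (q k.+1 z) / dot (q k z) (q k.+1 z)).
have cq k : continuous (q k).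
  apply: cont_all => z; apply: (continuous_comp (f := fun z => (k%:R / N.+1%:R) *: clamp2 z)); last exact: ch.
  by apply: continuousZr; exact: clamp2_continuous.
exists th.
  apply: cont_all => z; apply: cont_add; first exact: cst_continuous.
  rewrite /th; under [X in {for _, continuous X}]funext do rewrite big_mkord.
  apply: cont_sum => i _; apply: cont_atan; apply: cont_div.
  - by apply: cont_det; exact: cq.
  - by apply: cont_dot; exact: cq.
  - by rewrite gt_eqF// qq.
move=> z zu.
have -> : g z = q N.+1 z by rewrite /q divff ?gt_eqF// scale1r /h/= !clamp2_id.
suff H k : (k <= N.+1)%N -> isarg (q k z)
   (a0 + \sum_(0 <= j < k) atan (det (q j z) (q j.+1 z) / dot (q j z) (q j.+1 z))).
  exact: H.
elim: k => [|k IH] kN.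
  by rewrite big_nil addr0 /q mul0r scale0r.
rewrite big_nat_recr//= addrA; apply: isarg_step; last exact: qq.
by apply: IH; exact: ltnW.
Qed.

End Lift.

(** * Arguments of the linear parts *)

Section Linear.
Variable R : realType.
Implicit Types (z w u v : R * R) (a b c t th ph : R).

(* The argument of z, given that w has argument c. The arc cotangent is
   continuous off the line spanned by w, where the division is junk. *)
Definition halfarg w c z : R :=
  c + (if 0 < det w z then pi / 2 else - (pi / 2)) - atan (dot w z / det w z).

Lemma isarg_rot z a : isarg z a -> isarg (- z.2, z.1) (a + pi / 2).
Proof.
by move=> [r r0 zE]; exists r => //; rewrite zE/= sinDpihalf cosDpihalf mulrN.
Qed.

Lemma isarg_halfarg w c z : isarg w c -> det w z != 0 -> isarg z (halfarg w c z).
Proof.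
move=> wc d0; rewrite /halfarg; set x := atan _.
have wr := isarg_rot wc.
have [dp|dn] := ltP 0 (det w z).
  have dp' : 0 < dot (- w.2, w.1) z by move: dp; rewrite /det /dot/=; lra.
  have := isarg_step wr dp'; congr isarg; congr (_ + _).
  rewrite -atanN -mulNr; congr (atan (_ / _)); rewrite /det /dot/=; ring.
have {}dn : det w z < 0 by rewrite lt_neqAle d0.
have dn' : 0 < dot (- (- w.2, w.1)) z by move: dn; rewrite /det /dot/=; lra.
have := isarg_step (isarg_oppB wr) dn'; congr isarg.
have -> : det (- (- w.2, w.1)) z / dot (- (- w.2, w.1)) z = - (dot w z / det w z).
  have -> : det (- (- w.2, w.1)) z = dot w z by rewrite /det /dot/=; ring.
  have -> : dot (- (- w.2, w.1)) z = - det w z by rewrite /det /dot/=; ring.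
  by rewrite invrN mulrN.
rewrite atanN -/x; lra.
Qed.

Lemma halfarg_gt w c z : 0 < det w z -> c < halfarg w c z < c + pi.
Proof.
move=> d0; rewrite /halfarg d0; set x := dot w z / _.
have := atan_gtNpi2 x; have := atan_ltpi2 x; lra.
Qed.

Lemma halfarg_lt w c z : det w z < 0 -> c - pi < halfarg w c z < c.
Proof.
move=> d0; rewrite /halfarg (lt_gtF d0); set x := dot w z / _.
have := atan_gtNpi2 x; have := atan_ltpi2 x; lra.
Qed.

Lemma halfarg_continuous (T : topologicalType) w c (g : T -> R * R) (d : R) :
  continuous g -> d != 0 -> (forall x, det w (g x) = d) ->
  continuous (fun x => halfarg w c (g x)).
Proof.
move=> cg d0 dE.
have -> : (fun x => halfarg w c (g x)) =
    (fun x => c + (if 0 < d then pi / 2 else - (pi / 2)) + - atan (dot w (g x) / d)).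
  by apply/funext => x; rewrite /halfarg dE.
apply: cont_all => x.
apply: cont_add; first exact: cst_continuous.
apply: cont_opp; apply: cont_atan; apply: cont_div => //; last exact: cst_continuous.
apply: cont_dot; [exact: cst_continuous|exact: cg].
Qed.

Definition lin u v (x y : R) : R * R := x *: u - y *: v.

Lemma cont_lin (T : topologicalType) (p : T) u v (r1 r2 : T -> R) :
  {for p, continuous r1} -> {for p, continuous r2} ->
  {for p, continuous (fun q => lin u v (r1 q) (r2 q))}.
Proof.
move=> h1 h2.
have cM (r : T -> R) c : {for p, continuous r} -> {for p, continuous (fun q => r q * c)}.
  by move=> h; apply: cont_mul => //; exact: cst_continuous.
have := cont_pair (cont_add (cM _ u.1 h1) (cont_opp (cM _ v.1 h2)))
                  (cont_add (cM _ u.2 h1) (cont_opp (cM _ v.2 h2))).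
exact.
Qed.

(** For fixed nonzero [y] this determinant is a nonzero constant as soon as [det u v] is nonzero:
    along a horizontal line the vector never crosses the line spanned by [u], and [halfarg] is
    continuous. [det_linr] serves vertical lines. *)
Lemma det_linl u v x y : det u (lin u v x y) = - y * det u v.
Proof. by rewrite /det /lin/= /GRing.scale/=; ring. Qed.

Lemma det_linr u v x y : det v (lin u v x y) = - x * det u v.
Proof. by rewrite /det /lin/= /GRing.scale/=; ring. Qed.

Lemma int_near (k : int) (x : R) : x = 2 * pi * k%:~R -> - (2 * pi) < x < 2 * pi -> k = 0.
Proof.
move=> ->; have p0 : 0 < 2 * pi :> R by rewrite mulr_gt0 ?pi_gt0.
rewrite -ltr_norml normrM (gtr0_norm p0) -[ltRHS]mulr1 ltr_pM2l//.
by rewrite -intr_norm -[1]/(1%:~R) ltr_int; lia.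
Qed.

(* lh lifts the argument of lin u v along horizontal lines off the origin, lv
   along vertical ones; they disagree by a jump in the quadrant x < 0 < y. *)
Record lin_lift u v (al be : R) (b e : int) (lh lv : R -> R -> R) : Prop := {
  ll_sign : e = 1 \/ e = -1;
  ll_hcont : forall y : R, y != 0 -> continuous (lh ^~ y);
  ll_h : forall x y : R, y != 0 -> isarg (lin u v x y) (lh x y);
  ll_vcont : forall x : R, x != 0 -> continuous (lv x);
  ll_v : forall x y : R, x != 0 -> isarg (lin u v x y) (lv x y);
  ll_vh : forall x y : R, x != 0 -> y != 0 ->
    lv x y = lh x y + 2 * pi * (b%:~R + e%:~R * ((x < 0) && (0 < y))%:R);
  ll_h0 : forall y : R, y != 0 -> lh 0 y = be - 2 * pi * b%:~R - e%:~R * pi * (0 < y)%R%:R;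
  ll_v0 : forall x : R, x != 0 -> lv x 0 = al + 2 * pi * b%:~R + e%:~R * pi * (x < 0)%R%:R }.

Ltac oppmul_sign := rewrite mulNr ?oppr_gt0 ?oppr_lt0;
  first [by rewrite pmulr_rgt0 | by rewrite nmulr_rgt0 | by rewrite pmulr_rlt0 | by rewrite nmulr_rlt0].

(** [lh] measures from [u], [lv] from [v], and [e] is the sign of [det u v]. In an open quadrant
    both are confined to half turns, so their difference, a multiple of [2 * pi], takes a single
    value. *)
Lemma linear_lift u v al be : isarg u al -> isarg v be -> det u v != 0 ->
  exists (b e : int) (lh lv : R -> R -> R), lin_lift u v al be b e lh lv.
Proof.
move=> ua vb d0.
have pi0 := pi_gt0 R.
have [b hb] := shift_int (- pi) (be - al).
have vb' := isarg_int b vb.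
pose e : int := if 0 < det u v then 1 else -1.
have sd := det_isarg ua vb'.
set de := be - al + 2 * pi * b%:~R in hb.
have deE : be + 2 * pi * b%:~R - al = de by rewrite /de; ring.
rewrite deE in sd.
(* The shifted angle from [u] to [v] lies strictly between 0 and [e * pi], since its sine has the
   sign of [det u v]. *)
have hde : (0 < det u v /\ e = 1 /\ 0 < de < pi) \/ (det u v < 0 /\ e = -1 /\ - pi < de < 0).
  rewrite /e; have [dp|dn] := ltP 0 (det u v); [left|right].
    do 2 split=> //; have [r r0 dE] := sd.
    have s0 : 0 < sin de by move: dp; rewrite dE pmulr_rgt0.
    have [d1|d1] := ltP 0 de; first by move: hb; lra.
    have : 0 <= sin (- de) by apply: sin_ge0_pi; move: hb; lra.
    by rewrite sinN; lra.
  have {}dn : det u v < 0 by rewrite lt_neqAle d0.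
  do 2 split=> //; have [r r0 dE] := sd.
  have s0 : sin de < 0 by move: dn; rewrite dE pmulr_rlt0.
  have dN : de != - pi by apply: contraTneq s0 => ->; rewrite sinN sinpi oppr0 ltxx.
  have [d1|d1] := ltP de 0; first by move: hb; rewrite le_eqVlt eq_sym (negbTE dN); lra.
  have : 0 <= sin de by apply: sin_ge0_pi; move: hb; lra.
  lra.
exists (- b), e, (fun x y => halfarg u al (lin u v x y)), (fun x y => halfarg v be (lin u v x y)).
have lx0 x : lin u v x 0 = x *: u by rewrite /lin scale0r subr0.
have l0y y : lin u v 0 y = (- y) *: v by rewrite /lin scale0r add0r scaleNr.
split.
- by rewrite /e; case: ifP; [left|right].
- move=> y y0; apply: (halfarg_continuous (d := - y * det u v)); last by move=> x; rewrite det_linl.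
    by apply: cont_all => x; apply: cont_lin; [exact: cvg_id|exact: cst_continuous].
  by rewrite mulf_neq0// oppr_eq0.
- by move=> x y y0; apply: isarg_halfarg => //; rewrite det_linl mulf_neq0// oppr_eq0.
- move=> x x0; apply: (halfarg_continuous (d := - x * det u v)); last by move=> y; rewrite det_linr.
    by apply: cont_all => y; apply: cont_lin; [exact: cst_continuous|exact: cvg_id].
  by rewrite mulf_neq0// oppr_eq0.
- by move=> x y x0; apply: isarg_halfarg => //; rewrite det_linr mulf_neq0// oppr_eq0.
- move=> x y x0 y0.
  have := isarg_halfarg ua (z := lin u v x y).
  have := isarg_halfarg vb (z := lin u v x y).
  rewrite !(det_linl, det_linr) !mulf_neq0 ?oppr_eq0// => /(_ isT) hv /(_ isT) hh.
  have [k hk] := isarg_uniq hh hv.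
  have := @halfarg_gt u al (lin u v x y); have := @halfarg_lt u al (lin u v x y).
  have := @halfarg_gt v be (lin u v x y); have := @halfarg_lt v be (lin u v x y).
  rewrite !(det_linl, det_linr) hk; set lh := halfarg u al _.
  move=> v1 v2 u1 u2.
  suff -> : k = - b + e * ((x < 0) && (0 < y))%:R.
    by rewrite !(rmorphD, rmorphM)/=; case: (_ && _).
  apply/eqP; rewrite -subr_eq0; apply/eqP.
  apply: int_near (erefl _) _; rewrite !(rmorphD, rmorphM, rmorphN)/=.
  have kE : 2 * pi * k%:~R = halfarg v be (lin u v x y) - lh by rewrite hk -/lh; ring.
  rewrite -hk in v1 v2.
  set lv := halfarg v be _ in v1 v2 kE.
  case: hde => -[dp [-> hd]]; case: (ltgtP y 0) y0 => // y0 _; case: (ltgtP x 0) x0 => // x0 _ /=;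
    (first [have := u2 ltac:(oppmul_sign) | have := u1 ltac:(oppmul_sign)]);
    (first [have := v2 ltac:(oppmul_sign) | have := v1 ltac:(oppmul_sign)]); move: hd kE pi0; rewrite /de/=; clear; lra.
- move=> y y0; have L0 := l0y y.
  have hh := isarg_halfarg ua (z := lin u v 0 y).
  have u1 := @halfarg_gt u al (lin u v 0 y); have u2 := @halfarg_lt u al (lin u v 0 y).
  rewrite !det_linl in hh u1 u2; move/(_ (mulf_neq0 _ d0)): hh; rewrite oppr_eq0 => /(_ y0) hh.
  apply: isarg_near _ hh _; last first.
    case: hde => -[dp [-> hd]]; case: (ltgtP y 0) y0 => // y0 _;
      (first [have := u2 ltac:(oppmul_sign) | have := u1 ltac:(oppmul_sign)]); rewrite ltr_norml;
      move: hd pi0; rewrite /de rmorphN/=; clear; lra.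
  rewrite L0; case: hde => -[dp [-> hd]]; case: (ltgtP y 0) y0 => // y0 _ /=.
  - have yN : 0 < - y by rewrite oppr_gt0.
    have := isarg_scale yN vb'; congr isarg; rewrite rmorphN/=; ring.
  - rewrite scaleNr; have := isarg_oppB (isarg_scale y0 vb'); congr isarg; rewrite rmorphN/=; ring.
  - have yN : 0 < - y by rewrite oppr_gt0.
    have := isarg_scale yN vb'; congr isarg; rewrite rmorphN/=; ring.
  - rewrite scaleNr; have := isarg_opp (isarg_scale y0 vb'); congr isarg; rewrite rmorphN/=; ring.
- move=> x x0; have L0 := lx0 x.
  have hh := isarg_halfarg vb (z := lin u v x 0).
  have u1 := @halfarg_gt v be (lin u v x 0); have u2 := @halfarg_lt v be (lin u v x 0).
  rewrite !det_linr in hh u1 u2; move/(_ (mulf_neq0 _ d0)): hh; rewrite oppr_eq0 => /(_ x0) hh.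
  have ua' := isarg_int (- b) ua.
  apply: isarg_near _ hh _; last first.
    case: hde => -[dp [-> hd]]; case: (ltgtP x 0) x0 => // x0 _;
      (first [have := u2 ltac:(oppmul_sign) | have := u1 ltac:(oppmul_sign)]); rewrite ltr_norml;
      move: hd pi0; rewrite /de rmorphN/=; clear; lra.
  rewrite L0; case: hde => -[dp [-> hd]]; case: (ltgtP x 0) x0 => // x0 _ /=.
  - have xN : 0 < - x by rewrite oppr_gt0.
    have -> : x *: u = - ((- x) *: u) by rewrite scaleNr opprK.
    have := isarg_opp (isarg_scale xN ua'); congr isarg; ring.
  - have := isarg_scale x0 ua'; congr isarg; ring.
  - have xN : 0 < - x by rewrite oppr_gt0.
    have -> : x *: u = - ((- x) *: u) by rewrite scaleNr opprK.
    have := isarg_oppB (isarg_scale xN ua'); congr isarg; rewrite rmorphN/=; ring.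
  - have := isarg_scale x0 ua'; congr isarg; ring.
Qed.

End Linear.

(** * Chords *)

Section Chord.
Variable R : realType.
Implicit Types (g : R -> R * R) (f : R -> R).

Lemma derive_fst g t : derivable g t 1 -> is_derive t 1 (fun s => (g s).1) (g^`() t).1.
Proof.
move=> dg; rewrite derive1E.
have h : ((fun h => h^-1 *: ((g \o shift t) (h *: 1) - g t)) @ 0^') --> 'D_1 g t by exact: dg.
have h1 : (fst \o (fun h => h^-1 *: ((g \o shift t) (h *: 1) - g t))) @ 0^' --> ('D_1 g t).1.
  have := cvg_comp _ _ h (_ : x.1 @[x --> 'D_1 g t] --> ('D_1 g t).1).
  by apply; exact: cvg_fst.
apply: DeriveDef.
  by apply/cvg_ex; exists ('D_1 g t).1.
exact: (cvg_lim _ h1).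
Qed.

Lemma derive_snd g t : derivable g t 1 -> is_derive t 1 (fun s => (g s).2) (g^`() t).2.
Proof.
move=> dg; rewrite derive1E.
have h : ((fun h => h^-1 *: ((g \o shift t) (h *: 1) - g t)) @ 0^') --> 'D_1 g t by exact: dg.
have h1 : (snd \o (fun h => h^-1 *: ((g \o shift t) (h *: 1) - g t))) @ 0^' --> ('D_1 g t).2.
  have := cvg_comp _ _ h (_ : x.2 @[x --> 'D_1 g t] --> ('D_1 g t).2).
  by apply; exact: cvg_snd.
apply: DeriveDef.
  by apply/cvg_ex; exists ('D_1 g t).2.
exact: (cvg_lim _ h1).
Qed.

Lemma derivable_cont g t : derivable g t 1 -> {for t, continuous g}.
Proof. by move=> /derivable1_diffP; exact: differentiable_continuous. Qed.

Definition slope f (df : R -> R) (z : R * R) : R :=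
  if z.1 == z.2 then df z.1 else (f z.2 - f z.1) / (z.2 - z.1).

(** The mean value theorem in a form that covers the diagonal; it yields the continuity of [slope]
    there. *)
Lemma slope_mean f (df : R -> R) (a b : R) : (forall x : R, is_derive x 1 f (df x)) ->
  exists2 c, Num.min a b <= c <= Num.max a b & slope f df (a, b) = df c.
Proof.
move=> fdf.
have fc : continuous f.
  by apply: cont_all => x; apply/differentiable_continuous/derivable1_diffP; have [] := fdf x.
have aux x y : x < y -> exists2 c, x <= c <= y & f y - f x = df c * (y - x).
  move=> xy; have [|c] := @MVT_segment R f df x y (ltW xy) (fun z _ => fdf z).
    exact: continuous_subspaceT.
  by rewrite in_itv/=; exists c.
rewrite /slope/=; have [<-|ab] := eqVneq a b.
  by exists a; rewrite ?minxx ?maxxx ?lexx.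
have [lab|lab] := ltP a b.
  have [c cab ->] := aux _ _ lab; exists c => //.
  by rewrite mulfK// subr_eq0 eq_sym.
have {}lab : b < a by rewrite lt_neqAle eq_sym ab.
have [c cab E] := aux _ _ lab; exists c => //.
by rewrite -opprB E -[in X in X / _](opprB b a) mulrN opprK mulfK// subr_eq0 eq_sym.
Qed.

Lemma slope_continuous f (df : R -> R) : (forall x : R, is_derive x 1 f (df x)) -> continuous df ->
  continuous (slope f df).
Proof.
move=> fdf cdf; apply: cont_all => -[a b].
have fc : continuous f.
  by apply: cont_all => x; apply/differentiable_continuous/derivable1_diffP; have [] := fdf x.
have [ab|ab] := eqVneq a b.
  subst b; apply/cvgrPdist_lt => e e0.
  have -> : slope f df (a, a) = df a by rewrite /slope/= eqxx.
  have /cvgrPdist_lt/(_ _ e0)/nbhs_ballP[d /= d0 hd] := cdf a.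
  exists (ball a d, ball a d); first by split; exact: nbhsx_ballx.
  move=> [x y] [/= xa ya].
  have [c cxy ->] := slope_mean x y fdf; apply: hd.
  move: xa ya; rewrite -!ball_normE/= !ltr_norml => xa ya.
  move: cxy; case: (leP x y) => xy /andP[c1 c2]; apply/andP; split; lra.
have cF : {for (a, b), continuous (fun z : R * R => (f z.2 - f z.1) / (z.2 - z.1))}.
  apply: cont_div.
  - apply: cont_add; [|apply: cont_opp]; apply: continuous_comp; try exact: fc.
      exact: cvg_snd.
    exact: cvg_fst.
  - by apply: cont_add; [exact: cvg_snd|apply: cont_opp; exact: cvg_fst].
  - by rewrite /= subr_eq0 eq_sym.
have nE : \forall z \near (a, b), (f z.2 - f z.1) / (z.2 - z.1) = slope f df z.
  have cd : {for (a, b), continuous (fun z : R * R => z.2 - z.1)}.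
    by apply: cont_add; [exact: cvg_snd|apply: cont_opp; exact: cvg_fst].
  have : \forall z \near (a, b), z.2 - z.1 != 0 :> R.
    by apply: (cvgr_neq0 (b - a)) cd _; rewrite subr_eq0 eq_sym.
  by apply: filterS => z; rewrite subr_eq0 /slope eq_sym => /negbTE->.
have := cvg_trans (near_eq_cvg nE) cF.
have E : slope f df (a, b) = (f b - f a) / (b - a) by rewrite /slope/= (negbTE ab).
move=> h; rewrite /prop_for /continuous_at E; exact: h.
Qed.

Definition chord g (z : R * R) : R * R :=
  (slope (fun s => (g s).1) (fun s => (g^`() s).1) z,
   slope (fun s => (g s).2) (fun s => (g^`() s).2) z).

Lemma chordC g s t : chord g (s, t) = chord g (t, s).
Proof.
rewrite /chord /slope/= [t == s]eq_sym; case: eqP => [->//|_].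
by rewrite -[in RHS](opprB (g t).1) -[in RHS](opprB (g t).2) -[in RHS](opprB t s) invrN !mulrNN.
Qed.

Lemma chordE g s t : g t - g s = (t - s) *: chord g (s, t).
Proof.
rewrite /chord /slope/= /GRing.scale/=; case: eqP => [->|/eqP st].
  by rewrite !subrr /scale_pair/= !scale0r.
rewrite /scale_pair/= /GRing.scale/=.
by rewrite ![(t - s) * _]mulrC !divfK// subr_eq0 eq_sym.
Qed.

Lemma chord_diag g s : chord g (s, s) = g^`() s.
Proof. by rewrite /chord /slope/= eqxx; case: (g^`() s). Qed.

Lemma chord_continuous g : smooth g -> continuous (chord g).
Proof.
move=> sg; apply: cont_all => z.
have c1 : continuous (g^`()) by apply: cont_all => t; exact/derivable_cont/(sg 1%N).
apply: cont_pair.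
  apply: slope_continuous => [x|]; first exact/derive_fst/(sg 0%N).
  by apply: cont_all => x; apply: cont_fst; exact: c1.
apply: slope_continuous => [x|]; first exact/derive_snd/(sg 0%N).
by apply: cont_all => x; apply: cont_snd; exact: c1.
Qed.

(** Injectivity handles distinct parameters and the immersion condition the diagonal. Hence chords
    have a continuous angle on the whole square. *)
Lemma chord_neq0 c r g z : proper_embedding c r g -> unit_square z -> chord g z != 0.
Proof.
move=> pg; case: z => s t [/= s01 t01].
have [->|st] := eqVneq s t; first by rewrite chord_diag; exact: (pe_immersion pg).
apply: contra_neq st => h; apply: (pe_inj pg s01 t01); apply/eqP.
by rewrite eq_sym -subr_eq0 chordE h scaler0.
Qed.

End Chord.

(** * Division by the linear parts *)

Section Quotient.
Variable R : realType.
Implicit Types (z w u v : R * R).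

Definition cinv z : R * R := (z.1 / dot z z, - z.2 / dot z z).

Lemma cmulV z : z != 0 -> cmul z (cinv z) = cone R.
Proof.
move=> z0; have d0 : dot z z != 0 by rewrite gt_eqF// dot_gt0.
rewrite /cmul /cinv /cone /=; congr pair; last by ring.
by rewrite -[RHS](divff d0) /dot; ring.
Qed.

Lemma cinv_neq0 z : z != 0 -> cinv z != 0.
Proof.
move=> z0; apply/eqP => h; have := cmulV z0.
by rewrite h /cmul/= !mulr0 subr0 => -[/eqP]; rewrite eq_sym oner_eq0.
Qed.

Lemma cmul_neq0 z w : z != 0 -> w != 0 -> cmul z w != 0.
Proof.
move=> /isarg_exists[a za] /isarg_exists[b wb].
exact: isarg_neq0 (isarg_mul za wb).
Qed.

Lemma cprod_neq0 (I : Type) (r : seq I) (P : pred I) (F : I -> R * R) :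
  (forall i, P i -> F i != 0) -> \big[@cmul R/cone R]_(i <- r | P i) F i != 0.
Proof.
move=> F0; apply: (big_ind (fun z => z != 0)) => //; last exact: cmul_neq0.
by apply/eqP => -[/eqP]; rewrite oner_eq0.
Qed.

Lemma cinvM z w : cinv (cmul z w) = cmul (cinv z) (cinv w).
Proof.
have dE : dot (cmul z w) (cmul z w) = dot z z * dot w w by rewrite /dot/=; ring.
rewrite /cinv dE invfM /cmul/=; congr pair; ring.
Qed.

Lemma cont_cinv (T : topologicalType) (x : T) (f : T -> R * R) :
  {for x, continuous f} -> f x != 0 -> {for x, continuous (fun y => cinv (f y))}.
Proof.
move=> cf f0; have d0 : dot (f x) (f x) != 0 by rewrite gt_eqF// dot_gt0.
apply: cont_pair; apply: cont_div; do ?[exact: cont_dot|exact: cont_fst|exact: cont_snd|exact: d0].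
by apply: cont_opp; exact: cont_snd.
Qed.

Lemma lin_neq0 u v x y : det u v != 0 -> (x != 0) || (y != 0) -> lin u v x y != 0.
Proof.
move=> d0; apply: contraTneq => L0.
have h1 := det_linl u v x y; have h2 := det_linr u v x y.
rewrite L0 /det/= !mulr0 subrr in h1 h2.
move/eqP: h1; rewrite eq_sym mulf_eq0 (negbTE d0) orbF oppr_eq0 => ->.
by move/eqP: h2; rewrite eq_sym mulf_eq0 (negbTE d0) orbF oppr_eq0 => ->.
Qed.

(** [p] and [q] are the coordinates of a vector of which [x] is a linear function, by Cramer's rule.
    The bound concerns a coordinate of [x] divided by that vector as a complex number. *)
Lemma ratio_bound (p q x D a b : R) : D != 0 -> x * D = p * a + q * b ->
  `|x * p / (p ^+ 2 + q ^+ 2)| <= (`|a| + `|b|) / `|D|.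
Proof.
move=> D0 xD; set N := p ^+ 2 + q ^+ 2.
have N0 : 0 <= N by rewrite addr_ge0 ?sqr_ge0.
have [->|NN] := eqVneq N 0.
  by rewrite invr0 mulr0 normr0 divr_ge0// addr_ge0.
have {}N0 : 0 < N by rewrite lt_def NN.
rewrite normrM normfV (gtr0_norm N0) ler_pdivrMr// mulrAC ler_pdivlMr ?normr_gt0//.
rewrite -normrM mulrAC xD mulrDl mulrDl.
apply: le_trans (ler_normD _ _) _; apply: lerD; rewrite normrM.
  rewrite mulrC normrM mulrA [leRHS]mulrC ler_wpM2r//.
  by rewrite -normrM -expr2 ger0_norm ?sqr_ge0// /N lerDl sqr_ge0.
rewrite normrM mulrAC [leRHS]mulrC ler_wpM2r// -normrM.
by rewrite /N ler_norml; apply/andP; split; nra.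
Qed.

(** The quotient minus 1 has numerator [x *: (h1 x' - u) - y *: (h2 y' - v)]. The brackets tend to
    0, while [x] and [y] divided by the linear part stay bounded. *)
Lemma ratio_continuous (a b : R) (h1 h2 : R -> R * R) :
  {for a, continuous h1} -> {for b, continuous h2} -> det (h1 a) (h2 b) != 0 ->
  {for (a, b), continuous (fun z => if z == (a, b) then cone R else
     cmul ((z.1 - a) *: h1 z.1 - (z.2 - b) *: h2 z.2)
          (cinv (lin (h1 a) (h2 b) (z.1 - a) (z.2 - b))))}.
Proof.
move=> c1 c2 D0; set u := h1 a in D0 *; set v := h2 b in D0 *; set D := det u v in D0.
set Q := fun z => _.
pose C := (`|u.1| + `|u.2| + `|v.1| + `|v.2|) / `|D|.
have C0 : 0 <= C by rewrite divr_ge0// !addr_ge0.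
have QE : Q (a, b) = cone R by rewrite /Q eqxx.
rewrite /prop_for /continuous_at QE; apply/cvgrPdist_le => e e0.
(* Each coordinate of the error consists of four terms of size at most [C * d]. *)
pose d := e / (4 * C + 1).
have d0 : 0 < d by rewrite divr_gt0// ltr_wpDl// mulr_ge0.
have N1 : nbhs a (fun x => `|u - h1 x| < d) by apply: (cvgrPdist_lt _ _).1 c1 _ d0.
have N2 : nbhs b (fun x => `|v - h2 x| < d) by apply: (cvgrPdist_lt _ _).1 c2 _ d0.
exists ([set x | `|u - h1 x| < d], [set x | `|v - h2 x| < d]) => //.
move=> [x' y'] [/= hx hy]; rewrite /Q.
case: ifPn => zE; first by rewrite subrr normr0 ltW.
set x := x' - a; set y := y' - b; set L := lin u v x y.
have L0 : L != 0.
  by apply: lin_neq0 => //; rewrite !subr_eq0 -negb_and; exact: zE.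
have N0 : dot L L != 0 by rewrite gt_eqF// dot_gt0.
have NE : dot L L = L.1 ^+ 2 + L.2 ^+ 2 by rewrite /dot !expr2.
have xD : x * D = L.1 * v.2 + L.2 * - v.1.
  by rewrite /L /lin /D /det/= /GRing.scale/=; ring.
have yD : y * D = L.1 * u.2 + L.2 * - u.1.
  by rewrite /L /lin /D /det/= /GRing.scale/=; ring.
have bnd (z : R) w : z * D = L.1 * w.2 + L.2 * - w.1 -> `|w.1| + `|w.2| <= C * `|D| ->
    `|z * L.1 / dot L L| <= C /\ `|z * L.2 / dot L L| <= C.
  move=> zD wC; have wC' : (`|w.2| + `|w.1|) / `|D| <= C.
    by rewrite ler_pdivrMr ?normr_gt0// addrC.
  rewrite NE; split.
    by have := ratio_bound D0 zD; rewrite normrN => /le_trans; apply.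
  rewrite addrC; rewrite addrC in zD.
  have := ratio_bound D0 zD; rewrite normrN addrC => /le_trans; apply.
  by rewrite addrC.
have CD : C * `|D| = `|u.1| + `|u.2| + `|v.1| + `|v.2| by rewrite divfK// normr_eq0.
have [||xp xq] := bnd x v => //; first by rewrite CD -addrA lerDr addr_ge0.
have [||yp yq] := bnd y u => //; first by rewrite CD -addrA lerDl addr_ge0.
set e1 := u - h1 x' in hx; set e2 := v - h2 y' in hy.
have -> : cone R - cmul (x *: h1 x' - y *: h2 y') (cinv L) = cmul (x *: e1 - y *: e2) (cinv L).
  have cB z1 z2 w : cmul z1 w - cmul z2 w = cmul (z1 - z2) w.
    by rewrite /cmul/=; congr pair; rewrite /=; ring.
  rewrite -(cmulV L0) cB; congr cmul.
  by rewrite /L /lin /e1 /e2 !scalerBr opprD addrACA -opprD.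
clearbody L e1 e2.
have de : 4 * C * d <= e.
  rewrite /d mulrCA ler_piMr ?(ltW e0)// ler_pdivrMr ?mul1r ?lerDl//.
  by rewrite ltr_wpDl// mulr_ge0.
move: hx hy; rewrite !prod_normE/= !gt_max ge_max => /andP[h11 h12] /andP[h21 h22].
have mb (z w : R) : `|z| <= C -> `|w| < d -> `|z * w| <= C * d.
  by move=> zC wd; rewrite normrM ler_pM// ltW.
have tri (z1 z2 z3 z4 : R) : `|z1| <= C * d -> `|z2| <= C * d -> `|z3| <= C * d ->
    `|z4| <= C * d -> `|z1 - z2 + (z3 - z4)| <= e.
  rewrite !ler_norml; lra.
apply/andP; split; rewrite /cmul /cinv/= /GRing.scale/=.
  have := tri _ _ _ _ (mb _ _ xp h11) (mb _ _ yp h21) (mb _ _ xq h12) (mb _ _ yq h22).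
  by congr (`|_| <= _); ring.
have := tri _ _ _ _ (mb _ _ xp h12) (mb _ _ yp h22) (mb _ _ yq h21) (mb _ _ xq h11).
by congr (`|_| <= _); ring.
Qed.

Section Exists.
Variables (n : nat) (F : R * R -> R * R) (s t : 'I_n -> R) (h1 h2 : 'I_n -> R -> R * R).
Hypothesis cF : continuous F.
Hypothesis s_inj : injective s.
Hypothesis ch1 : forall i, continuous (h1 i).
Hypothesis ch2 : forall i, continuous (h2 i).
Hypothesis FE : forall i z, F z = (z.1 - s i) *: h1 i z.1 - (z.2 - t i) *: h2 i z.2.
Hypothesis D0 : forall i, det (h1 i (s i)) (h2 i (t i)) != 0.
Hypothesis F0 : forall z, unit_square z -> F z = 0 -> exists i, z = (s i, t i).

Let L i z := lin (h1 i (s i)) (h2 i (t i)) (z.1 - s i) (z.2 - t i).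

Let L_neq0 i z : z != (s i, t i) -> L i z != 0.
Proof.
move=> zi; apply: lin_neq0 => //; rewrite !subr_eq0 -negb_and.
by apply: contra zi => /andP[/eqP <- /eqP <-]; case: (z).
Qed.

Let L_cont i : continuous (L i).
Proof.
apply: cont_all => z; apply: cont_lin.
  by apply: cont_add; [exact: cvg_fst|exact: cst_continuous].
by apply: cont_add; [exact: cvg_snd|exact: cst_continuous].
Qed.

(** At crossing [i] the ratio of [F] to [L i] tends to 1, so [G] must be the inverse of the product
    of the other factors there. The last clause records this value; it extends the formula for
    chords to the crossing itself. *)
Lemma quotient_exists : exists G : R * R -> R * R,
  [/\ forall z, unit_square z -> {for z, continuous G},
      forall z, unit_square z -> G z != 0,
      forall z, unit_square z -> F z = cmul (G z) (\big[@cmul R/cone R]_r L r z) &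
      forall i, cmul (G (s i, t i)) (\big[@cmul R/cone R]_(r | r != i) L r (s i, t i)) = cone R].
Proof.
pose G z := if [pick i | z == (s i, t i)] is Some i
  then cinv (\big[@cmul R/cone R]_(r | r != i) L r z)
  else cmul (F z) (cinv (\big[@cmul R/cone R]_r L r z)).
have pt_inj i j : ((s i, t i) == (s j, t j)) = (i == j).
  by apply/eqP/eqP => [[/s_inj]|->].
have Gi i : G (s i, t i) = cinv (\big[@cmul R/cone R]_(r | r != i) L r (s i, t i)).
  rewrite /G; case: pickP => [j|/(_ i)]; last by rewrite eqxx.
  by rewrite pt_inj => /eqP ->.
have Gn z : (forall i, z != (s i, t i)) -> G z = cmul (F z) (cinv (\big[@cmul R/cone R]_r L r z)).
  by move=> zn; rewrite /G; case: pickP => // i; rewrite (negbTE (zn i)).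
have Pi0 i : \big[@cmul R/cone R]_(r | r != i) L r (s i, t i) != 0.
  by apply: cprod_neq0 => r ri; apply: L_neq0; rewrite pt_inj eq_sym.
have P0 z : (forall i, z != (s i, t i)) -> \big[@cmul R/cone R]_r L r z != 0.
  by move=> zn; apply: cprod_neq0 => r _; exact: L_neq0.
have zP z : (exists i, z = (s i, t i)) \/ (forall i, z != (s i, t i)).
  case: (pickP (fun i => z == (s i, t i))) => [i /eqP ->|h]; first by left; exists i.
  by right => i; rewrite h.
have near_ne z i : z != (s i, t i) -> \forall w \near z, w != (s i, t i).
  move=> zi; have cL := @L_cont i z.
  have : \forall w \near z, L i w != 0.
    by apply: (cvgr_neq0 (L i z)) cL _; exact: L_neq0.
  apply: filterS => w; apply: contra_neq => ->.
  by rewrite /L/= !subrr /lin !scale0r subr0.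
have near_all (P : pred 'I_n) z : (forall i, P i -> z != (s i, t i)) ->
    \forall w \near z, forall i, P i -> w != (s i, t i).
  move=> zn; apply: (@filter_forall _ _ (fun i w => P i -> w != (s i, t i)) (nbhs z)) => i.
  have [Pi|Pi] := boolP (P i); last by apply: nearW => w.
  by apply: filterS (near_ne z i (zn i Pi)) => w.
exists G; split.
- move=> z zu; have [[i ->]|zn] := zP z; last first.
    have nE : \forall w \near z, cmul (F w) (cinv (\big[@cmul R/cone R]_r L r w)) = G w.
      have := near_all predT z (fun i _ => zn i).
      by apply: filterS => w wn; rewrite Gn// => i; exact: wn.
    have cQ : {for z, continuous (fun w => cmul (F w) (cinv (\big[@cmul R/cone R]_r L r w)))}.
      apply: cont_cmul; first exact: cF.
      by apply: cont_cinv; [apply: cont_prod => r _; exact: L_cont|exact: P0].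
    have h := cvg_trans (near_eq_cvg nE) cQ.
    by rewrite /prop_for /continuous_at Gn//; exact: h.
  pose Q z := if z == (s i, t i) then cone R else
     cmul ((z.1 - s i) *: h1 i z.1 - (z.2 - t i) *: h2 i z.2) (cinv (L i z)).
  have cQ : {for (s i, t i), continuous Q}.
    have h := ratio_continuous (@ch1 i (s i)) (@ch2 i (t i)) (D0 i).
    exact: h.
  have nE : \forall w \near (s i, t i),
      cmul (Q w) (cinv (\big[@cmul R/cone R]_(r | r != i) L r w)) = G w.
    have := near_all (predC1 i) (s i, t i); rewrite /=.
    have ij : forall j, j != i -> (s i, t i) != (s j, t j).
      by move=> j ji; rewrite pt_inj eq_sym.
    move=> /(_ ij); apply: filterS => w wn.
    have [->|wi] := eqVneq w (s i, t i); first by rewrite /Q eqxx cmul1 Gi.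
    rewrite Gn; last by move=> j; have [->//|/wn] := eqVneq j i.
    by rewrite /Q (negbTE wi) (FE i) [in RHS](bigD1 i)//= cinvM cmulA.
  have cQ2 : {for (s i, t i), continuous (fun w => cmul (Q w) (cinv (\big[@cmul R/cone R]_(r | r != i) L r w)))}.
    apply: cont_cmul => //.
    by apply: cont_cinv; [apply: cont_prod => r _; exact: L_cont|exact: Pi0].
  have h := cvg_trans (near_eq_cvg nE) cQ2.
  have E : G (s i, t i) = cmul (Q (s i, t i)) (cinv (\big[@cmul R/cone R]_(r | r != i) L r (s i, t i))).
    by rewrite Gi /Q eqxx cmul1.
  by rewrite /prop_for /continuous_at E; exact: h.
- move=> z zu; have [[i ->]|zn] := zP z; first by rewrite Gi cinv_neq0.
  rewrite Gn//; apply: cmul_neq0; last by apply: cinv_neq0; exact: P0.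
  by apply/eqP => /(F0 zu)[i zi]; move: (zn i); rewrite zi eqxx.
- move=> z zu; have [[i ->]|zn] := zP z.
    rewrite (FE i)/= !subrr !scale0r subr0 (bigD1 i)//= /L/= !subrr /lin !scale0r subr0.
    by rewrite /cmul/= !(mul0r, mulr0, subr0, addr0).
  by rewrite Gn// -cmulA [cmul (cinv _) _]cmulC cmulV ?P0// cmulC cmul1.
- by move=> i; rewrite Gi cmulC cmulV.
Qed.

End Exists.
End Quotient.

(** * Angles along the sides of the square and along lines *)

Section Pencil.
Variable R : realType.
Implicit Types (z w u v q : R * R).

(** Strict convexity: twice the scalar product is [|q - z|^2 + |q - ctr|^2 - |z - ctr|^2], and the
    last difference is nonnegative. *)
Lemma disk_convex (ctr : R * R) (rad : R) q z : disk_boundary ctr rad q -> disk ctr rad z ->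
  z != q -> 0 < dot (q - ctr) (q - z).
Proof.
rewrite /disk_boundary /disk /dot/= => qb zd zq.
have : q - z != 0 by rewrite subr_eq0 eq_sym.
move=> /dot_gt0; rewrite /dot/=; nra.
Qed.

(** Leaving the interval would mean passing through one of its ends, where the sine vanishes. *)
Lemma window (th : R -> R) (c x y : R) : continuous th ->
  (forall a, Num.min x y <= a <= Num.max x y -> 0 < sin (th a - c)) ->
  c < th x < c + pi -> c < th y < c + pi.
Proof.
move=> cth hs hx.
have noval (v : R) : v = c \/ v = c + pi -> ~ (Num.min (th x) (th y) <= v <= Num.max (th x) (th y)).
  move=> hv hm.
  have [a ha av] : exists2 a, Num.min x y <= a <= Num.max x y & th a = v.
    have [xy|/ltW xy] := leP x y.
      have [||a] := @IVT R th x y v xy => //; first exact: continuous_subspaceT.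
      by rewrite in_itv/=; exists a.
    have [||a] := @IVT R th y x v xy => //; first exact: continuous_subspaceT.
      by rewrite minC maxC.
    by rewrite in_itv/=; exists a.
  have := hs _ ha; rewrite av; case: hv => ->.
    by rewrite subrr sin0 ltxx.
  by rewrite addrAC subrr add0r sinpi ltxx.
have h1 := noval c (or_introl erefl); have h2 := noval (c + pi) (or_intror erefl).
have [d1|d1] := ltP c (th y); last first.
  case: h1; case: (leP (th x) (th y)) => h; apply/andP; split; move: hx; lra.
have [d2|d2] := ltP (th y) (c + pi); first by apply/andP; split.
case: h2; case: (leP (th x) (th y)) => h; apply/andP; split; move: hx; lra.
Qed.

(* The vectors from points of the disk to the boundary point g e lie in an open
   half plane, so both families of angles fit in one window of length pi; the
   factor 2 e - 1 makes the parameter difference positive at either end. *)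
Lemma pencil (g h : R -> R * R) (ctr : R * R) (rad e : R) (th : R * R -> R) :
  proper_embedding ctr rad g -> e = 0 \/ e = 1 ->
  (forall b, b \in `[0, 1]%R -> {for b, continuous h}) ->
  (forall b, b \in `[0, 1]%R -> disk ctr rad (h b)) ->
  (forall b, b \in `[0, 1]%R -> h b != g e) ->
  continuous th -> (forall z, unit_square z -> isarg (chord g z) (th z)) ->
  exists y c, [/\ continuous y,
    forall b, b \in `[0, 1]%R -> isarg ((2 * e - 1) *: (g e - h b)) (y b) /\ c < y b < c + pi &
    forall a, a \in `[0, 1]%R -> a != e ->
      isarg ((2 * e - 1) *: (g e - g a)) (th (a, e)) /\ c < th (a, e) < c + pi].
Proof.
move=> pg e01 ch hd hne cth hth.
have e01' : e \in `[0, 1]%R by rewrite in_itv/=; lra.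
set sg := 2 * e - 1.
have bnd : disk_boundary ctr rad (g e) by apply/(pe_proper pg) => //; lra.
(* [w] is [N] turned back by a right angle: a positive determinant with [w] means lying on the side
   of [N]. *)
pose N := sg *: (g e - ctr); pose w : R * R := (N.2, - N.1).
have dw z : det w z = dot N z by rewrite /det /dot/=; ring.
have dN z : dot N (sg *: z) = dot (g e - ctr) z.
  rewrite /N /dot/= /GRing.scale/=.
  have -> : sg = 1 \/ sg = -1 -> sg * ((g e).1 - ctr.1) * (sg * z.1) +
     sg * ((g e).2 - ctr.2) * (sg * z.2) = ((g e).1 - ctr.1) * z.1 + ((g e).2 - ctr.2) * z.2.
    by case=> ->; ring.
  by [].
  by rewrite /sg; case: e01 => ->; [right|left]; ring.
have dpos z : disk ctr rad z -> z != g e -> 0 < det w (sg *: (g e - z)).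
  by move=> zd zn; rewrite dw dN; exact: disk_convex zd zn.
have gpos a : a \in `[0, 1]%R -> a != e -> 0 < det w (sg *: (g e - g a)).
  move=> a01 ae; apply: dpos; first exact: (pe_disk pg).
  by apply: contra_neq ae; exact: (pe_inj pg).
have garg a : a \in `[0, 1]%R -> a != e -> isarg (sg *: (g e - g a)) (th (a, e)).
  move=> a01 ae; rewrite chordE scalerA; apply: isarg_scale; last exact: hth.
  by move: a01 ae; rewrite in_itv/= /sg; case: e01 => -> /andP[a0 a1];
    rewrite neq_lt => /orP[]; lra.
pose e' := 1 - e.
have e'01 : e' \in `[0, 1]%R by rewrite in_itv/= /e'; lra.
have e'e : e' != e by rewrite /e'; case: e01 => ->; rewrite ?subr0 ?subrr ?oner_eq0// eq_sym oner_eq0.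
have w0 : w != 0.
  apply: contraTneq (gpos _ e'01 e'e) => ->.
  by rewrite /det/= !mul0r subrr ltxx.
have [c0 wc0] := isarg_exists w0.
(* The argument [c] of [w] is chosen with [th (e', e) - c] in [(0, 2 * pi]]; the positive sine then
   confines this difference to [(0, pi)]. *)
have [k hk] := shift_int (th (e', e) - 2 * pi) c0.
have wc1 := isarg_int k wc0.
set c := c0 + _ in hk wc1.
have spos a : a \in `[0, 1]%R -> a != e -> 0 < sin (th (a, e) - c).
  by move=> a01 ae; rewrite -(det_gt0_sin wc1 (garg _ a01 ae)); exact: gpos.
have base : c < th (e', e) < c + pi.
  have pi0 := pi_gt0 R.
  have s0 := spos _ e'01 e'e.
  have n1 : th (e', e) - c != 0 by apply: contraTneq s0 => ->; rewrite sin0 ltxx.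
  have [h1|h1] := ltP (th (e', e) - c) pi.
    rewrite -subr_gt0 in n1 *; move: n1; rewrite neq_lt; move: hk; lra.
  have : 0 <= sin (th (e', e) - c - pi) by apply: sin_ge0_pi; move: hk; lra.
  by rewrite sinB cospi sinpi mulr0 subr0 mulrN1; lra.
have [||y cy hy] := @halfplane_lift R (fun b => sg *: (g e - h b)) w c _ _ wc1.
- move=> b b01; have hb := ch _ b01.
  have cc (r : R -> R) (x0 : R) : {for b, continuous r} -> {for b, continuous (fun b => sg * (x0 - r b))}.
    by move=> hr; apply: cont_mul; [exact: cst_continuous|apply: cont_add; [exact: cst_continuous|exact: cont_opp]].
  have := cont_pair (cc _ (g e).1 (cont_fst hb)) (cc _ (g e).2 (cont_snd hb)); exact.
- by move=> b b01; apply: dpos; [exact: hd|exact: hne].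
exists y, c; split => // a a01 ae; split; first exact: garg.
apply: (window (th := fun a => th (a, e)) (x := e')) => //.
  apply: cont_all => x; apply: (continuous_comp (f := fun a => (a, e))); last exact: cth.
  by apply: cont_pair; [exact: cvg_id|exact: cst_continuous].
move=> x hx; apply: spos.
  by move: hx a01 e'01; rewrite !in_itv/=; case: (leP e' a); lra.
move: hx ae a01; rewrite in_itv/= /e'; case: e01 => ->; rewrite ?subr0 ?subrr.
  case: (leP 1 a) => h1 h2 ae h3; rewrite gt_eqF//; move: ae; rewrite neq_lt; lra.
case: (leP 0 a) => h1 h2 ae h3; rewrite lt_eqF//; move: ae; rewrite neq_lt; lra.
Qed.

(** The sum of the arguments of the factors is an argument of the product. It differs from [th] by a
    multiple of [2 * pi], which is constant by continuity. *)
Lemma line_const (I : finType) (P : pred I) (X Gf : R -> R * R) (Lr : I -> R -> R * R)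
    (th ga : R -> R) (la : I -> R -> R) u al :
  continuous th -> continuous ga -> (forall i, P i -> continuous (la i)) ->
  isarg u al ->
  (forall a, a \in `[0, 1]%R -> isarg (X a) (th a)) ->
  (forall a, a \in `[0, 1]%R -> isarg (Gf a) (ga a)) ->
  (forall i a, P i -> isarg (Lr i a) (la i a)) ->
  (forall a, a \in `[0, 1]%R ->
     X a = cmul (cmul (Gf a) u) (\big[@cmul R/cone R]_(i | P i) Lr i a)) ->
  exists k : int, forall a, a \in `[0, 1]%R ->
    th a = al + 2 * pi * k%:~R + ga a + \sum_(i | P i) la i a.
Proof.
move=> cth cga cla ua hX hG hL XE.
pose f a := th a - ga a - \sum_(i | P i) la i a.
have hf a : a \in `[0, 1]%R -> exists k : int, f a = al + 2 * pi * k%:~R.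
  move=> a01; have := hX _ a01; rewrite XE// => h.
  have h2 : isarg (cmul (cmul (Gf a) u) (\big[@cmul R/cone R]_(i | P i) Lr i a))
      (ga a + al + \sum_(i | P i) la i a).
    apply: isarg_mul; first by apply: isarg_mul => //; exact: hG.
    by apply: isarg_prod => i Pi; exact: hL.
  have [k kE] := isarg_uniq h2 h; exists k; rewrite /f kE; ring.
have cf : continuous f.
  apply: cont_all => a; apply: cont_add; [apply: cont_add; [exact: cth|apply: cont_opp; exact: cga]|].
  by apply: cont_opp; apply: cont_sum => i Pi; exact: cla.
have z01 : (0 : R) \in `[0, 1]%R by rewrite in_itv/= lexx ler01.
have [k kE] := hf _ z01; exists k => a a01.
have := lift_const cf hf a01 z01; rewrite kE /f; lra.
Qed.

(** Two arguments in a window of length [pi] differ by less than [pi], so their difference has the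
    sign of its sine, hence of the determinant. *)
Lemma same_window z w (a b c : R) : isarg z a -> isarg w b -> c < a < c + pi -> c < b < c + pi ->
  (0 < det z w -> 0 < b - a < pi) /\ (det z w < 0 -> - pi < b - a < 0).
Proof.
move=> za wb ha hb; have [r r0 ->] := det_isarg za wb.
rewrite pmulr_rgt0// pmulr_rlt0//; split => s0.
  have [h|h] := ltP 0 (b - a); first by lra.
  have : 0 <= sin (- (b - a)) by apply: sin_ge0_pi; lra.
  by rewrite sinN; lra.
have [h|h] := ltP (b - a) 0; first by lra.
have : 0 <= sin (b - a) by apply: sin_ge0_pi; lra.
lra.
Qed.

End Pencil.

(** * Relations between the crossing signs *)

(* e is the sign of the crossings and o the orientation of the four boundary
   points. The first relation compares the bottom and the top side of the
   square along the vertical line through a crossing, the second one the left and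
   the right side along the horizontal line, and the third one the two points
   where the lines through crossings i and j meet. *)
Lemma winding_relations (R : realType) (n : nat) (mu ell : R -> R * R) (ctr : R * R) (rad : R)
    (s t : 'I_n -> R) :
  proper_embedding ctr rad mu -> proper_embedding ctr rad ell ->
  (forall i, 0 < s i < 1) -> (forall i, 0 < t i < 1) -> injective s -> injective t ->
  (forall i, mu (s i) = ell (t i)) ->
  (forall a b : R, a \in `[0, 1]%R -> b \in `[0, 1]%R -> mu a = ell b ->
    exists i, a = s i /\ b = t i) ->
  (forall i, det (mu^`() (s i)) (ell^`() (t i)) != 0) ->
  0 < det (ell 0 - mu 0) (mu 1 - mu 0) * det (ell 0 - mu 0) (ell 1 - mu 0) ->
  exists (e : 'I_n -> int) (o : int),
  [/\ forall i, e i = 1 \/ e i = -1,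
      o = 1 \/ o = -1,
      forall j, e j + 2 * (\sum_r e r * (s j < s r)%R%:R) = 2 * (\sum_r e r) - o,
      forall i, e i + 2 * (\sum_r e r * (t r < t i)%R%:R) = o &
      forall i j, i != j ->
        2 * (\sum_r e r * ((s j < s r) && (t r < t i))%R%:R)
          + e j * (t j < t i)%R%:R + e i * (s j < s i)%R%:R =
        2 * (\sum_r e r * ((s i < s r) && (t r < t j))%R%:R)
          + e i * (t i < t j)%R%:R + e j * (s i < s j)%R%:R].
Proof.
move=> pm pl s01 t01 s_inj t_inj mst zeros D0 orient.
have pi0 := pi_gt0 R.
have z01 : (0 : R) \in `[0, 1]%R by rewrite in_itv/= lexx ler01.
have o01 : (1 : R) \in `[0, 1]%R by rewrite in_itv/= lexx ler01.
have s01' i : s i \in `[0, 1]%R by rewrite in_itv/=; have := s01 i; lra.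
have t01' i : t i \in `[0, 1]%R by rewrite in_itv/=; have := t01 i; lra.
have sm : smooth mu by exact: (pe_smooth pm).
have sl : smooth ell by exact: (pe_smooth pl).
have cmu (a : R) : {for a, continuous mu} by exact: (derivable_cont (sm 0%N a)).
have cell (a : R) : {for a, continuous ell} by exact: (derivable_cont (sl 0%N a)).
have ccm := chord_continuous sm.
have ccl := chord_continuous sl.
have [thm cthm hthm] := square_lift (fun z _ => ccm z) (fun z => @chord_neq0 R ctr rad mu z pm).
have [thl cthl hthl] := square_lift (fun z _ => ccl z) (fun z => @chord_neq0 R ctr rad ell z pl).
pose F z := mu z.1 - ell z.2.
pose h1 i a := chord mu (s i, a); pose h2 i b := chord ell (t i, b).
have horiz (U : topologicalType) (f : R * R -> U) y : continuous f -> continuous (fun a : R => f (a, y)).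
  move=> cf; apply: cont_all => a; apply: (continuous_comp (f := fun a : R => (a, y))); last exact: cf.
  by apply: cont_pair; [exact: cvg_id|exact: cst_continuous].
have verti (U : topologicalType) (f : R * R -> U) x : continuous f -> continuous (fun b : R => f (x, b)).
  move=> cf; apply: cont_all => a; apply: (continuous_comp (f := fun a : R => (x, a))); last exact: cf.
  by apply: cont_pair; [exact: cst_continuous|exact: cvg_id].
have cF : continuous F.
  apply: cont_all => z; apply: continuousB.
    by apply: (continuous_comp (f := fst)); [exact: cvg_fst|exact: cmu].
  by apply: (continuous_comp (f := snd)); [exact: cvg_snd|exact: cell].
have ch1 i : continuous (h1 i) by exact: (verti _ (chord mu) (s i) ccm).
have ch2 i : continuous (h2 i) by exact: (verti _ (chord ell) (t i) ccl).
(* Both curves pass through crossing [i], so [F] is a difference of two displacements from that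
   common point. *)
have FE i z : F z = (z.1 - s i) *: h1 i z.1 - (z.2 - t i) *: h2 i z.2.
  by rewrite -!chordE mst opprB addrA subrK.
have D0' i : det (h1 i (s i)) (h2 i (t i)) != 0 by rewrite /h1 /h2 !chord_diag.
have F0 z : unit_square z -> F z = 0 -> exists i, z = (s i, t i).
  case: z => a b [/= a01 b01] /eqP; rewrite subr_eq0 => /eqP /(zeros _ _ a01 b01)[i [-> ->]].
  by exists i.
have [G [cG G0 GE G1]] := quotient_exists cF s_inj ch1 ch2 FE D0' F0.
have [gam cgam hgam] := square_lift cG G0.
pose L i z := lin (h1 i (s i)) (h2 i (t i)) (z.1 - s i) (z.2 - t i).
pose al i := thm (s i, s i); pose be i := thl (t i, t i).
have ua i : isarg (h1 i (s i)) (al i) by apply: hthm; split; exact: s01'.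
have vb i : isarg (h2 i (t i)) (be i) by apply: hthl; split; exact: t01'.
have [b hb] := choice (fun i => linear_lift (ua i) (vb i) (D0' i)).
have [e he] := choice hb; have [lh hlh] := choice he; have {hb he hlh}[lv ll] := choice hlh.
have hline (P : pred 'I_n) (y : R) (X : R -> R * R) (th : R -> R) (u : R * R) (a0 : R) : y \in `[0, 1]%R -> (forall r, P r -> t r != y) ->
    continuous th -> isarg u a0 -> (forall a, a \in `[0, 1]%R -> isarg (X a) (th a)) ->
    (forall a, a \in `[0, 1]%R -> X a = cmul (cmul (G (a, y)) u) (\big[@cmul R/cone R]_(r | P r) L r (a, y))) ->
    exists k : int, forall a, a \in `[0, 1]%R ->
      th a = a0 + 2 * pi * k%:~R + gam (a, y) + \sum_(r | P r) lh r (a - s r) (y - t r).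
  move=> y01 yt cth u0 hX XE.
  apply: (line_const (Gf := fun a => G (a, y)) (ga := fun a => gam (a, y))
    (Lr := fun r a => L r (a, y)) (la := fun r a => lh r (a - s r) (y - t r)) cth _ _ u0 hX _ _ XE).
  - exact: horiz.
  - move=> r Pr; have yr : y - t r != 0 by rewrite subr_eq0 eq_sym yt.
    apply: cont_all => a; apply: (continuous_comp (f := fun a => a - s r) (g := lh r ^~ (y - t r))).
      by apply: cont_add; [exact: cvg_id|exact: cst_continuous].
    exact: (ll_hcont (ll r) yr).
  - by move=> a a01; apply: hgam.
  - by move=> r a Pr; apply: (ll_h (ll r)); rewrite subr_eq0 eq_sym yt.
have vline (P : pred 'I_n) (x : R) (X : R -> R * R) (th : R -> R) (u : R * R) (a0 : R) : x \in `[0, 1]%R -> (forall r, P r -> s r != x) ->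
    continuous th -> isarg u a0 -> (forall a, a \in `[0, 1]%R -> isarg (X a) (th a)) ->
    (forall a, a \in `[0, 1]%R -> X a = cmul (cmul (G (x, a)) u) (\big[@cmul R/cone R]_(r | P r) L r (x, a))) ->
    exists k : int, forall a, a \in `[0, 1]%R ->
      th a = a0 + 2 * pi * k%:~R + gam (x, a) + \sum_(r | P r) lv r (x - s r) (a - t r).
  move=> x01 xs cth u0 hX XE.
  apply: (line_const (Gf := fun a => G (x, a)) (ga := fun a => gam (x, a))
    (Lr := fun r a => L r (x, a)) (la := fun r a => lv r (x - s r) (a - t r)) cth _ _ u0 hX _ _ XE).
  - exact: verti.
  - move=> r Pr; have xr : x - s r != 0 by rewrite subr_eq0 eq_sym xs.
    apply: cont_all => a; apply: (continuous_comp (f := fun a => a - t r) (g := lv r (x - s r))).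
      by apply: cont_add; [exact: cvg_id|exact: cst_continuous].
    exact: (ll_vcont (ll r) xr).
  - by move=> a a01; apply: hgam.
  - by move=> r a Pr; apply: (ll_v (ll r)); rewrite subr_eq0 eq_sym xs.
have cZ (k : R) (z w : R * R) : k *: cmul z w = cmul (k *: z) w.
  case: z w => z1 z2 [w1 w2]; rewrite /cmul/= /GRing.scale/= /scale_pair/= /GRing.scale/=.
  by congr pair; ring.
(* On the horizontal line through crossing [i], [F] and its factor [L i] both carry the scalar
   [a - s i]. Cancelling it expresses the chord of [mu]; at [a = s i] the normalization [G1] gives
   the same formula. [V] treats chords of [ell] likewise. *)
have H i : exists k : int, forall a, a \in `[0, 1]%R ->
    thm (s i, a) = al i + 2 * pi * k%:~R + gam (a, t i) + \sum_(r | r != i) lh r (a - s r) (t i - t r).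
  apply: (hline _ _ (h1 i) (fun a => thm (s i, a)) _ _ (t01' i)) (ua i) _ _.
  - by move=> r; apply: contra_neq; exact: t_inj.
  - exact: verti.
  - by move=> a a01; apply: hthm; split => //; exact: s01'.
  - move=> a a01; have [->|asi] := eqVneq a (s i).
      by rewrite -cmulA [cmul (h1 _ _) _]cmulC cmulA G1 cmul1.
    have au : unit_square (a, t i) by split => //; exact: t01'.
    have asi' : a - s i != 0 by rewrite subr_eq0.
    have := GE _ au; rewrite (FE i)/= subrr scale0r subr0 (bigD1 i)//= subrr /lin scale0r subr0.
    move=> /(congr1 (fun z => (a - s i)^-1 *: z)); rewrite scalerA mulVf// scale1r => ->.
    rewrite cmulA cZ; congr (cmul _ _).
    by rewrite cmulC [LHS]cZ scalerA mulVf// scale1r cmulC.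
have V j : exists k : int, forall a, a \in `[0, 1]%R ->
    thl (t j, a) = be j + 2 * pi * k%:~R + gam (s j, a) + \sum_(r | r != j) lv r (s j - s r) (a - t r).
  apply: (vline _ _ (h2 j) (fun a => thl (t j, a)) _ _ (s01' j)) (vb j) _ _.
  - by move=> r; apply: contra_neq; exact: s_inj.
  - exact: verti.
  - by move=> a a01; apply: hthl; split => //; exact: t01'.
  - move=> a a01; have [->|atj] := eqVneq a (t j).
      by rewrite -cmulA [cmul (h2 _ _) _]cmulC cmulA G1 cmul1.
    have au : unit_square (s j, a) by split => //; exact: s01'.
    have atj' : - (a - t j) != 0 by rewrite oppr_eq0 subr_eq0.
    have := GE _ au; rewrite (FE j)/= subrr scale0r sub0r (bigD1 j)//= subrr /lin scale0r sub0r -!scaleNr.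
    move=> /(congr1 (fun z => (- (a - t j))^-1 *: z)); rewrite scalerA mulVf// scale1r => ->.
    rewrite cmulA cZ; congr (cmul _ _).
    by rewrite cmulC [LHS]cZ scalerA mulVf// scale1r cmulC.
have [ka Hk] := choice H; have [kb Vk] := choice V.
have mu_ell x y : x \in `[0, 1]%R -> y \in `[0, 1]%R -> (forall i, x != s i) \/ (forall i, y != t i) -> mu x != ell y.
  move=> x01 y01 xy; apply/eqP => /(zeros _ _ x01 y01)[i [xi yi]].
  by case: xy => /(_ i); rewrite ?xi ?yi eqxx.
have s0 i : 0 != s i by have /andP[h _] := s01 i; rewrite lt_eqF.
have s1 i : 1 != s i by have /andP[_ h] := s01 i; rewrite gt_eqF.
have t0 i : 0 != t i by have /andP[h _] := t01 i; rewrite lt_eqF.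
have t1 i : 1 != t i by have /andP[_ h] := t01 i; rewrite gt_eqF.
have dmu a : a \in `[0, 1]%R -> disk ctr rad (mu a) by exact: (pe_disk pm).
have dell a : a \in `[0, 1]%R -> disk ctr rad (ell a) by exact: (pe_disk pl).
have sg1 z : (2 * 1 - 1) *: z = z :> R * R.
  have -> : 2 * 1 - 1 = 1 :> R by ring.
  by rewrite scale1r.
have sg0 z : (2 * 0 - 1) *: z = - z :> R * R.
  have -> : 2 * 0 - 1 = -1 :> R by ring.
  by rewrite scaleN1r.
(* [y0] and [y1] are angles along the left and right sides of the square, [x0] and [x1] along the
   bottom and top. Each window also holds the angles of the chords at the endpoint concerned. *)
have [|y0 [c0 [cy0 hy0 hm0]]] := pencil pm (or_introl erefl) (fun b _ => cell b) dell _ cthm hthm.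
  by move=> a a01; rewrite eq_sym; apply: mu_ell => //; left.
have [|y1 [c1 [cy1 hy1 hm1]]] := pencil pm (or_intror erefl) (fun b _ => cell b) dell _ cthm hthm.
  by move=> a a01; rewrite eq_sym; apply: mu_ell => //; left.
have [|x0 [d0 [cx0 hx0 hp0]]] := pencil pl (or_introl erefl) (fun b _ => cmu b) dmu _ cthl hthl.
  by move=> a a01; apply: mu_ell => //; right.
have [|x1 [d1 [cx1 hx1 hp1]]] := pencil pl (or_intror erefl) (fun b _ => cmu b) dmu _ cthl hthl.
  by move=> a a01; apply: mu_ell => //; right.
have iy0 y : y \in `[0, 1]%R -> isarg (ell y - mu 0) (y0 y) /\ c0 < y0 y < c0 + pi.
  by move=> y01; have := hy0 _ y01; rewrite sg0 opprB.
have iy1 y : y \in `[0, 1]%R -> isarg (mu 1 - ell y) (y1 y) /\ c1 < y1 y < c1 + pi.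
  by move=> y01; have := hy1 _ y01; rewrite sg1.
have ix0 x : x \in `[0, 1]%R -> isarg (mu x - ell 0) (x0 x) /\ d0 < x0 x < d0 + pi.
  by move=> x01; have := hx0 _ x01; rewrite sg0 opprB.
have ix1 x : x \in `[0, 1]%R -> isarg (ell 1 - mu x) (x1 x) /\ d1 < x1 x < d1 + pi.
  by move=> x01; have := hx1 _ x01; rewrite sg1.
have im0 x : x \in `[0, 1]%R -> x != 0 -> isarg (mu x - mu 0) (thm (x, 0)) /\ c0 < thm (x, 0) < c0 + pi.
  by move=> x01 xn; have := hm0 _ x01 xn; rewrite sg0 opprB.
have im1 x : x \in `[0, 1]%R -> x != 1 -> isarg (mu 1 - mu x) (thm (x, 1)) /\ c1 < thm (x, 1) < c1 + pi.
  by move=> x01 xn; have := hm1 _ x01 xn; rewrite sg1.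
have ip0 y : y \in `[0, 1]%R -> y != 0 -> isarg (ell y - ell 0) (thl (y, 0)) /\ d0 < thl (y, 0) < d0 + pi.
  by move=> y01 yn; have := hp0 _ y01 yn; rewrite sg0 opprB.
have ip1 y : y \in `[0, 1]%R -> y != 1 -> isarg (ell 1 - ell y) (thl (y, 1)) /\ d1 < thl (y, 1) < d1 + pi.
  by move=> y01 yn; have := hp1 _ y01 yn; rewrite sg1.
have near_eq (z : R * R) (a1 a2 c : R) : isarg z a1 /\ c < a1 < c + pi -> isarg z a2 /\ c < a2 < c + pi -> a1 = a2.
  move=> [h3 h4] [h5 h6]; apply: isarg_near h5 h3 _; rewrite ltr_norml; move: h4 h6 pi0; clear; lra.
(* At a crossing the vector along a side is also a chord at the same endpoint, and two arguments of
   one vector in one window agree. *)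
have ey0 i : y0 (t i) = thm (s i, 0).
  by apply: near_eq (iy0 _ (t01' i)) _; rewrite -mst; apply: im0; rewrite // eq_sym.
have ey1 i : y1 (t i) = thm (s i, 1).
  by apply: near_eq (iy1 _ (t01' i)) _; rewrite -mst; apply: im1; rewrite // eq_sym.
have ex0 i : x0 (s i) = thl (t i, 0).
  by apply: near_eq (ix0 _ (s01' i)) _; rewrite mst; apply: ip0; rewrite // eq_sym.
have ex1 i : x1 (s i) = thl (t i, 1).
  by apply: near_eq (ix1 _ (s01' i)) _; rewrite mst; apply: ip1; rewrite // eq_sym.
have FG z : unit_square z -> F z = cmul (cmul (G z) (cone R)) (\big[@cmul R/cone R]_(r | predT r) L r z).
  by move=> zu; rewrite GE// [cmul _ (cone R)]cmulC cmul1.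
have cadd (f : R -> R) c : continuous f -> continuous (fun x => f x + c).
  by move=> cf; apply: cont_all => x; apply: cont_add; [exact: cf|exact: cst_continuous].
have [k1 K1] : exists k : int, forall y, y \in `[0, 1]%R ->
    y1 y = 0 + 2 * pi * k%:~R + gam (1, y) + \sum_(r | predT r) lv r (1 - s r) (y - t r).
  apply: (vline predT 1 (fun y => F (1, y)) y1 (cone R) 0 o01 _ cy1 (@isarg_one R)).
  - by move=> r _; rewrite eq_sym.
  - by move=> y /iy1[].
  - by move=> y y01; apply: FG.
(* Here [y0] is an angle of [- F], hence the extra [pi]. *)
have [k0 K0] : exists k : int, forall y, y \in `[0, 1]%R ->
    y0 y + pi = 0 + 2 * pi * k%:~R + gam (0, y) + \sum_(r | predT r) lv r (0 - s r) (y - t r).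
  apply: (vline predT 0 (fun y => F (0, y)) (fun y => y0 y + pi) (cone R) 0 z01 _ _ (@isarg_one R)).
  - by move=> r _; rewrite eq_sym.
  - exact: cadd.
  - by move=> y /iy0[h _]; rewrite /F/= -opprB; exact: isarg_opp.
  - by move=> y y01; apply: FG.
have [l0 C0] : exists k : int, forall x, x \in `[0, 1]%R ->
    x0 x = 0 + 2 * pi * k%:~R + gam (x, 0) + \sum_(r | predT r) lh r (x - s r) (0 - t r).
  apply: (hline predT 0 (fun x => F (x, 0)) x0 (cone R) 0 z01 _ cx0 (@isarg_one R)).
  - by move=> r _; rewrite eq_sym.
  - by move=> x /ix0[].
  - by move=> x x01; apply: FG.
have [l1 C1] : exists k : int, forall x, x \in `[0, 1]%R ->
    x1 x + pi = 0 + 2 * pi * k%:~R + gam (x, 1) + \sum_(r | predT r) lh r (x - s r) (1 - t r).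
  apply: (hline predT 1 (fun x => F (x, 1)) (fun x => x1 x + pi) (cone R) 0 o01 _ _ (@isarg_one R)).
  - by move=> r _; rewrite eq_sym.
  - exact: cadd.
  - by move=> x /ix1[h _]; rewrite /F/= -opprB; exact: isarg_opp.
  - by move=> x x01; apply: FG.
(* Signed count of the crossings with [x < s r] and [t r < y]. These are the factors whose two lifts
   differ by the extra turn [e r] of [ll_vh], so replacing all [lv] by [lh] at [(x, y)] costs this
   count. *)
pose Eps x y : R := \sum_r (e r)%:~R * ((x < s r) && (t r < y))%:R.
have conv (P : pred 'I_n) x y : (forall r, P r -> x != s r /\ y != t r) ->
    (forall r, ~~ P r -> x = s r \/ y = t r) ->
    \sum_(r | P r) lv r (x - s r) (y - t r) = \sum_(r | P r) lh r (x - s r) (y - t r)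
      + 2 * pi * (\sum_(r | P r) (b r)%:~R + Eps x y).
  move=> h3 h4.
  have -> : Eps x y = \sum_(r | P r) (e r)%:~R * ((x < s r) && (t r < y))%:R.
    rewrite /Eps (bigID P)/= [X in _ + X]big1 ?addr0// => r /h4.
    by case=> ->; rewrite ltxx ?andbF mulr0.
  rewrite -big_split/= mulr_sumr -big_split/=; apply: eq_bigr => r Pr.
  have [xr yr] := h3 _ Pr.
  by rewrite (ll_vh (ll r)) ?subr_eq0// subr_lt0 subr_gt0.
pose B : R := \sum_r (b r)%:~R.
have Bi i : B = (b i)%:~R + \sum_(r | r != i) (b r)%:~R by rewrite /B (bigD1 i).
have sgt0 i : (s i < 0) = false by have := s01 i; case: ltP => //; lra.
have sgt1 i : (1 < s i) = false by have := s01 i; case: ltP => //; lra.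
have sl1 i : s i < 1 by have /andP[] := s01 i.
have sl0 i : 0 < s i by have /andP[] := s01 i.
have tl1 i : t i < 1 by have /andP[] := t01 i.
have tgt0 i : (t i < 0) = false by have := t01 i; case: ltP => //; lra.
have tgt1 i : (1 < t i) = false by have := t01 i; case: ltP => //; lra.
have sne i r : r != i -> s i != s r by rewrite eq_sym; apply: contra_neq; exact: s_inj.
have tne i r : r != i -> t i != t r by rewrite eq_sym; apply: contra_neq; exact: t_inj.
have inI (P : pred 'I_n) i : ~~ (i != i) by rewrite eqxx.
have EpsR y : Eps 1 y = 0 by rewrite /Eps big1// => r _; rewrite sgt1 mulr0.
have EpsB x : Eps x 0 = 0 by rewrite /Eps big1// => r _; rewrite tgt0 andbF mulr0.
(* The integer belonging to a line through a crossing is computed at both ends of the line, from the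
   sides of the square reached there. Equating the two values yields the first two relations. *)
have ka1 i : 2 * pi * (ka i)%:~R = 2 * pi * k1%:~R + 2 * pi * B :> R.
  have := Hk i _ o01; have := K1 _ (t01' i); rewrite ey1 (bigD1 i)//= subrr.
  rewrite (ll_v0 (ll i)) ?subr_eq0// subr_lt0 sgt1 mulr0 addr0.
  rewrite (conv (fun r => r != i) 1 (t i)); last 2 first.
  - by move=> r ri; split; [exact: s1|exact: tne].
  - by move=> r; rewrite negbK => /eqP ->; right.
  by rewrite EpsR (Bi i); lra.
have ka0 i : 2 * pi * (ka i)%:~R = 2 * pi * k0%:~R - pi + 2 * pi * B + (e i)%:~R * pi + 2 * pi * Eps 0 (t i) :> R.
  have := Hk i _ z01; have := K0 _ (t01' i); rewrite ey0 (bigD1 i)//= subrr.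
  rewrite (ll_v0 (ll i)) ?subr_eq0// subr_lt0 sl0 mulr1.
  rewrite (conv (fun r => r != i) 0 (t i)); last 2 first.
  - by move=> r ri; split; [exact: s0|exact: tne].
  - by move=> r; rewrite negbK => /eqP ->; right.
  by rewrite (Bi i); clear; lra.
have kb0 j : 2 * pi * (kb j)%:~R = 2 * pi * l0%:~R - 2 * pi * B :> R.
  have := Vk j _ z01; have := C0 _ (s01' j); rewrite ex0 (bigD1 j)//= subrr.
  rewrite (ll_h0 (ll j)) ?subr_eq0// subr_gt0 tgt0 mulr0 subr0.
  rewrite (conv (fun r => r != j) (s j) 0); last 2 first.
  - by move=> r ri; split; [exact: sne|exact: t0].
  - by move=> r; rewrite negbK => /eqP ->; left.
  by rewrite EpsB (Bi j); lra.
have kb1 j : 2 * pi * (kb j)%:~R = 2 * pi * l1%:~R - pi - 2 * pi * B - (e j)%:~R * pi - 2 * pi * Eps (s j) 1 :> R.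
  have := Vk j _ o01; have := C1 _ (s01' j); rewrite ex1 (bigD1 j)//= subrr.
  rewrite (ll_h0 (ll j)) ?subr_eq0// subr_gt0 tl1 mulr1.
  rewrite (conv (fun r => r != j) (s j) 1); last 2 first.
  - by move=> r ri; split; [exact: sne|exact: t1].
  - by move=> r; rewrite negbK => /eqP ->; left.
  by rewrite (Bi j); clear; lra.
(* At a corner two sides meet, which ties [k0] and [k1] to [l0] and [l1]. *)
have E00 : y0 0 + pi - x0 0 = 2 * pi * k0%:~R - 2 * pi * l0%:~R + 2 * pi * B.
  have := K0 _ z01; have := C0 _ z01; rewrite (conv predT 0 0); last 2 first.
  - by move=> r _; split.
  - by [].
  rewrite EpsB.
  by rewrite -/B; clear; lra.
have E10 : y1 0 - x0 1 = 2 * pi * k1%:~R - 2 * pi * l0%:~R + 2 * pi * B.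
  have := K1 _ z01; have := C0 _ o01; rewrite (conv predT 1 0); last 2 first.
  - by move=> r _; split.
  - by [].
  rewrite EpsB.
  by rewrite -/B; clear; lra.
pose S : R := \sum_r (e r)%:~R.
have E01 : y0 1 - x1 0 = 2 * pi * k0%:~R - 2 * pi * l1%:~R + 2 * pi * B + 2 * pi * S.
  have := K0 _ o01; have := C1 _ z01; rewrite (conv predT 0 1); last 2 first.
  - by move=> r _; split.
  - by [].
  have -> : Eps 0 1 = S by rewrite /Eps /S; apply: eq_bigr => r _; rewrite sl0 tl1 mulr1.
  by rewrite -/B; clear; lra.
(* As [chord] is symmetric, the two angles differ by a multiple of [2 * pi], constant on the way
   from the diagonal, where it is 0. *)
have chsym (g : R -> R * R) (th : R * R -> R) x y : continuous th ->
    (forall z, unit_square z -> isarg (chord g z) (th z)) ->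
    x \in `[0, 1]%R -> y \in `[0, 1]%R -> th (x, y) = th (y, x).
  move=> cth hth x01 y01.
  pose p a := x + a * (y - x).
  have cp : continuous p.
    apply: cont_all => a; apply: cont_add; first exact: cst_continuous.
    by apply: cont_mul; [exact: cvg_id|exact: cst_continuous].
  have p01 a : a \in `[0, 1]%R -> p a \in `[0, 1]%R.
    move: x01 y01; rewrite !in_itv/= /p; clear => /andP[? ?] /andP[? ?] /andP[? ?]; apply/andP; split; nra.
  have cf : continuous (fun a => th (x, p a) - th (p a, x)).
    apply: cont_all => a; apply: cont_add; [|apply: cont_opp].
      by apply: (continuous_comp (f := p) (g := fun y => th (x, y))); [exact: cp|exact: verti].
    by apply: (continuous_comp (f := p) (g := fun y => th (y, x))); [exact: cp|exact: horiz].
  have := lift_const cf (c := 0) _ o01 z01.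
  have -> : p 1 = y by rewrite /p; ring.
  have -> : p 0 = x by rewrite /p; ring.
  rewrite subrr => h; apply/eqP; rewrite -subr_eq0; apply/eqP/h => a a01.
  have [k kE] := @isarg_uniq R _ _ _ (hth (p a, x) (conj (p01 _ a01) x01))
    (eq_ind_r (fun z => isarg z _) (hth (x, p a) (conj x01 (p01 _ a01))) (chordC g (p a) x)).
  by exists k; rewrite kE; ring.
have thm01 := chsym mu thm 0 1 cthm hthm z01 o01.
have thl01 := chsym ell thl 0 1 cthl hthl z01 o01.
(* The angles of the triangle [mu 0], [mu 1], [ell 0] will show that [o] is the sign of [Dm]; those
   of [mu 0], [ell 0], [ell 1] determine [l1 - l0] in the same way from the sign of [Dp], equal to
   that of [Dm]. *)
pose o : int := 2 * (k1 - k0) + 1.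
pose Dm := det (ell 0 - mu 0) (mu 1 - mu 0).
pose Dp := det (ell 0 - mu 0) (ell 1 - mu 0).
have oE : o%:~R = 2 * (k1%:~R - k0%:~R) + 1 :> R.
  by rewrite /o rmorphD/= rmorphM/= rmorphB.
have o10 : (1 : R) != 0 by exact: oner_neq0.
have o10' : (0 : R) != 1 by rewrite eq_sym.
have win z w (a1 a2 c : R) : isarg z a1 /\ c < a1 < c + pi -> isarg w a2 /\ c < a2 < c + pi ->
    (0 < det z w -> 0 < a2 - a1 < pi) /\ (det z w < 0 -> - pi < a2 - a1 < 0).
  by move=> [h3 h4] [h5 h6]; exact: same_window h3 h5 h4 h6.
have := win _ _ _ _ _ (iy0 _ z01) (im0 _ o01 o10).
rewrite -/Dm => -[d1p d1n].
have := win _ _ _ _ _ (im1 _ z01 o10') (iy1 _ z01).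
have -> : det (mu 1 - mu 0) (mu 1 - ell 0) = Dm by rewrite /Dm /det/=; ring.
move=> [d2p d2n].
have := win _ _ _ _ _ (ix0 _ z01) (ix0 _ o01).
have -> : det (mu 0 - ell 0) (mu 1 - ell 0) = - Dm by rewrite /Dm /det/=; ring.
rewrite oppr_gt0 oppr_lt0 => -[d3n d3p].
have := win _ _ _ _ _ (iy0 _ z01) (iy0 _ o01).
rewrite -/Dp => -[e1p e1n].
have := win _ _ _ _ _ (ix0 _ z01) (ip0 _ o01 o10).
have -> : det (mu 0 - ell 0) (ell 1 - ell 0) = - Dp by rewrite /Dp /det/=; ring.
rewrite oppr_gt0 oppr_lt0 => -[e2n e2p].
have := win _ _ _ _ _ (ip1 _ z01 o10') (ix1 _ z01).
have -> : det (ell 1 - ell 0) (ell 1 - mu 0) = - Dp by rewrite /Dp /det/=; ring.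
rewrite oppr_gt0 oppr_lt0 => -[e3n e3p].
have Sint : S = (\sum_r e r)%:~R by rewrite /S rmorph_sum.
have oS : 2 * (l1%:~R - l0%:~R) = 2 * S - o%:~R + 1 :> R /\ (o = 1 \/ o = -1).
  have kl1 (h : - (2 * pi) < 2 * pi * (k1%:~R - k0%:~R : R) < 2 * pi) : k1 - k0 = 0.
    by apply: (@int_near R _ (2 * pi * (k1 - k0)%:~R) erefl); rewrite rmorphB.
  have kl2 (h : - (2 * pi) < 2 * pi * (k1%:~R - k0%:~R + 1 : R) < 2 * pi) : k1 - k0 + 1 = 0.
    by apply: (@int_near R _ (2 * pi * (k1 - k0 + 1)%:~R) erefl); rewrite rmorphD/= rmorphB.
  have kl3 (h : - (2 * pi) < 2 * pi * (l0%:~R - l1%:~R + S) < 2 * pi) : l0%:~R - l1%:~R + S = 0 :> R.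
    rewrite Sint -rmorphB/= -rmorphD/=.
    suff -> : l0 - l1 + \sum_r e r = 0 by [].
    by apply: (@int_near R _ (2 * pi * (l0 - l1 + \sum_r e r)%:~R) erefl); rewrite rmorphD/= rmorphB/= -Sint.
  have kl4 (h : - (2 * pi) < 2 * pi * (l0%:~R - l1%:~R + S + 1) < 2 * pi) : l0%:~R - l1%:~R + S + 1 = 0 :> R.
    rewrite Sint -rmorphB/= -rmorphD/= -[X in _ + X]/(1%:~R) -rmorphD/=.
    suff -> : l0 - l1 + \sum_r e r + 1 = 0 by [].
    by apply: (@int_near R _ (2 * pi * (l0 - l1 + \sum_r e r + 1)%:~R) erefl); rewrite !rmorphD/= rmorphN/= -Sint.
  have [Dmp|Dmn] := ltP 0 Dm.
    have Dpp : 0 < Dp by move: orient; rewrite -/Dm -/Dp pmulr_rgt0.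
    have kk : k1 - k0 = 0.
      apply: kl1; move: (d1p Dmp) (d2p Dmp) (d3p Dmp) E00 E10 thm01 pi0; clear; lra.
    have ll0 := kl3 ltac:(move: (e1p Dpp) (e2p Dpp) (e3p Dpp) E00 E01 thl01 pi0; clear; lra).
    have kkR : k1%:~R - k0%:~R = 0 :> R by rewrite -rmorphB/= kk.
    rewrite oE kkR /o kk; split; [move: ll0; clear; lra|by left].
  have {}Dmn : Dm < 0.
    by rewrite lt_neqAle Dmn andbT; apply: contraTneq orient; rewrite -/Dm => ->; rewrite mul0r ltxx.
  have Dpn : Dp < 0 by move: orient; rewrite -/Dm -/Dp nmulr_rgt0.
  have kk : k1 - k0 + 1 = 0.
    apply: kl2; move: (d1n Dmn) (d2n Dmn) (d3n Dmn) E00 E10 thm01 pi0; clear; lra.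
  have ll0 := kl4 ltac:(move: (e1n Dpn) (e2n Dpn) (e3n Dpn) E00 E01 thl01 pi0; clear; lra).
  have {}kk : k1 - k0 = -1 by move: kk; clear; lia.
  have kkR : k1%:~R - k0%:~R = -1 :> R by rewrite -rmorphB/= kk rmorphN.
  rewrite oE kkR /o kk; split; [move: ll0; clear; lra|by right].
have piI (x y : R) : pi * x = pi * y -> x = y by move/mulfI; apply; rewrite gt_eqF.
case: oS => oS oo; have castE (f : 'I_n -> bool) : (\sum_r e r * (f r)%:R)%:~R = \sum_r (e r)%:~R * (f r)%:R :> R.
  by rewrite rmorph_sum/=; apply: eq_bigr => r _; rewrite rmorphM/= rmorph_nat.
exists e, o; split => //.
- by move=> i; exact: (ll_sign (ll i)).
- move=> j; apply: (@intr_inj R).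
  rewrite rmorphB/= rmorphD/= !rmorphM/= castE -Sint.
  have -> : \sum_r (e r)%:~R * (s j < s r)%R%:R = Eps (s j) 1 :> R.
    by apply: eq_bigr => r _; rewrite tl1 andbT.
  by apply: piI; have := kb0 j; have := kb1 j; have := congr1 (fun x => pi * x) oS; rewrite /=; clear; lra.
- move=> i; apply: (@intr_inj R).
  rewrite rmorphD/= !rmorphM/= castE.
  have -> : \sum_r (e r)%:~R * (t r < t i)%R%:R = Eps 0 (t i) :> R.
    by apply: eq_bigr => r _; rewrite sl0.
  by rewrite oE; apply: piI; have := ka0 i; have := ka1 i; clear; lra.
- move=> i j ij; apply: (@intr_inj R).
  have ji : j != i by rewrite eq_sym.
  rewrite !rmorphD/= !rmorphM/= !castE !rmorph_nat.
  (* Both lines through [(s j', t i')] are evaluated at this point, and subtracting removes the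
     angle of [G]. The left side is symmetric in the two crossings by [chsym], so the right side is
     too: this is the third relation. *)
  have key i' j' : i' != j' ->
      thm (s i', s j') - thl (t j', t i') =
      2 * pi * k1%:~R - 2 * pi * l0%:~R + 2 * pi * B
      - pi * (2 * Eps (s j') (t i') + (e j')%:~R * (t j' < t i')%R%:R + (e i')%:~R * (s j' < s i')%R%:R).
    move=> ij'; have ji' : j' != i' by rewrite eq_sym.
    have := Hk i' _ (s01' j'); have := Vk j' _ (t01' i').
    rewrite (bigD1 i')//= [in X in _ -> X -> _](bigD1 j')//= !subrr.
    rewrite (ll_v0 (ll i')) ?subr_eq0 ?sne// (ll_h0 (ll j')) ?subr_eq0 ?tne//.
    rewrite subr_lt0 subr_gt0.
    rewrite (conv (fun r => (r != j') && (r != i')) (s j') (t i')); last 2 first.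
    - by move=> r /andP[h3 h4]; split; [exact: sne|exact: tne].
    - by move=> r; rewrite negb_and !negbK => /orP[/eqP ->|/eqP ->]; [left|right].
    have -> : \sum_(r | (r != i') && (r != j')) lh r (s j' - s r) (t i' - t r) =
      \sum_(r | (r != j') && (r != i')) lh r (s j' - s r) (t i' - t r).
      by apply: eq_bigl => r; rewrite andbC.
    have BE : B = (b j')%:~R + ((b i')%:~R + \sum_(r | (r != j') && (r != i')) (b r)%:~R).
      by rewrite (Bi j') (bigD1 i').
    have := ka1 i'; have := kb0 j'; have := congr1 (fun x => pi * x) BE; rewrite /=.
    clear; lra.
  have := key i j ij; have := key j i ji.
  rewrite (chsym mu thm _ _ cthm hthm (s01' j) (s01' i)) (chsym ell thl _ _ cthl hthl (t01' j) (t01' i)).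
  move=> h3 h4; apply: piI; rewrite -/(Eps (s j) (t i)) -/(Eps (s i) (t j)); move: h3 h4; clear; lra.
Qed.

(** * The square of the inversion matrix *)

Section Comb.
Variables (n : nat) (pi : 'S_n).
Implicit Types i j r : 'I_n.

Definition below i j : nat := (\sum_(r < n) ((r < i) && (pi r < pi j)))%N.

Lemma sum_ltn m : (m <= n)%N -> (\sum_(r < n) (r < m) = m)%N.
Proof.
move=> mn; transitivity (\sum_(r < n | r < m) 1)%N.
  by rewrite [RHS]big_mkcond; apply: eq_bigr => r _; case: (_ < _)%N.
by rewrite -(big_ord_widen n (fun=> 1%N) mn) sum1_card card_ord.
Qed.

Lemma sum_perm_ltn m : (m <= n)%N -> (\sum_(r < n) (pi r < m) = m)%N.
Proof. by move=> mn; rewrite -[RHS](sum_ltn mn) [RHS](reindex_inj (@perm_inj _ pi)). Qed.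

Lemma natF2 (a b : nat) : (a%:R = b%:R :> 'F_2) <-> odd a = odd b.
Proof.
have H (k : nat) : k%:R = (odd k : nat)%:R :> 'F_2.
  rewrite -[in LHS](odd_double_half k) natrD -muln2 natrM.
  have -> : 2%:R = 0 :> 'F_2 by apply: val_inj.
  by rewrite mulr0 addr0.
rewrite (H a) (H b); split => [|->//].
by case: (odd a); case: (odd b).
Qed.

Definition inverted i j : bool := ((i < j) && (pi j < pi i) || (j < i) && (pi i < pi j))%N.

Lemma inversion_mxE i j : inversion_mx pi i j = (inverted i j : nat)%:R.
Proof.
rewrite mxE /inverted; case: ltngtP => //= _; first by rewrite orbF.
Qed.

Lemma invertedC i j : inverted i j = inverted j i.
Proof. by rewrite /inverted orbC. Qed.

Lemma inverted_sum i r : odd ((r < i) + (pi r < pi i)) = inverted i r.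
Proof.
rewrite /inverted; case: (ltngtP i r) => ir /=.
- by rewrite orbF add0n; case: (_ < _)%N.
- have: pi r != pi i by rewrite (inj_eq perm_inj) neq_ltn ir.
  by rewrite -val_eqE neq_ltn /= => /orP[] h; rewrite h ltnNge ltnW.
- by have -> : i = r :> 'I_n; [exact: val_inj|rewrite ltnn].
Qed.

(** Modulo 2 the indicator of an inversion between [i] and [r] is [(r < i) + (pi r < pi i)]. The
    product of two such sums expands into four counts over [r], two of which are minima. *)
Lemma inversion_sqP : (inversion_mx pi ^+ 2 = inversion_mx pi)%R <->
  forall i j, odd (minn i j + minn (pi i) (pi j) + below i j + below j i) = inverted i j.
Proof.
have E i j : (inversion_mx pi ^+ 2)%R i j =
    (minn i j + minn (pi i) (pi j) + below i j + below j i)%:R.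
  rewrite expr2 mxE.
  transitivity ((\sum_(r < n) ((r < i) + (pi r < pi i)) * ((r < j) + (pi r < pi j)))%N%:R : 'F_2).
    rewrite natr_sum; apply: eq_bigr => r _; rewrite !inversion_mxE -natrM.
    by apply/natF2; rewrite !oddM !oddb !inverted_sum [inverted r j]invertedC.
  congr (_%:R).
  have -> : minn i j = (\sum_(r < n) ((r < i) && (r < j)))%N.
    rewrite -[LHS]sum_ltn ?(leq_trans (geq_minl _ _))//; last exact: ltnW.
    by apply: eq_bigr => r _; rewrite leq_min.
  have -> : minn (pi i) (pi j) = (\sum_(r < n) ((pi r < pi i) && (pi r < pi j)))%N.
    rewrite -[LHS]sum_perm_ltn ?(leq_trans (geq_minl _ _))//; last exact: ltnW.
    by apply: eq_bigr => r _; rewrite leq_min.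
  rewrite /below -!big_split/=; apply: eq_bigr => r _.
  by case: (r < i)%N; case: (r < j)%N; case: (pi r < pi i)%N; case: (pi r < pi j)%N.
split => [H i j|H].
  have := congr1 (fun A : 'M['F_2]_n => A i j) H; rewrite E inversion_mxE => /natF2 ->.
  by rewrite oddb.
by apply/matrixP => i j; rewrite E inversion_mxE; apply/natF2; rewrite H oddb.
Qed.

(** Replacing every sign by 1 changes the sum by an even number. *)
Lemma signed_count (e : 'I_n -> int) (f : 'I_n -> bool) : (forall i, e i = 1 \/ e i = -1) ->
  exists X : int, \sum_r e r * (f r)%:R = ((\sum_r f r)%N%:Z - 2 * X)%R.
Proof.
move=> he; pose x r : int := if e r == 1 then 0 else 1.
exists (\sum_r x r * (f r)%:R).
rewrite mulr_sumr -natz natr_sum -sumrB; apply: eq_bigr => r _.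
rewrite /x; case: (he r) => ->; case: (f r); rewrite ?eqxx //=.
Qed.

(** Modulo 4 the first two relations give [e i] as [o + 2 i] and as [o + 2 pi i], so [pi] preserves
    parity. With these values the third one, halved, becomes the parity condition of
    [inversion_sqP]. *)
Lemma relations_idempotent (e : 'I_n -> int) (o : int) :
  (forall i, e i = 1 \/ e i = -1) -> o = 1 \/ o = -1 ->
  (forall j, e j + 2 * (\sum_r e r * (j < r)%N%:R) = 2 * (\sum_r e r) - o) ->
  (forall i, e i + 2 * (\sum_r e r * (pi r < pi i)%N%:R) = o) ->
  (forall i j, i != j ->
        2 * (\sum_r e r * ((j < r)%N && (pi r < pi i)%N)%:R)
          + e j * (pi j < pi i)%N%:R + e i * (j < i)%N%:R =
        2 * (\sum_r e r * ((i < r)%N && (pi r < pi j)%N)%:R)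
          + e i * (pi i < pi j)%N%:R + e j * (i < j)%N%:R) ->
  inversion_mx pi ^+ 2 = inversion_mx pi.
Proof.
move=> he ho E1 E2 E3; apply/inversion_sqP.
have S1 j : (\sum_(r < n) (j < r) + j.+1 = n)%N.
  rewrite -[X in (_ + X)%N](@sum_ltn j.+1)// -big_split/=.
  transitivity (\sum_(r < n) 1)%N; last by rewrite sum1_card card_ord.
  by apply: eq_bigr => r _; rewrite ltnS; case: ltngtP.
have S2 i : (\sum_(r < n) (pi r < pi i) = pi i)%N by rewrite sum_perm_ltn// ltnW.
have P1 j : exists X : int, e j = o + 2 * j%:Z + 4 * X.
  have [X XE] := signed_count (fun r => (j < r)%N) he.
  have [Y YE] := signed_count predT he.
  have := E1 j; rewrite XE.
  have -> : \sum_r e r = \sum_r e r * (predT r)%:R by apply: eq_bigr => r _; rewrite mulr1.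
  rewrite YE; have -> : (\sum_(r < n) predT r = n)%N by rewrite sum1_card card_ord.
  have := S1 j; set a := (\sum_(r < n) _)%N => an En.
  (* Substitution leaves [2 - o], which is [o] for [o = 1] and [o + 4] for [o = -1]. *)
  exists (X - Y + (o == -1)%:R); move: an En; case: ho => ->; rewrite ?eqxx /=; clear; lia.
have P2 i : exists X : int, e i = o + 2 * (pi i)%:Z + 4 * X.
  have [X XE] := signed_count (fun r => (pi r < pi i)%N) he.
  exists (X - (pi i)%:Z); have := E2 i; rewrite XE S2; clear; lia.
have par i : odd (pi i) = odd i.
  by have [X X1] := P1 i; have [Y Y1] := P2 i; move: X1; rewrite Y1; clear; lia.
(* The values below [pi i] are sorted by position: after, before or at [j]. This converts the counts
   of the third relation into [below]. *)
have D i j : (\sum_(r < n) ((j < r) && (pi r < pi i)) + below j i + (pi j < pi i) = pi i)%N.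
  rewrite -[RHS]S2 /below -big_split/= [RHS](bigD1 j)//= [in LHS](bigD1 j)//= !ltnn/= add0n addnC.
  congr (_ + _)%N; apply: eq_bigr => r rj.
  have : (r < j)%N || (j < r)%N by rewrite -neq_ltn.
  by case: ltngtP => // _ _; case: (_ < _)%N.
have main i j : (i < j)%N -> odd (minn i j + minn (pi i) (pi j) + below i j + below j i) = inverted i j.
  move=> ij; have ne : i != j by rewrite -val_eqE/= neq_ltn ij.
  have pne : (pi i != pi j :> nat) by rewrite val_eqE (inj_eq perm_inj).
  have [X XE] := signed_count (fun r => (j < r)%N && (pi r < pi i)%N) he.
  have [Y YE] := signed_count (fun r => (i < r)%N && (pi r < pi j)%N) he.
  have := E3 i j ne; rewrite XE YE /inverted [(j < i)%N]ltnNge (ltnW ij) ij /=.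
  have := D i j; have := D j i; set d1 := (\sum_(r < n) _)%N; set d2 := (\sum_(r < n) _)%N.
  have [Z ZE] := P1 i; have [T TE] := P1 j.
  have := par i; have := par j; rewrite ZE TE.
  move: ij pne ho; clear; case: (ltngtP (pi i) (pi j)) => //= pij ij _ [->|->]; lia.
move=> i j; have [ij|] := boolP (i < j)%N; first exact: main.
rewrite -leqNgt leq_eqVlt => /orP[/eqP ij|ij]; last first.
  by rewrite invertedC -main// minnC [minn (pi _) _]minnC -!addnA [(below j i + _)%N]addnC.
have -> : j = i by exact: val_inj.
rewrite /inverted ltnn/= !minnn -addnA addnn oddD odd_double addbF oddD par.
by case: (odd i).
Qed.

End Comb.

(** * Meanders give idempotent matrices *)

Section Forward.
Variable R : realType.
Implicit Types (z w u v q : R * R).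

(** With [d] and [e] collinear, equality of the three distances to [c] forces
    [k * (k - dot d d) = 0]; the two roots are the two ends of the chord. *)
Lemma circle_chord (c : R * R) (r : R) q q' z : disk_boundary c r q -> disk_boundary c r q' ->
  disk_boundary c r z -> q != q' -> det (q' - q) (z - q) = 0 -> z = q \/ z = q'.
Proof.
rewrite /disk_boundary/= => qb q'b zb qq' d0.
set d := q' - q; set e := z - q.
have D0 : 0 < dot d d by apply: dot_gt0; rewrite subr_eq0 eq_sym.
pose k := dot d e.
have ee : dot e e * dot d d = k ^+ 2.
  have -> : k ^+ 2 = dot e e * dot d d - det d e ^+ 2 by rewrite /k /dot /det; ring.
  by rewrite d0 expr0n subr0.
have e2 : dot e e = - 2 * dot e (q - c) by move: qb zb; rewrite /e /dot/=; nra.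
have d2 : dot d d = - 2 * dot d (q - c) by move: qb q'b; rewrite /d /dot/=; nra.
have ek : dot e (q - c) * dot d d = k * dot d (q - c).
  have -> : dot e (q - c) * dot d d = k * dot d (q - c) + det d e * det d (q - c).
    by rewrite /k /dot /det; ring.
  by rewrite d0 mul0r addr0.
have kk : k * (k - dot d d) = 0.
  by rewrite mulrBr -expr2 -ee {1}e2 [in X in _ - X]d2 -mulrA ek; ring.
have z0 w : dot w w = 0 -> w = 0.
  by move=> w0; apply/eqP; rewrite -[_ == _]negbK; apply/negP => /dot_gt0; rewrite w0 ltxx.
move/eqP: kk; rewrite mulf_eq0 => /orP[/eqP k0|/eqP kD].
  left; apply/eqP; rewrite -subr_eq0; apply/eqP/z0.
  by move/eqP: ee; rewrite k0 expr0n mulf_eq0 (gt_eqF D0) orbF => /eqP.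
right; apply/eqP; rewrite -subr_eq0; apply/eqP/z0.
have {}kD : k = dot d d by apply/eqP; rewrite -subr_eq0 kD.
have eD : dot e e = dot d d.
  by apply: (mulIf (lt0r_neq0 D0)); rewrite ee kD expr2.
have -> : z - q' = e - d by rewrite /e /d opprB addrA subrK.
have -> : dot (e - d) (e - d) = dot e e - 2 * k + dot d d by rewrite /k /dot/=; ring.
by rewrite eD kD; ring.
Qed.

(** On the circle the determinant vanishes at [q] and [q'] only, so its sign is constant on a
    connected part of the rest. This turns the topological condition on the endpoints into an
    inequality. *)
Lemma component_orient (c : R * R) (r : R) q q' z z' x :
  let B := disk_boundary c r `\` [set q; q'] in
  disk_boundary c r q -> disk_boundary c r q' -> q != q' -> B x ->
  connected_component B x z -> connected_component B x z' ->
  0 < det (q' - q) (z - q) * det (q' - q) (z' - q).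
Proof.
move=> B qb q'b qq' Bx Cz Cz'.
pose f w := det (q' - q) (w - q).
have cf : continuous f.
  apply: cont_all => w; apply: cont_det; first exact: cst_continuous.
  by apply: continuousB; [exact: cvg_id|exact: cst_continuous].
have CB := @connected_component_sub _ B x.
have f0 w : connected_component B x w -> f w != 0.
  move=> /CB[wb]; rewrite /= not_orP => -[wq wq'].
  by apply/eqP => /(circle_chord qb q'b wb qq')[].
have fC : connected (f @` connected_component B x).
  apply: connected_continuous_connected; first exact: component_connected.
  exact: continuous_subspaceT.
have I := (connected_intervalP _).1 fC.
have fz := f0 _ Cz; have fz' := f0 _ Cz'.
rewrite -/(f z) -/(f z') lt_neqAle eq_sym mulf_neq0//= leNgt; apply/negP.
have I0 w w' : connected_component B x w -> connected_component B x w' -> f w < 0 -> 0 < f w' -> False.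
  move=> Cw Cw' w0 w0'.
  have Aw : (f @` connected_component B x) (f w) by exists w.
  have Aw' : (f @` connected_component B x) (f w') by exists w'.
  have w00 : f w <= 0 <= f w' by rewrite (ltW w0) (ltW w0').
  have [p Cp fp] := I _ _ Aw Aw' 0 w00.
  by have := f0 _ Cp; rewrite fp eqxx.
move=> neg; case: (ltgtP (f z) 0) fz neg => // h _.
  by rewrite nmulr_rlt0// => h'; exact: I0 Cz Cz' h h'.
by rewrite pmulr_rlt0// => h'; exact: I0 Cz' Cz h' h.
Qed.

Lemma det_comb u v (a b : R) : det u (a *: u + b *: v) = b * det u v.
Proof. by rewrite /det/=/GRing.scale/=; ring. Qed.

Lemma det_eq0 u : (forall w, det u w = 0) -> u = 0.
Proof.
move=> key; have := key (1, 0); have := key (0, 1).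
rewrite /det/= !mulr0 !mulr1 subr0 sub0r => h1 /eqP; rewrite oppr_eq0 => /eqP h2.
by case: u h1 h2 {key} => ? ? /= -> ->.
Qed.

Lemma transverse_det (g h : R -> R * R) (s t : R) : transverse g h ->
  s \in `[0, 1]%R -> t \in `[0, 1]%R -> g s = h t -> g^`() s != 0 -> det (g^`() s) (h^`() t) != 0.
Proof.
move=> tr s01 t01 gh; apply: contraNN => /eqP d0.
have key w : det (g^`() s) w = 0.
  have [a [b ->]] := tr _ _ s01 t01 gh w.
  rewrite det_comb.
  by rewrite d0 mulr0.
exact/eqP/det_eq0.
Qed.

Lemma meandric_idempotent (n : nat) (pi : 'S_n) : meandric R pi ->
  (inversion_mx pi ^+ 2 = inversion_mx pi)%R.
Proof.
move=> [m [P [Q [[rP [tl [tl01 tlm PE]]] [rQ [sm [sm01 smm QE]]] QP]]]].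
set mu := mu m in QE rQ rP *; set ell := ell m in PE rQ rP *.
have pm := mu_embedding m; have pl := ell_embedding m; rewrite -/mu -/ell in pm pl.
(* Crossings are indexed by position along [mu]; their order along [ell] is then the order of the
   labels [pi i]. *)
pose t i := tl (pi i).
have mst i : mu (sm i) = ell (t i) by rewrite -QE QP PE.
have uniq4 := points_uniq m; rewrite /= !inE !negb_or !andbA andbT in uniq4.
move: uniq4 => /andP[/andP[/andP[/andP[/andP[m01 m0p0] m0p1] m1p0] m1p1] p01].
have mu0 : mu 0 = m0 m := mu_0 m. have mu1 : mu 1 = m1 m := mu_1 m.
have el0 : ell 0 = p0 m := ell_0 m. have el1 : ell 1 = p1 m := ell_1 m.
have i01 (f : 'I_n -> R) : {homo f : i j / (i < j)%N >-> i < j} -> {mono f : i j / (i < j)%N >-> i < j}.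
  move=> fm i j; have [ij|] := boolP (i < j)%N; first exact: fm.
  rewrite -leqNgt leq_eqVlt => /orP[/eqP/val_inj->|/fm ji]; first by rewrite ltxx.
  by apply/negbTE; rewrite -leNgt ltW.
have smo := i01 _ smm; have tlo := i01 _ tlm.
have inj (f : 'I_n -> R) : {mono f : i j / (i < j)%N >-> i < j} -> injective f.
  by move=> fm i j fij; case: (ltngtP i j) => [| |/val_inj//]; rewrite -fm fij ltxx.
have smi := inj _ smo; have tli := inj _ tlo.
have bnd (g : R -> R * R) : proper_embedding (Defs.center m) (Defs.radius m) g ->
    disk_boundary (Defs.center m) (Defs.radius m) (g 0) /\ disk_boundary (Defs.center m) (Defs.radius m) (g 1).
  by move=> pg; split; apply/(pe_proper pg); rewrite ?in_itv/= ?lexx ?ler01//; [left|right].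
have [bm0 bm1] := bnd _ pm; have [bl0 bl1] := bnd _ pl.
(* A crossing at an end of one curve would be on the circle, hence an end of the other curve as
   well; but the four ends are distinct. *)
have strict (g h : R -> R * R) a b : proper_embedding (Defs.center m) (Defs.radius m) h ->
    a \in `[0, 1]%R -> b \in `[0, 1]%R -> g a = h b ->
    disk_boundary (Defs.center m) (Defs.radius m) (g 0) -> disk_boundary (Defs.center m) (Defs.radius m) (g 1) ->
    g 0 != h 0 -> g 0 != h 1 -> g 1 != h 0 -> g 1 != h 1 -> 0 < a < 1.
  move=> ph a01 b01 gh b0 b1 n00 n01 n10 n11.
  have an0 : a != 0.
    apply/eqP => a0; move: b0; rewrite -[in g 0]a0 gh => /(pe_proper ph b01)[]bE.
      by move: n00; rewrite -[in g 0]a0 gh bE eqxx.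
    by move: n01; rewrite -[in g 0]a0 gh bE eqxx.
  have an1 : a != 1.
    apply/eqP => a0; move: b1; rewrite -[in g 1]a0 gh => /(pe_proper ph b01)[]bE.
      by move: n10; rewrite -[in g 1]a0 gh bE eqxx.
    by move: n11; rewrite -[in g 1]a0 gh bE eqxx.
  by move: a01; rewrite in_itv/= !le_eqVlt eq_sym (negbTE an0) (negbTE an1).
have s01 i : 0 < sm i < 1.
  by apply: (strict mu ell _ (t i)) => //; rewrite ?mu0 ?mu1 ?el0 ?el1//; exact: tl01.
have t01 i : 0 < t i < 1.
  apply: (strict ell mu _ (sm i)) => //; rewrite ?mu0 ?mu1 ?el0 ?el1// 1?eq_sym//; exact: tl01.
have zeros a b : a \in `[0, 1]%R -> b \in `[0, 1]%R -> mu a = ell b ->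
    exists i, a = sm i /\ b = t i.
  move=> a01 b01 ab.
  have : intersection mu ell (mu a) by split; [exists a|exists b; rewrite ?ab].
  rewrite -rQ => -[i _ Qi]; exists i; split.
    by apply: (pe_inj pm) => //; rewrite -Qi QE.
  by apply: (pe_inj pl) => //; [exact: tl01|rewrite -ab -Qi QE mst].
have D0 i : det (mu^`() (sm i)) (ell^`() (t i)) != 0.
  apply: transverse_det => //; [exact: mu_ell_transverse|exact: tl01|exact: (pe_immersion pm)].
have ori : 0 < det (ell 0 - mu 0) (mu 1 - mu 0) * det (ell 0 - mu 0) (ell 1 - mu 0).
  have [x Bx [h1 h2]] := m1_p1_component m.
  rewrite mu0 mu1 el0 el1 in bm0 bl0 *.
  exact: (component_orient bm0 bl0 m0p0 Bx h1 h2).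
have [e [sgn [he ho E1 E2 E3]]] := winding_relations pm pl s01 t01 smi (inj_comp tli perm_inj) mst zeros D0 ori.
apply: (relations_idempotent he ho).
- by move=> j; rewrite -(E1 j); congr (_ + 2 * _); apply: eq_bigr => r _; rewrite smo.
- by move=> i; rewrite -(E2 i); congr (_ + 2 * _); apply: eq_bigr => r _; rewrite /t tlo.
- move=> i j ij; have := E3 i j ij; rewrite /t !smo !tlo.
  under eq_bigr do rewrite smo tlo; under [in X in _ = X -> _]eq_bigr do rewrite smo tlo.
  exact.
Qed.

End Forward.

(** * Noncrossing arcs *)

Section Noncrossing.
Variables (n : nat) (pi : 'S_n).

(* The permutation with labels shifted by one, fixing the extra labels 0 and
   n + 1 of the two ends of the curve. *)
Definition ext (k : nat) : nat :=
  if k is k'.+1 then (if insub k' is Some i then (pi (i : 'I_n)).+1 else n.+1) else 0%N.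

Arguments ext : simpl never.

Lemma ext0 : ext 0 = 0%N. Proof. by []. Qed.

Lemma extS (i : 'I_n) : ext i.+1 = (pi i).+1.
Proof. by rewrite /ext valK. Qed.

Lemma ext_last : ext n.+1 = n.+1.
Proof. by rewrite /ext insubF ?ltnn. Qed.

Lemma extP k : (k <= n.+1)%N -> [\/ k = 0%N, (exists2 i : 'I_n, k = i.+1 & ext k = (pi i).+1) | k = n.+1].
Proof.
case: k => [_|k]; first by apply: Or31.
rewrite ltnS leq_eqVlt => /orP[/eqP ->|kn]; first by apply: Or33.
by apply: Or32; exists (Ordinal kn) => //; rewrite -[k.+1]/(Ordinal kn).+1 extS.
Qed.

Lemma ext_inj k l : (k <= n.+1)%N -> (l <= n.+1)%N -> ext k = ext l -> k = l.
Proof.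
move=> /extP[->|[i -> ->]|->] /extP[->|[j -> ->]|->]; rewrite ?ext0 ?ext_last //.
- by move=> [ij]; rewrite (perm_inj (ord_inj ij)).
- by move=> [ij]; have := ltn_ord (pi i); rewrite ij ltnn.
- by move=> [ij]; have := ltn_ord (pi j); rewrite -ij ltnn.
Qed.

Definition ebelow i j : nat := (\sum_(r < i) (ext r < ext j))%N.

Lemma ebelowS i j : ebelow i.+1 j = (ebelow i j + (ext i < ext j))%N.
Proof. by rewrite /ebelow big_ord_recr. Qed.

(** The extra 1 counts position 0, whose label 0 is below all others. *)
Lemma ebelow_ord (i j : 'I_n) : ebelow i.+1 j.+1 = (below pi i j).+1.
Proof.
rewrite /ebelow big_ord_recl /= ext0 extS add1n; congr _.+1.
rewrite (big_ord_widen n (fun r => (ext r.+1 < (pi j).+1) : nat)%N (ltnW (ltn_ord i))).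
rewrite big_mkcond /below; apply: eq_bigr => r _.
by rewrite extS ltnS; case: (r < i)%N.
Qed.

Definition einv i j : bool := ((i < j) && (ext j < ext i) || (j < i) && (ext i < ext j))%N.

Hypothesis idem : (inversion_mx pi ^+ 2 = inversion_mx pi)%R.

Lemma perm_parity (i : 'I_n) : odd (pi i) = odd i.
Proof.
have /inversion_sqP/(_ i i) := idem.
rewrite /inverted ltnn/= !minnn -addnA addnn oddD odd_double addbF oddD.
by case: (odd i); case: (odd (pi i)).
Qed.

Lemma ext_parity k : (k <= n.+1)%N -> odd (ext k) = odd k.
Proof. by move=> /extP[->|[i -> ->]|->]//=; rewrite ?ext_last// perm_parity. Qed.

(** As [pi] preserves parity, the two minima of [inversion_sqP] have even sum unless the pair is
    inverted, when they contribute [i + j]. Pairs with an extra position obey the same rule by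
    direct counting. *)
Lemma ebelow_parity i j : (i <= n.+1)%N -> (j <= n.+1)%N ->
  odd (ebelow i j + ebelow j i) = einv i j && ~~ odd (i + j).
Proof.
move=> ik jk.
have e0 j' : ebelow 0 j' = 0%N by rewrite /ebelow big_ord0.
have e1 i' : ebelow i' 0 = 0%N by rewrite /ebelow big1.
have e2 j' : (j' <= n)%N -> ebelow j' n.+1 = j'.
  move=> jn; rewrite /ebelow -[RHS]card_ord -sum1_card; apply: eq_bigr => r _.
  have rn : (r <= n.+1)%N by have := ltn_ord r; lia.
  have := ltn_ord r; case: (extP rn) => [->|[i' -> ->]|->]; rewrite ext_last ?ltnS ?ltn_ord//; lia.
have e3 j' : (j' <= n)%N -> ebelow n.+1 j' = ext j'.
  move=> jn; have jn' : (j' <= n.+1)%N by lia.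
  case: (extP jn') => [->|[i' -> ->]|jE]; first by rewrite e1.
    rewrite /ebelow big_ord_recl/= ext0 extS add1n; congr _.+1.
    rewrite -[RHS](@sum_perm_ltn n pi)//; last exact/ltnW/ltn_ord.
    by apply: eq_bigr => r _; rewrite extS ltnS.
  by move: jn; rewrite jE ltnn.
have last k : (k <= n)%N -> odd (ebelow k n.+1 + ebelow n.+1 k) = false /\ einv k n.+1 = false.
  move=> kn; have kn' : (k <= n.+1)%N by lia.
  rewrite e2// e3// oddD ext_parity// addbb; split=> //.
  rewrite /einv ext_last [(n.+1 < k)%N]ltnNge kn' orbF.
  case: (extP kn') => [->|[i' _ ->]|kE]; first by rewrite ext0 andbF.
    have -> : (n.+1 < (pi i').+1)%N = false by rewrite ltnS ltnNge (ltnW (ltn_ord _)).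
    by rewrite andbF.
  by move: kn; rewrite kE ltnn.
have einvC i' j' : einv i' j' = einv j' i' by rewrite /einv orbC.
have [iE|iN] := eqVneq i n.+1.
  have [jE|jN] := eqVneq j n.+1; first by rewrite iE jE addnn odd_double /einv ltnn.
  have [|h1 h2] := last j; first by lia.
  by rewrite iE addnC h1 einvC h2.
have [jE|jN] := eqVneq j n.+1.
  have [|h1 h2] := last i; first by lia.
  by rewrite jE h1 h2.
case: (extP ik) => [->|[i' iE iE']|iE]; last by rewrite iE eqxx in iN.
  by rewrite e0 e1 /einv ext0 !ltn0 !andbF.
case: (extP jk) => [->|[j' jE jE']|jE]; last by rewrite jE eqxx in jN.
  by rewrite e0 e1 /einv ext0 !ltn0 !andbF.
rewrite iE jE !ebelow_ord addnS addSn /= negbK /einv !extS !ltnS.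
have /inversion_sqP/(_ i' j') := idem.
have := perm_parity i'; have := perm_parity j'; rewrite /inverted.
have : i' = j' \/ (i' != j' :> nat) /\ (pi i' != pi j' :> nat).
  have [->|ij] := eqVneq i' j'; first by left.
  by right; rewrite !val_eqE (inj_eq perm_inj).
move: (below pi i' j') (below pi j' i') => x y.
case=> [->|[]]; first by rewrite !ltnn; clear; lia.
move: (nat_of_ord (pi i')) (nat_of_ord (pi j')) (nat_of_ord i') (nat_of_ord j'); clear; lia.
Qed.

(* Second difference of the parity relation: an even number of the four
   endpoint comparisons hold. *)
Lemma noncrossing k l : (k <= n)%N -> (l <= n)%N -> k <> l -> odd k = odd l ->
  let a := minn (ext k) (ext k.+1) in let b := maxn (ext k) (ext k.+1) in
  let c := minn (ext l) (ext l.+1) in let d := maxn (ext l) (ext l.+1) in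
  [\/ (b < c)%N, (d < a)%N, (a < c)%N && (d < b)%N | (c < a)%N && (b < d)%N].
Proof.
move=> kn ln kl okl.
have d1 : ext k <> ext l by move/ext_inj; lia.
have d2 : ext k <> ext l.+1 by move/ext_inj; lia.
have d3 : ext k.+1 <> ext l by move/ext_inj; lia.
have d4 : ext k.+1 <> ext l.+1 by move/ext_inj; lia.
have d5 : ext k <> ext k.+1 by move/ext_inj; lia.
have d6 : ext l <> ext l.+1 by move/ext_inj; lia.
have h1 := ebelow_parity (leqW kn) (leqW ln).
have h2 := @ebelow_parity k.+1 l kn (leqW ln).
have h3 := @ebelow_parity k l.+1 (leqW kn) ln.
have h4 := @ebelow_parity k.+1 l.+1 kn ln.
have even_ends : odd ((ext k < ext l) + (ext k < ext l.+1) + (ext k.+1 < ext l)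
    + (ext k.+1 < ext l.+1)) = false.
{ have flip x y : x <> y -> (y < x)%N = ~~ (x < y)%N by case: (ltngtP x y) => // ->.
  move: h1 h2 h3 h4; rewrite !ebelowS /einv !addSn !addnS /= !oddD okl addbb /=.
  rewrite !andbT !andbF (flip _ _ d1) (flip _ _ d4) ?(flip _ _ d3).
  rewrite -[(k.+1 < l.+1)%N]/(k < l)%N -[(l.+1 < k.+1)%N]/(l < k)%N !oddb.
  have [[-> ->]|[-> ->]] : ((k < l)%N = true /\ (l < k)%N = false) \/ ((k < l)%N = false /\ (l < k)%N = true).
    by case: (ltngtP k l) kl; [left|right|].
  all: by case: (ext k < ext l)%N; case: (ext k < ext l.+1)%N; case: (ext k.+1 < ext l)%N;
    case: (ext k.+1 < ext l.+1)%N; case: (odd (ebelow k l)); case: (odd (ebelow l k));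
    case: (odd (ebelow k l.+1)); case: (odd (ebelow l k.+1)). }
move: d1 d2 d3 d4 d5 d6 even_ends; move: (ext k) (ext k.+1) (ext l) (ext l.+1) => p q r s.
clear => d1 d2 d3 d4 d5 d6.
(* Separated pairs give 0 or 4 true comparisons and nested pairs give 2; interleaved pairs would
   give 1 or 3. *)
case: (ltngtP p q) d5 => // pq _; case: (ltngtP r s) d6 => // rs _;
case: (ltngtP p r) d1 => // pr _; case: (ltngtP p s) d2 => // ps _;
  case: (ltngtP q r) d3 => // qr _; case: (ltngtP q s) d4 => // qs _ //= _;
  first [by apply: Or41 | by apply: Or42 | by apply: Or43; apply/andP | by apply: Or44; apply/andP | by exfalso; lia].
Qed.
End Noncrossing.

Arguments ext {n} pi k : simpl never.

(** * Smooth functions *)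

Section Elementary.
Variable R : realType.
Implicit Types (f g : R -> R) (x a b : R).

(* The rules isd_* restate library ones for eta-expanded functions, the form in
   which they unify with formulas. *)
Lemma isd_add f g x a b : is_derive x 1 f a -> is_derive x 1 g b ->
  is_derive x 1 (fun y => f y + g y) (a + b).
Proof. by move=> h1 h2; exact: is_deriveD. Qed.

Lemma isd_mul f g x a b : is_derive x 1 f a -> is_derive x 1 g b ->
  is_derive x 1 (fun y => f y * g y) (a * g x + f x * b).
Proof.
move=> h1 h2; have := is_deriveM h1 h2; rewrite /GRing.scale/= addrC [g x * a]mulrC.
exact.
Qed.

Lemma isd_comp f g x a b : is_derive (g x) 1 f a -> is_derive x 1 g b ->
  is_derive x 1 (fun y => f (g y)) (a * b).
Proof. exact: is_derive1_comp. Qed.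

Lemma isd_inv f x a : f x != 0 -> is_derive x 1 f a ->
  is_derive x 1 (fun y => (f y)^-1) (- (a * ((f x)^-1 * (f x)^-1))).
Proof.
move=> f0 h; have := is_deriveV f0 h; rewrite /GRing.scale/= expr2 invfM mulNr mulrC.
exact.
Qed.

Lemma isd_cst (c x : R) : is_derive x 1 (fun=> c) (0 : R).
Proof. exact: is_derive_cst. Qed.

Lemma isd_id (x : R) : is_derive x 1 (fun y => y) (1 : R).
Proof. exact: is_derive_id. Qed.

(** The standard function that is flat at 0 is [flat 0]; the parameter [m] makes the linear span of
    the family closed under derivatives. *)
Definition flat (m : nat) x : R := if 0 < x then expR (- x^-1) * x^-1 ^+ m else 0.

Lemma flat_ge0 m x : 0 <= flat m x.
Proof.
by rewrite /flat; case: ifP => // x0; rewrite mulr_ge0 ?expR_ge0// exprn_ge0// invr_ge0 ltW.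
Qed.

Lemma flat_gt0 m x : 0 < x -> 0 < flat m x.
Proof. by move=> x0; rewrite /flat x0 mulr_gt0 ?expR_gt0// exprn_gt0// invr_gt0. Qed.

Lemma flat_le0 m x : x <= 0 -> flat m x = 0.
Proof. by move=> x0; rewrite /flat ltNge x0. Qed.

(** For positive [x], the exponential of [x^-1] dominates the term of degree [m + 2] of its series.
    A quadratic bound is what makes the derivative at 0 vanish. *)
Lemma flat_small m x : flat m x <= (m.+2)`!%:R * x ^+ 2.
Proof.
rewrite /flat; case: ifPn => x0; last by rewrite mulr_ge0// sqr_ge0.
have h := @expR_ge1Dxn R x^-1 m.+1 (ltW _); rewrite invr_gt0 in h.
have {}h : x^-1 ^+ m.+2 / (m.+2)`!%:R <= expR x^-1 by apply: le_trans (h x0); rewrite lerDr.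
rewrite ler_pdivrMr ?ltr0n ?fact_gt0// in h.
have e0 : 0 < expR x^-1 by exact: expR_gt0.
have -> : x^-1 ^+ m = x^-1 ^+ m.+2 * x ^+ 2.
  by rewrite -addn2 exprD -mulrA -exprMn mulVf ?gt_eqF// expr1n mulr1.
rewrite expRN mulrA ler_wpM2r ?sqr_ge0//.
by rewrite ler_pdivrMl// mulrC.
Qed.

Lemma isd_flat m x : is_derive x 1 (flat m) (flat m.+2 x - m%:R * flat m.+1 x).
Proof.
have [x0|x0|->] := ltgtP x 0.
- rewrite !(flat_le0 _ (ltW x0)) mulr0 subrr.
  apply: near_eq_is_derive (isd_cst 0 x).
  by near do rewrite flat_le0// ltW//; exact: lt_nbhsl.
- have xn : x != 0 by rewrite gt_eqF.
  have hi := isd_inv xn (isd_id x).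
  have hn : is_derive x 1 (fun y : R => - y^-1) (1 * (x^-1 * x^-1)).
    by have := is_deriveN hi; rewrite opprK; exact.
  have hp : is_derive x 1 (fun y : R => y^-1 ^+ m) (- (m%:R * x^-1 ^+ m.+1)).
    elim: (m) => [|k IH].
      have -> : (fun y : R => y^-1 ^+ 0) = (fun=> 1) by apply/funext => y; rewrite expr0.
      by rewrite mul0r oppr0; exact: isd_cst.
    have -> : (fun y : R => y^-1 ^+ k.+1) = (fun y => y^-1 * y^-1 ^+ k) by apply/funext => y; rewrite exprS.
    by apply: (is_derive_eq (isd_mul hi IH)); rewrite !exprS -natr1; ring.
  have h := isd_mul (isd_comp (is_derive_expR _) hn) hp.
  have {}h : is_derive x 1 (fun y => expR (- y^-1) * y^-1 ^+ m) (flat m.+2 x - m%:R * flat m.+1 x).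
    by apply: (is_derive_eq h); rewrite /flat x0 !exprS; ring.
  apply: near_eq_is_derive h.
  by near=> y; rewrite /flat ifT//; near: y; exact: lt_nbhsr.
- rewrite !flat_le0// mulr0 subrr.
  have h : h^-1 *: ((flat m \o shift 0) (h *: 1) - flat m 0) @[h --> 0^'] --> (0 : R).
    apply/cvgr0Pnorm_le => e e0; near=> h.
    have hn : h != 0 by near: h; exact: nbhs_dnbhs_neq.
    rewrite /= [flat m 0]flat_le0// subr0 addr0 /GRing.scale/= mulr1 normrM normfV.
    rewrite ler_pdivrMl ?normr_gt0// (ger0_norm (flat_ge0 _ _)).
    apply: le_trans (flat_small _ _) _.
    rewrite -real_normK ?num_real// expr2 mulrA mulrC ler_wpM2l//.
    rewrite -ler_pdivlMl ?ltr0n ?fact_gt0//.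
    by near: h; apply: dnbhs0_le; rewrite mulr_gt0// invr_gt0 ltr0n fact_gt0.
  apply: DeriveDef; first by apply/cvg_ex; exists 0.
  exact: (cvg_lim _ h).
Unshelve. all: by end_near. Qed.

(* Closed under derivatives, hence consisting of smooth functions. *)
Inductive elem : (R -> R) -> Prop :=
| elem_cst c : elem (fun=> c)
| elem_id : elem (fun x => x)
| elem_sin : elem sin
| elem_cos : elem cos
| elem_flat m : elem (flat m)
| elem_add f g : elem f -> elem g -> elem (fun x => f x + g x)
| elem_mul f g : elem f -> elem g -> elem (fun x => f x * g x)
| elem_comp f g : elem f -> elem g -> elem (fun x => f (g x))
| elem_inv f : (forall x, f x != 0) -> elem f -> elem (fun x => (f x)^-1).

Lemma elem_opp f : elem f -> elem (fun x => - f x).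
Proof.
move=> ef; have -> : (fun x => - f x) = (fun x => -1 * f x) by apply/funext => x; rewrite mulN1r.
by apply: elem_mul => //; exact: elem_cst.
Qed.

Lemma elem_derive f : elem f -> exists2 f', elem f' & forall x, is_derive x 1 f (f' x).
Proof.
elim=> {f}.
- by move=> c; exists (fun=> 0); [exact: elem_cst|exact: isd_cst].
- by exists (fun=> 1); [exact: elem_cst|exact: isd_id].
- by exists cos; [exact: elem_cos|exact: is_derive_sin].
- by exists (fun x => - sin x); [apply: elem_opp; exact: elem_sin|exact: is_derive_cos].
- move=> m; exists (fun x => flat m.+2 x - m%:R * flat m.+1 x); last exact: isd_flat.
  apply: elem_add; first exact: elem_flat.
  apply: elem_opp; apply: elem_mul; [exact: elem_cst|exact: elem_flat].
- move=> f g _ [f' ef' hf] _ [g' eg' hg]; exists (fun x => f' x + g' x); first exact: elem_add.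
  by move=> x; exact: isd_add.
- move=> f g ef [f' ef' hf] eg [g' eg' hg]; exists (fun x => f' x * g x + f x * g' x).
    by apply: elem_add; exact: elem_mul.
  by move=> x; exact: isd_mul.
- move=> f g ef [f' ef' hf] eg [g' eg' hg]; exists (fun x => f' (g x) * g' x).
    by apply: elem_mul => //; exact: elem_comp.
  by move=> x; exact: isd_comp.
- move=> f f0 ef [f' ef' hf]; exists (fun x => - (f' x * ((f x)^-1 * (f x)^-1))).
    by apply: elem_opp; apply: elem_mul => //; apply: elem_mul; exact: elem_inv.
  by move=> x; exact: isd_inv.
Qed.

Lemma elem_sum (I : Type) (s : seq I) (F : I -> R -> R) :
  (forall i, elem (F i)) -> elem (fun x => \sum_(i <- s) F i x).
Proof.
move=> h; elim: s => [|i s IH].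
  by under eq_fun do rewrite big_nil; exact: elem_cst.
by under eq_fun do rewrite big_cons; exact: elem_add.
Qed.

Lemma is_derive_pair f g (t a b : R) : is_derive t 1 f a -> is_derive t 1 g b ->
  is_derive t 1 (fun s => (f s, g s) : R * R) (a, b).
Proof.
move=> [df fE] [dg gE].
have hf : h^-1 *: ((f \o shift t) (h *: 1) - f t) @[h --> 0^'] --> a by rewrite -fE; exact: df.
have hg : h^-1 *: ((g \o shift t) (h *: 1) - g t) @[h --> 0^'] --> b by rewrite -gE; exact: dg.
have := cvg_pair hf hg => h.
have h' : h^-1 *: (((fun s => (f s, g s) : R * R) \o shift t) (h *: 1) - (f t, g t)) @[h --> 0^'] --> (a, b).
  exact: h.
apply: DeriveDef; first by apply/cvg_ex; exists (a, b).
exact: (cvg_lim _ h').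
Qed.

Lemma elem_smooth f g : elem f -> elem g -> smooth (fun s => (f s, g s) : R * R).
Proof.
move=> ef eg k; elim: k f g ef eg => [|k IH] f g ef eg t.
  have [f' _ hf] := elem_derive ef; have [g' _ hg] := elem_derive eg.
  by have [] := is_derive_pair (hf t) (hg t).
have [f' ef' hf] := elem_derive ef; have [g' eg' hg] := elem_derive eg.
have E : derive1 (fun s => (f s, g s) : R * R) = (fun s => (f' s, g' s)).
  by apply/funext => s; rewrite derive1E; have [_ ->] := is_derive_pair (hf s) (hg s).
rewrite /derive1n iterSr -/(derive1n k _) E; exact: IH.
Qed.

End Elementary.

(** * Smooth steps and bumps *)

Section Step.
Variable R : realType.
Implicit Types (x y u h : R).

(** The usual smooth transition from 0 to 1: since [x] or [1 - x] is positive, the denominator never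
    vanishes. *)
Definition step x : R := flat 0 x / (flat 0 x + flat 0 (1 - x)).
(** The quotient rule after cancellation, in a form whose sign is visible. *)
Definition dstep x : R :=
  (flat 2 x * flat 0 (1 - x) + flat 0 x * flat 2 (1 - x)) / (flat 0 x + flat 0 (1 - x)) ^+ 2.

Lemma step_den_gt0 x : 0 < flat 0 x + flat 0 (1 - x).
Proof.
have [x0|x0] := ltP 0 x; first by rewrite ltr_wpDr ?flat_ge0// flat_gt0.
by rewrite ltr_wpDl ?flat_ge0// flat_gt0//; lra.
Qed.

Lemma step_elem : elem step.
Proof.
have e1 : elem (fun x => flat 0 (1 - x)).
  apply: (elem_comp (elem_flat R 0)); apply: elem_add; first exact: elem_cst.
  by apply: elem_opp; exact: elem_id.
apply: elem_mul; first exact: elem_flat.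
apply: elem_inv => [x|]; first by rewrite gt_eqF// step_den_gt0.
by apply: elem_add => //; exact: elem_flat.
Qed.

Lemma step_derive x : is_derive x 1 step (dstep x).
Proof.
have d0 : flat 0 x + flat 0 (1 - x) != 0 by rewrite gt_eqF// step_den_gt0.
have h1 := isd_flat 0 x.
have hB : is_derive x 1 (fun y : R => 1 - y) (0 + - 1).
  exact: (isd_add (isd_cst _ _) (is_deriveN (isd_id x))).
have h2 := isd_comp (isd_flat 0 _) hB.
have h3 := isd_mul h1 (isd_inv (f := fun y => flat 0 y + flat 0 (1 - y)) d0 (isd_add h1 h2)).
by apply: (is_derive_eq h3); rewrite /dstep; field.
Qed.

Lemma step_le0 x : x <= 0 -> step x = 0.
Proof. by move=> x0; rewrite /step flat_le0// mul0r. Qed.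

Lemma step_ge1 x : 1 <= x -> step x = 1.
Proof.
move=> x1; rewrite /step [flat 0 (1 - x)]flat_le0 ?addr0 ?divff//; last by lra.
by rewrite gt_eqF// flat_gt0//; lra.
Qed.

Lemma step_gt0 x : 0 < x -> 0 < step x.
Proof. by move=> x0; rewrite divr_gt0 ?step_den_gt0// flat_gt0. Qed.

Lemma step_ge0 x : 0 <= step x.
Proof. by rewrite divr_ge0 ?flat_ge0// ltW// step_den_gt0. Qed.

Lemma step_lt1 x : x < 1 -> step x < 1.
Proof.
by move=> x1; rewrite ltr_pdivrMr ?step_den_gt0// mul1r ltrDl flat_gt0//; lra.
Qed.

Lemma step_le1 x : step x <= 1.
Proof. by have [/ltW|/step_ge1->] := ltP x 1; [|]; last by []; rewrite ler_pdivrMr ?step_den_gt0// mul1r lerDl flat_ge0. Qed.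

Lemma dstep_le0 x : x <= 0 -> dstep x = 0.
Proof. by move=> x0; rewrite /dstep !(flat_le0 _ x0) !mul0r addr0 mul0r. Qed.

Lemma dstep_ge1 x : 1 <= x -> dstep x = 0.
Proof.
have : 1 <= x -> 1 - x <= 0 by lra.
by move=> h /h x1; rewrite /dstep !(flat_le0 _ x1) !mulr0 addr0 mul0r.
Qed.

Lemma dstep_gt0 x : 0 < x < 1 -> 0 < dstep x.
Proof.
move=> /andP[x0 x1]; have x1' : 0 < 1 - x by lra.
by rewrite divr_gt0 ?exprn_gt0 ?step_den_gt0// addr_gt0// mulr_gt0// flat_gt0.
Qed.

Lemma dstep_ge0 x : 0 <= dstep x.
Proof.
by rewrite divr_ge0 ?sqr_ge0// addr_ge0// mulr_ge0 ?flat_ge0.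
Qed.

Lemma step_mvt x y : x < y -> exists2 c, x < c < y & step y - step x = dstep c * (y - x).
Proof.
move=> xy; have [|c] := @MVT R step dstep x y xy (fun z _ => step_derive z).
  apply: continuous_subspaceT => z; apply: differentiable_continuous.
  by apply/derivable1_diffP; have [] := step_derive z.
by rewrite in_itv/=; exists c.
Qed.

Lemma step_lt x y : 0 <= x -> x < y -> y <= 1 -> step x < step y.
Proof.
move=> x0 xy y1; have [c cxy E] := step_mvt xy.
by rewrite -subr_gt0 E mulr_gt0 ?subr_gt0// dstep_gt0//; lra.
Qed.

Lemma step_le x y : x <= y -> step x <= step y.
Proof.
rewrite le_eqVlt => /orP[/eqP->//|xy]; have [c cxy E] := step_mvt xy.
by rewrite -subr_ge0 E mulr_ge0 ?dstep_ge0// subr_ge0 ltW.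
Qed.

(** The values 1/4 and 3/4 separate the two motions of the curve: [ramp] varies only between them,
    where [plateau] is constantly 1. *)
Definition ramp u : R := step (2 * u - 2^-1).
Definition plateau u : R := step (4 * u) * step (4 - 4 * u).
Definition dplateau u : R := 4 * dstep (4 * u) * step (4 - 4 * u) - 4 * step (4 * u) * dstep (4 - 4 * u).
(** The second factor is 1 to infinite order at 0 and 1, so humps of different heights join smoothly
    along one sine wave. *)
Definition hump h u : R := sin (pi * u) * (1 + (h - 1) * plateau u).

Lemma ramp_elem k : elem (fun t => ramp (t - k)).
Proof.
apply: (elem_comp step_elem); apply: elem_add; last exact: elem_cst.
apply: elem_mul; first exact: elem_cst.
by apply: elem_add; [exact: elem_id|exact: elem_cst].
Qed.

Lemma affine_derive (a b x : R) : is_derive x 1 (fun u => a * u + b) a.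
Proof.
have := isd_add (isd_mul (isd_cst a x) (isd_id x)) (isd_cst b x).
by move=> h; apply: (is_derive_eq h); rewrite mul0r mulr1 add0r addr0.
Qed.

Lemma ramp_derive k x : is_derive x 1 (fun t => ramp (t - k)) (2 * dstep (2 * (x - k) - 2^-1)).
Proof.
have h := affine_derive 2 (- (2 * k) - 2^-1) x.
have E t : 2 * t + (- (2 * k) - 2^-1) = 2 * (t - k) - 2^-1 by ring.
have -> : (fun t => ramp (t - k)) = (fun y => step (2 * y + (- (2 * k) - 2^-1))).
  by apply/funext => t; rewrite E.
by have hh := isd_comp (step_derive _) h; apply: (is_derive_eq hh); rewrite E mulrC.
Qed.

Lemma plateau_elem k : elem (fun t => plateau (t - k)).
Proof.
have e0 : elem (fun t => t - k) by apply: elem_add; [exact: elem_id|exact: elem_cst].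
apply: (elem_comp (f := plateau)) => //; apply: elem_mul; apply: (elem_comp step_elem).
  by apply: elem_mul; [exact: elem_cst|exact: elem_id].
apply: elem_add; first exact: elem_cst.
by apply: elem_opp; apply: elem_mul; [exact: elem_cst|exact: elem_id].
Qed.

Lemma plateau_derive k x : is_derive x 1 (fun t => plateau (t - k)) (dplateau (x - k)).
Proof.
have h1 := affine_derive 4 (- (4 * k)) x.
have h2 := affine_derive (- 4) (4 + 4 * k) x.
have E1 t : 4 * t + - (4 * k) = 4 * (t - k) by ring.
have E2 t : - 4 * t + (4 + 4 * k) = 4 - 4 * (t - k) by ring.
have h := isd_mul (isd_comp (step_derive _) h1) (isd_comp (step_derive _) h2).
have -> : (fun t => plateau (t - k)) = (fun y => step (4 * y + - (4 * k)) * step (- 4 * y + (4 + 4 * k))).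
  by apply/funext => t; rewrite E1 E2.
by apply: (is_derive_eq h); rewrite E1 E2 /dplateau; ring.
Qed.

Lemma ramp_le u : u <= 4^-1 -> ramp u = 0.
Proof. by move=> h; rewrite /ramp step_le0//; lra. Qed.
Lemma ramp_ge u : 3 / 4 <= u -> ramp u = 1.
Proof. by move=> h; rewrite /ramp step_ge1//; lra. Qed.
Lemma ramp_itv u : 4^-1 < u < 3 / 4 -> 0 < ramp u < 1.
Proof. by move=> h; rewrite /ramp step_gt0 ?step_lt1//; lra. Qed.
Lemma ramp01 u : 0 <= ramp u <= 1.
Proof. by rewrite /ramp step_ge0 step_le1. Qed.

Lemma plateau_le0 u : u <= 0 -> plateau u = 0.
Proof. by move=> h; rewrite /plateau step_le0 ?mul0r//; lra. Qed.
Lemma plateau_ge1 u : 1 <= u -> plateau u = 0.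
Proof. by move=> h; rewrite /plateau [step (4 - _)]step_le0 ?mulr0//; lra. Qed.
Lemma plateau1 u : 4^-1 <= u <= 3 / 4 -> plateau u = 1.
Proof. by move=> h; rewrite /plateau !step_ge1 ?mulr1//; lra. Qed.
Lemma plateau01 u : 0 <= plateau u <= 1.
Proof. by rewrite /plateau mulr_ge0 ?step_ge0// mulr_ile1 ?step_ge0 ?step_le1. Qed.
Lemma plateauE u : u <= 3 / 4 -> plateau u = step (4 * u).
Proof. by move=> h; rewrite /plateau [step (4 - _)]step_ge1 ?mulr1//; lra. Qed.
Lemma plateau_sym u : plateau (1 - u) = plateau u.
Proof.
rewrite /plateau mulrC; congr (step _ * step _); ring.
Qed.

Lemma dplateau_le0 u : u <= 0 -> dplateau u = 0.
Proof.
by move=> h; rewrite /dplateau dstep_le0 ?(step_le0 (x := 4 * u)); try lra; ring.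
Qed.
Lemma dplateau_ge1 u : 1 <= u -> dplateau u = 0.
Proof.
by move=> h; rewrite /dplateau dstep_ge1 ?(dstep_le0 (x := 4 - _)); try lra; ring.
Qed.
Lemma dplateau_ge0 u : u <= 3 / 4 -> 0 <= dplateau u.
Proof.
move=> h; rewrite /dplateau [dstep (4 - _)]dstep_ge1; last by lra.
by rewrite mulr0 subr0 mulr_ge0 ?step_ge0// mulr_ge0 ?dstep_ge0.
Qed.
Lemma dplateau_sym u : dplateau (1 - u) = - dplateau u.
Proof.
rewrite /dplateau.
have -> : 4 * (1 - u) = 4 - 4 * u by ring.
have -> : 4 - (4 - 4 * u) = 4 * u by ring.
ring.
Qed.

Lemma hump0 h : hump h 0 = 0. Proof. by rewrite /hump mulr0 sin0 mul0r. Qed.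

Lemma hump_sym h u : hump h (1 - u) = hump h u.
Proof.
rewrite /hump plateau_sym; congr (_ * _).
by rewrite mulrBr mulr1 sinB sinpi cospi mul0r mulN1r add0r opprK.
Qed.

Lemma hump_factor h u : 1 <= h -> 1 <= 1 + (h - 1) * plateau u <= h.
Proof.
move=> h1; have /andP[p0 p1] := plateau01 u.
by apply/andP; split; nra.
Qed.

Lemma sin_pi_gt0 u : 0 < u < 1 -> 0 < sin (pi * u).
Proof.
move=> /andP[u0 u1]; have p0 := pi_gt0 R; apply: sin_gt0_pi.
by rewrite mulr_gt0//= -[ltRHS]mulr1 ltr_pM2l.
Qed.

Lemma hump_gt0 h u : 1 <= h -> 0 < u < 1 -> 0 < hump h u.
Proof.
move=> h1 u01; have /andP[f1 _] := hump_factor u h1.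
by rewrite /hump mulr_gt0 ?sin_pi_gt0//; lra.
Qed.

Lemma hump_le h u : 1 <= h -> 0 <= u <= 1 -> hump h u <= h.
Proof.
move=> h1 u01; have /andP[f1 f2] := hump_factor u h1; have s1 := sin_le1 (pi * u).
rewrite /hump; nra.
Qed.

Lemma hump_ge h u : 1 <= h -> 4^-1 <= u <= 3 / 4 -> h / 2 <= hump h u.
Proof.
move=> h1 u01; have p0 := pi_gt0 R.
rewrite /hump plateau1// mulr1.
have s0 : 0 < sin (pi * u) by apply: sin_pi_gt0; lra.
(* In the middle half the cosine of the doubled angle is nonpositive, so the squared sine is at
   least 1/2 and the sine at least 1/2. *)
have c0 : cos (pi * u *+ 2) <= 0.
  have : 0 <= cos (pi * u *+ 2 - pi).
    have [ua ub] := andP u01.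
    have g1 : pi * 4^-1 <= pi * u by rewrite ler_pM2l.
    have g2 : pi * u <= pi * (3 / 4) by rewrite ler_pM2l.
    by apply: cos_ge0_pihalf; rewrite [pi * u *+ 2]mulr2n; apply/andP; split; lra.
  by rewrite cosB cospi sinpi mulr0 addr0 mulrN1; lra.
rewrite cos_mulr2n [_ *+ 2]mulr2n in c0; have := cos2Dsin2 (pi * u).
nra.
Qed.

Lemma hump_lt h x y : 1 <= h -> 0 <= x -> x < y -> y <= 4^-1 -> hump h x < hump h y.
Proof.
move=> h1 x0 xy y1; have p0 := pi_gt0 R.
rewrite /hump !plateauE; [|lra|lra].
have s : sin (pi * x) < sin (pi * y).
  have g0 : 0 <= pi * x by rewrite mulr_ge0// ltW.
  have g1 : pi * x < pi * y by rewrite ltr_pM2l.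
  have g2 : pi * y <= pi * 4^-1 by rewrite ler_pM2l.
  by rewrite ltr_sin ?in_itv/=//; apply/andP; split; lra.
have sx : 0 <= sin (pi * x).
  have g0 : 0 <= pi * x by rewrite mulr_ge0// ltW.
  have g1 : pi * x <= pi * 1 by rewrite ler_pM2l//; lra.
  by apply: sin_ge0_pi; apply/andP; split; lra.
have p1 : step (4 * x) <= step (4 * y) by apply: step_le; lra.
have p2 := step_ge0 (4 * x).
have AB : 1 + (h - 1) * step (4 * x) <= 1 + (h - 1) * step (4 * y).
  by rewrite lerD2l ler_wpM2l// subr_ge0.
have A1 : 0 <= (h - 1) * step (4 * x) by rewrite mulr_ge0// subr_ge0.
apply: le_lt_trans (ler_wpM2l sx AB) _; rewrite ltr_pM2r//; lra.
Qed.

End Step.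

(** * The curve of an idempotent matrix *)

Section Pieces.
Variable R : realType.
Variables (n : nat) (X h : nat -> R).
Implicit Types (t u : R) (k j : nat).

(* For t in [k, k + 1] the curve moves from X k to X (k + 1), horizontally only
   for t - k in [1/4, 3/4], where its height is at least h k / 2. *)
Definition curve_x t : R := X 0 + \sum_(j < n.+1) (X j.+1 - X j) * ramp (t - j%:R).
Definition curve_y t : R := sin (pi * t) * (1 + \sum_(j < n.+1) (h j - 1) * plateau (t - j%:R)).

(** At time [k + u] the summands before [k] have reached their final value [e] and those after [k]
    have not started. *)
Lemma piece_sum (c : nat -> R) (F : R -> R) (e : R) k u : (k <= n)%N -> 0 <= u <= 1 ->
  (forall v, v <= 0 -> F v = 0) -> (forall v, 1 <= v -> F v = e) ->
  \sum_(j < n.+1) c j * F (k%:R + u - j%:R) = (\sum_(j < k) c j) * e + c k * F u.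
Proof.
move=> kn /andP[u0 u1] F0 F1; rewrite -(big_mkord xpredT (fun j => c j * F (k%:R + u - j%:R))).
rewrite (@big_cat_nat _ _ _ k)//=; last exact: leqW.
rewrite [X in _ + X]big_ltn ?ltnS//=.
have -> : k%:R + u - k%:R = u :> R by ring.
have -> : \sum_(k.+1 <= j < n.+1) c j * F (k%:R + u - j%:R) = 0.
  rewrite big_nat_cond big1// => j /andP[/andP[kj _] _]; rewrite F0 ?mulr0//.
  have : k.+1%:R <= j%:R :> R by rewrite ler_nat.
  by rewrite -natr1; lra.
rewrite addr0; congr (_ + _); rewrite mulr_suml -(big_mkord xpredT (fun j => c j * e)).
rewrite big_nat_cond [RHS]big_nat_cond; apply: eq_bigr => j /andP[/andP[_ jk] _].
rewrite F1//; have : j.+1%:R <= k%:R :> R by rewrite ler_nat.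
by rewrite -natr1; lra.
Qed.

Lemma telescope_ord k : \sum_(j < k) (X j.+1 - X j) = X k - X 0.
Proof. by rewrite -(big_mkord xpredT (fun j => X j.+1 - X j)) telescope_sumr. Qed.

Lemma sin_nat k u : sin (pi * (k%:R + u)) = (-1) ^+ k * sin (pi * u).
Proof.
elim: k => [|k IH]; first by rewrite add0r expr0 mul1r.
have -> : pi * (k.+1%:R + u) = pi * (k%:R + u) + pi by rewrite -natr1; ring.
by rewrite sinDpi IH exprS mulN1r mulNr.
Qed.

Lemma cos_nat k u : cos (pi * (k%:R + u)) = (-1) ^+ k * cos (pi * u).
Proof.
elim: k => [|k IH]; first by rewrite add0r expr0 mul1r.
have -> : pi * (k.+1%:R + u) = pi * (k%:R + u) + pi by rewrite -natr1; ring.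
by rewrite cosDpi IH exprS mulN1r mulNr.
Qed.

Lemma curve_xE k u : (k <= n)%N -> 0 <= u <= 1 ->
  curve_x (k%:R + u) = X k + (X k.+1 - X k) * ramp u.
Proof.
move=> kn u01; rewrite /curve_x (@piece_sum (fun j => X j.+1 - X j) _ 1)//.
- by rewrite telescope_ord mulr1 addrA addrCA subrr addr0.
- by move=> v v0; rewrite ramp_le//; lra.
- by move=> v v0; rewrite ramp_ge//; lra.
Qed.

Lemma curve_yE k u : (k <= n)%N -> 0 <= u <= 1 ->
  curve_y (k%:R + u) = (-1) ^+ k * hump (h k) u.
Proof.
move=> kn u01; rewrite /curve_y (@piece_sum (fun j => h j - 1) _ 0)//.
- by rewrite mulr0 add0r sin_nat /hump -mulrA.
- by move=> v v0; rewrite plateau_le0.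
- by move=> v v0; rewrite plateau_ge1.
Qed.

Lemma isd_sum m (F : nat -> R -> R) (dF : nat -> R) t : (forall j, is_derive t 1 (F j) (dF j)) ->
  is_derive t 1 (fun t => \sum_(j < m) F j t) (\sum_(j < m) dF j).
Proof.
move=> hF; elim: m => [|m IH].
  have -> : (fun t => \sum_(j < 0) F j t) = (fun=> 0) by apply/funext => v; rewrite big_ord0.
  by rewrite big_ord0; exact: isd_cst.
have -> : (fun t => \sum_(j < m.+1) F j t) = (fun t => \sum_(j < m) F j t + F m t).
  by apply/funext => v; rewrite big_ord_recr.
by rewrite big_ord_recr/=; exact: isd_add.
Qed.

Lemma isd_scale (f : R -> R) (c t a : R) : is_derive t 1 f a -> is_derive t 1 (fun t => c * f t) (c * a).
Proof.
move=> hf; have hh := isd_mul (isd_cst c t) hf.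
by apply: (is_derive_eq hh); rewrite mul0r add0r.
Qed.

Lemma curve_x_derive k u : (k <= n)%N -> 0 <= u <= 1 ->
  is_derive (k%:R + u) 1 curve_x ((X k.+1 - X k) * (2 * dstep (2 * u - 2^-1))).
Proof.
move=> kn u01; rewrite /curve_x; set t := k%:R + u.
have hh := isd_add (isd_cst (X 0) t) (@isd_sum n.+1 (fun j t => (X j.+1 - X j) * ramp (t - j%:R)) _ t
  (fun j => isd_scale (X j.+1 - X j) (ramp_derive j%:R t))).
apply: (is_derive_eq hh); rewrite add0r.
rewrite (@piece_sum (fun j => X j.+1 - X j) (fun v => 2 * dstep (2 * v - 2^-1)) 0)//.
- by rewrite mulr0 add0r.
- by move=> v v0; rewrite dstep_le0 ?mulr0//; lra.
- by move=> v v0; rewrite dstep_ge1 ?mulr0//; lra.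
Qed.

Lemma curve_y_derive k u : (k <= n)%N -> 0 <= u <= 1 ->
  is_derive (k%:R + u) 1 curve_y ((-1) ^+ k *
    (pi * cos (pi * u) * (1 + (h k - 1) * plateau u) + sin (pi * u) * ((h k - 1) * dplateau u))).
Proof.
move=> kn u01; rewrite /curve_y; set t := k%:R + u.
have hs := isd_comp (is_derive_sin _) (isd_scale pi (isd_id t)).
have hh := isd_mul hs (isd_add (isd_cst 1 t) (@isd_sum n.+1 (fun j t => (h j - 1) * plateau (t - j%:R)) _ t
  (fun j => isd_scale (h j - 1) (plateau_derive j%:R t)))).
apply: (is_derive_eq hh); rewrite add0r mulr1 /=.
rewrite (@piece_sum (fun j => h j - 1) (@dplateau R) 0)//; last 2 first.
- by move=> v v0; rewrite dplateau_le0.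
- by move=> v v0; rewrite dplateau_ge1.
rewrite (@piece_sum (fun j => h j - 1) (@plateau R) 0)//; last 2 first.
- by move=> v v0; rewrite plateau_le0.
- by move=> v v0; rewrite plateau_ge1.
by rewrite /t sin_nat cos_nat; ring.
Qed.

Lemma curve_x_elem : elem curve_x.
Proof.
apply: elem_add; first exact: elem_cst.
by apply: elem_sum => j; apply: elem_mul; [exact: elem_cst|exact: ramp_elem].
Qed.

Lemma curve_y_elem : elem curve_y.
Proof.
apply: elem_mul.
  by apply: (elem_comp (elem_sin R)); apply: elem_mul; [exact: elem_cst|exact: elem_id].
apply: elem_add; first exact: elem_cst.
by apply: elem_sum => j; apply: elem_mul; [exact: elem_cst|exact: plateau_elem].
Qed.

Hypothesis h1 : forall k, 1 <= h k.
Hypothesis X_inj : forall k l, (k <= n.+1)%N -> (l <= n.+1)%N -> X k = X l -> k = l.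

(** In the open middle half the horizontal speed is nonzero; in the outer quarters the two terms of
    the vertical speed do not have opposite signs and one is nonzero. The clause for [u = 0] gives
    transversality at the crossings. *)
Lemma curve_immersion k u : (k <= n)%N -> 0 <= u <= 1 ->
  exists a b, [/\ is_derive (k%:R + u) 1 curve_x a, is_derive (k%:R + u) 1 curve_y b,
    (a != 0) || (b != 0) & u = 0 -> b != 0].
Proof.
move=> kn u01; do 2 eexists; split; [exact: curve_x_derive|exact: curve_y_derive| |].
- have [um|] := boolP (4^-1 < u < 3 / 4).
    rewrite mulf_neq0//.
      by rewrite subr_eq0; apply/eqP => /X_inj; rewrite ltnS kn leqW// => /(_ isT isT); lia.
    by rewrite mulf_neq0// gt_eqF// dstep_gt0//; lra.
  move=> uo; apply/orP; right; rewrite mulf_neq0 ?signr_eq0//.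
  have p0 := pi_gt0 R; have h1k := h1 k.
  have /andP[f1 f2] := hump_factor u h1k.
  have [u4|u4] := lerP u 4^-1.
    have c0 : 0 < cos (pi * u).
      have g1 : pi * u <= pi * 4^-1 by rewrite ler_pM2l.
      have g2 : 0 <= pi * u by rewrite mulr_ge0 ?(ltW p0)//; lra.
      by apply: cos_gt0_pihalf; apply/andP; split; lra.
    have s0 : 0 <= sin (pi * u).
      have g1 : pi * u <= pi * 1 by rewrite ler_pM2l//; lra.
      by apply: sin_ge0_pi; rewrite mulr_ge0 ?(ltW p0)//=; lra.
    have d0 : 0 <= dplateau u by apply: dplateau_ge0; lra.
    rewrite gt_eqF// ltr_pwDl//; first by rewrite !mulr_gt0//; lra.
    by rewrite !mulr_ge0// subr_ge0.
  have u34 : 3 / 4 <= u by move: uo; rewrite u4/= -leNgt.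
  (* The last quarter is reflected onto the first. *)
  pose v := 1 - u; have uE : u = 1 - v by rewrite /v; ring.
  have v4 : v <= 4^-1 by rewrite /v; lra.
  have c0 : 0 < cos (pi * v).
    have g1 : pi * v <= pi * 4^-1 by rewrite ler_pM2l.
    have g2 : 0 <= pi * v by rewrite mulr_ge0 ?(ltW p0)// /v; lra.
    by apply: cos_gt0_pihalf; apply/andP; split; lra.
  have cE : cos (pi * u) = - cos (pi * v).
    by rewrite uE mulrBr mulr1 cosB cospi sinpi mul0r addr0 mulN1r.
  have s0 : 0 <= sin (pi * u).
    have g1 : pi * u <= pi * 1 by rewrite ler_pM2l//; lra.
    by apply: sin_ge0_pi; rewrite mulr_ge0 ?(ltW p0)//=; lra.
  have d0 : 0 <= dplateau v by apply: dplateau_ge0; lra.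
  have dE : dplateau u = - dplateau v by rewrite uE dplateau_sym.
  rewrite lt_eqF// cE dE mulrN mulNr !mulrN -opprD oppr_lt0.
  rewrite ltr_pwDl//; first by rewrite !mulr_gt0//; lra.
  by rewrite !mulr_ge0// subr_ge0.
- move=> u0; rewrite u0 mulr0 sin0 mul0r addr0 cos0 mulr1 plateau_le0// mulr0 addr0 mulr1.
  by rewrite mulf_neq0 ?signr_eq0// gt_eqF ?pi_gt0.
Qed.

End Pieces.

(** * Injectivity of the curve *)

Section Injectivity.
Variables (R : realType) (n : nat) (pi : 'S_n).
Hypothesis idem : (inversion_mx pi ^+ 2 = inversion_mx pi)%R.
Implicit Types (k l : nat) (t u : R).

Local Notation p := (ext pi).

Definition arc_height k : R := 4 ^+ (maxn (p k) (p k.+1) - minn (p k) (p k.+1)).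
(** Its square exceeds [n ^+ 2 + (4 ^+ n.+1) ^+ 2], a bound on the squared distance from the center
    for points with abscissa in [[1, n]] and the height of any arc. *)
Definition disk_radius : R := n%:R + 1 + 4 ^+ n.+1.
Definition disk_center : R := 2^-1 * n.+1%:R.
(* The two ends start outside the disk and are cut off where the curve meets the
   circle. *)
Definition crossing k : R :=
  if k == 0%N then disk_center - 2 * disk_radius else if k == n.+1 then disk_center + 2 * disk_radius else (p k)%:R.

Lemma arc_height_ge1 k : 1 <= arc_height k.
Proof. by rewrite exprn_ege1// ler1n. Qed.

Lemma disk_radius_gt0 : 0 < disk_radius.
Proof. by rewrite /disk_radius addr_gt0// ?exprn_gt0// ltr_wpDl// ler0n. Qed.

Lemma ext_le k : (k <= n.+1)%N -> (p k <= n.+1)%N.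
Proof.
by move=> /(extP pi)[->|[i _ ->]|->]; rewrite ?ext0 ?ext_last// ltnW// ltnS ltn_ord.
Qed.

Lemma arc_height_le k : (k <= n)%N -> arc_height k <= 4 ^+ n.+1.
Proof.
move=> kn; rewrite /arc_height ler_eXn2l ?ltr1n//.
have := ext_le (leqW kn); have := @ext_le k.+1 kn; lia.
Qed.

Lemma crossing_ord (i : 'I_n) : crossing i.+1 = (pi i).+1%:R.
Proof. by rewrite /crossing /= eqSS (ltn_eqF (ltn_ord i)) extS. Qed.

Lemma crossing_inner k : (0 < k <= n)%N -> 1 <= crossing k <= n%:R.
Proof.
move=> /andP[k0 kn]; have kn' : (k.-1 < n)%N by rewrite prednK.
have := crossing_ord (Ordinal kn'); rewrite /= prednK// => ->.
by rewrite ler1n ler_nat ltn_ord.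
Qed.

Lemma crossing0 : crossing 0 < 1.
Proof.
have := disk_radius_gt0; rewrite /crossing eqxx /disk_center /disk_radius -[n.+1%:R]natr1.
have e0 : 0 < 4 ^+ n.+1 :> R by rewrite exprn_gt0.
have n0 : 0 <= n%:R :> R by rewrite ler0n.
lra.
Qed.

Lemma crossing_last : n%:R < crossing n.+1.
Proof.
rewrite /crossing eqxx /disk_center /disk_radius -[n.+1%:R]natr1 /=.
have e0 : 0 < 4 ^+ n.+1 :> R by rewrite exprn_gt0.
have n0 : 0 <= n%:R :> R by rewrite ler0n.
lra.
Qed.

(** Moving the two ends outwards keeps the order of the labels, so [noncrossing] applies to
    abscissas. *)
Lemma crossing_mono k l : (k <= n.+1)%N -> (l <= n.+1)%N -> (p k < p l)%N -> crossing k < crossing l.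
Proof.
move=> kn ln; have p0 := crossing0; have p1 := crossing_last.
case: (extP pi kn) => [->|[i -> _]|->].
- case: (extP pi ln) => [->|[j -> _]|->].
  + by rewrite ltnn.
  + have := @crossing_inner j.+1; rewrite ltn_ord => /(_ isT); lra.
  + move=> _; have := disk_radius_gt0; rewrite /crossing !eqxx /=; lra.
- case: (extP pi ln) => [->|[j -> _]|->].
  + by rewrite ext0 ltn0.
  + by rewrite !extS !crossing_ord ltr_nat.
  + have := @crossing_inner i.+1; rewrite ltn_ord => /(_ isT); lra.
- by rewrite ext_last ltnNge ext_le.
Qed.

Lemma crossing_inj k l : (k <= n.+1)%N -> (l <= n.+1)%N -> crossing k = crossing l -> k = l.
Proof.
move=> kn ln e; apply: (@ext_inj n pi k l kn ln).
case: (ltngtP (p k) (p l)) => // h.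
  by have := crossing_mono kn ln h; rewrite e ltxx.
by have := crossing_mono ln kn h; rewrite e ltxx.
Qed.

Lemma conv_lt (a b c d s s' : R) : 0 <= s <= 1 -> 0 <= s' <= 1 -> a < c -> a < d -> b < c -> b < d ->
  a + (b - a) * s < c + (d - c) * s'.
Proof.
move=> /andP[s0 s1] /andP[s'0 s'1] ac ad bc bd.
have h1 : a + (b - a) * s <= Num.max a b by case: (leP a b) => ab; nra.
have h2 : Num.min c d <= c + (d - c) * s' by case: (leP c d) => cd; nra.
apply: le_lt_trans h1 (lt_le_trans _ h2).
by rewrite gt_max !lt_min ac ad bc bd.
Qed.

(** At either end of the outer interval the abscissa is outside the inner one. *)
Lemma conv_in (a b c d s s' : R) : 0 <= s <= 1 -> 0 <= s' <= 1 ->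
  (a < c /\ a < d /\ c < b /\ d < b) \/ (b < c /\ b < d /\ c < a /\ d < a) ->
  a + (b - a) * s = c + (d - c) * s' -> 0 < s < 1.
Proof.
move=> s01 s'01 H E.
have i0 : 0 <= (0 : R) <= 1 by rewrite lexx ler01.
have s0 : s != 0.
  apply/eqP => s0; move: E; rewrite s0 mulr0 addr0.
  case: H => [[ac [ad _]]|[_ [_ [ca da]]]] E.
    by have := conv_lt i0 s'01 ac ad ac ad; rewrite subrr mul0r addr0 E ltxx.
  by have := conv_lt s'01 i0 ca ca da da; rewrite [a - a]subrr mul0r addr0 E ltxx.
have s1 : s != 1.
  apply/eqP => s1; move: E; rewrite s1 mulr1 addrCA subrr addr0.
  case: H => [[_ [_ [cb db]]]|[bc [bd _]]] E.
    by have := conv_lt s'01 i0 cb cb db db; rewrite [b - b]subrr mul0r addr0 E ltxx.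
  by have := conv_lt i0 s'01 bc bd bc bd; rewrite [b - b]subrr mul0r addr0 E ltxx.
by move: s01; rewrite !le_eqVlt eq_sym (negbTE s0) (negbTE s1).
Qed.

Lemma ramp_in u : 0 < ramp u < 1 -> 4^-1 <= u <= 3 / 4.
Proof.
move=> /andP[s0 s1]; apply/andP; split; rewrite leNgt; apply/negP => h.
  by move: s0; rewrite ramp_le ?ltxx// ltW.
by move: s1; rewrite ramp_ge ?ltxx// ltW.
Qed.

(** At a common abscissa the outer arc is in its middle half, with height at least
    [arc_height k / 2]. The base 4 makes this at least twice [arc_height l], which bounds the inner
    arc. *)
Lemma nested_hump k l u v : (k <= n)%N -> (l <= n)%N -> 0 <= u <= 1 -> 0 <= v <= 1 ->
  (minn (p k) (p k.+1) < minn (p l) (p l.+1))%N && (maxn (p l) (p l.+1) < maxn (p k) (p k.+1))%N ->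
  crossing k + (crossing k.+1 - crossing k) * ramp u = crossing l + (crossing l.+1 - crossing l) * ramp v ->
  hump (arc_height k) u != hump (arc_height l) v.
Proof.
move=> kn ln u01 v01 nest E.
have kn1 := leqW kn; have ln1 := leqW ln.
have su : 4^-1 <= u <= 3 / 4.
  apply: ramp_in; apply: conv_in (ramp01 u) (ramp01 v) _ E.
  have [pk|pk] := leqP (p k) (p k.+1); [left|right]; repeat split; apply: crossing_mono => //;
    move: nest pk; rewrite /minn /maxn; do 4?[case: ifP]; lia.
have hk : 4 * arc_height l <= arc_height k.
  rewrite /arc_height -exprS ler_eXn2l ?ltr1n//; move: nest; lia.
have h1 := hump_ge (arc_height_ge1 k) su; have h2 := hump_le (arc_height_ge1 l) v01; have := arc_height_ge1 l.
by move=> h3; rewrite gt_eqF//; lra.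
Qed.

Lemma nat_part t : 0 <= t -> exists (k : nat) u, [/\ t = k%:R + u, 0 <= u & u < 1].
Proof.
move=> t0; have /andP[h1 h2] := truncn_itv t0.
exists (Num.truncn t), (t - (Num.truncn t)%:R); split=> //.
- by rewrite addrC subrK.
- by rewrite subr_ge0.
- by rewrite ltrBlDl natr1.
Qed.

Lemma curve_inj t t' : 0 <= t < n.+1%:R -> 0 <= t' < n.+1%:R ->
  curve_x n crossing t = curve_x n crossing t' -> curve_y n arc_height t = curve_y n arc_height t' -> t = t'.
Proof.
move=> /andP[t0 tn] /andP[t'0 t'n].
have [k [u [tE u0 u1]]] := nat_part t0; have [l [v [t'E v0 v1]]] := nat_part t'0.
have kn : (k <= n)%N by rewrite -ltnS -(ltr_nat R); apply: le_lt_trans tn; rewrite tE lerDl.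
have ln : (l <= n)%N by rewrite -ltnS -(ltr_nat R); apply: le_lt_trans t'n; rewrite t'E lerDl.
have u01 : 0 <= u <= 1 by rewrite u0 ltW.
have v01 : 0 <= v <= 1 by rewrite v0 ltW.
rewrite tE t'E !curve_xE// !curve_yE// => Ex Ey.
have hp j w : 0 <= w -> w < 1 -> w != 0 -> 0 < hump (arc_height j) w.
  by move=> w0 w1 wn; apply: hump_gt0; rewrite ?arc_height_ge1// lt_def wn w0.
have z0 (j j' : nat) (w : R) : 0 <= w -> w < 1 ->
    (-1) ^+ j * hump (arc_height j) 0 = (-1) ^+ j' * hump (arc_height j') w -> w = 0.
  move=> w0 w1; rewrite hump0 mulr0 => /esym/eqP; rewrite mulf_eq0 signr_eq0 /= => h.
  by apply/eqP; apply: contraTT h => /(hp j' _ w0 w1) h; rewrite gt_eqF.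
have kl : u = 0 -> v = 0 -> k%:R + u = l%:R + v.
  move=> uz vz; move: Ex; rewrite uz vz !ramp_le// !mulr0 !addr0.
  by move=> /crossing_inj ->//; exact: leqW.
have [uz|un] := eqVneq u 0.
  by apply: kl => //; move: Ey; rewrite uz; exact: z0.
have [vz|vn] := eqVneq v 0.
  by apply: kl => //; move: Ey; rewrite vz => /esym; exact: z0.
have hu := hp k _ u0 u1 un; have hv := hp l _ v0 v1 vn.
have okl : odd k = odd l.
  move: Ey; rewrite -signr_odd -[(-1) ^+ l]signr_odd.
  by case: (odd k); case: (odd l) => //=; rewrite ?expr0 ?expr1; lra.
have {}Ey : hump (arc_height k) u = hump (arc_height l) v.
  by move: Ey; rewrite -signr_odd -[(-1) ^+ l]signr_odd okl => /(mulfI _); apply; rewrite signr_eq0.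
(* Distinct arcs on the same side: separated ones share no abscissa, and nested ones have different
   heights wherever they share one. *)
have [kleq|kl'] := eqVneq k l; last first.
  exfalso; have kl2 : k <> l by apply/eqP.
  have kn1 := leqW kn; have ln1 := leqW ln.
  case: (noncrossing idem kn ln kl2 okl) => hh.
  - have := conv_lt (ramp01 u) (ramp01 v) (a := crossing k) (b := crossing k.+1) (c := crossing l) (d := crossing l.+1).
    rewrite Ex ltxx => H; suff: false by []; apply: H; apply: crossing_mono => //; move: hh; clear; lia.
  - have := conv_lt (ramp01 v) (ramp01 u) (c := crossing k) (d := crossing k.+1) (a := crossing l) (b := crossing l.+1).
    rewrite Ex ltxx => H; suff: false by []; apply: H; apply: crossing_mono => //; move: hh; clear; lia.
  - by have := nested_hump kn ln u01 v01 hh Ex; rewrite Ey eqxx.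
  - by have := nested_hump ln kn v01 u01 hh (esym Ex); rewrite Ey eqxx.
subst l; congr (_ + _).
(* On a single arc [ramp] tells the first quarter, the middle half and the last quarter apart;
   [hump] is injective on each quarter and [ramp] on the middle half. *)
have {}Ex : ramp u = ramp v.
  have n0 : crossing k.+1 - crossing k != 0.
    rewrite subr_eq0; apply/eqP => /crossing_inj; rewrite ltnS kn leqW// => /(_ isT isT).
    by clear; lia.
  apply: (mulfI n0); apply: (addrI (crossing k)); exact: Ex.
have hlt := hump_lt (arc_height_ge1 k).
have low (x y : R) : 0 <= x -> x <= 4^-1 -> 0 <= y -> y <= 4^-1 ->
    hump (arc_height k) x = hump (arc_height k) y -> x = y.
  move=> x0 x4 y0 y4 hxy; case: (ltgtP x y) => // xy.
    by have := hlt _ _ x0 xy y4; rewrite hxy ltxx.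
  by have := hlt _ _ y0 xy x4; rewrite hxy ltxx.
have slt (x y : R) : 4^-1 <= x -> x < y -> y <= 3 / 4 -> ramp x < ramp y.
  by move=> x4 xy y4; apply: step_lt; lra.
have [u4|u4] := leP u 4^-1.
  have v4 : v <= 4^-1.
    rewrite leNgt; apply/negP => v4; have : 0 < ramp v.
      have [v3|v3] := ltP v (3 / 4); first by have /andP[] := @ramp_itv R v ltac:(lra).
      by rewrite ramp_ge.
    by rewrite -Ex ramp_le ?ltxx.
  exact: low.
have [u3|u3] := leP (3 / 4) u.
  have v3 : 3 / 4 <= v.
    rewrite leNgt; apply/negP => v3; have : ramp v < 1.
      have [v4|v4] := ltP 4^-1 v; first by have /andP[] := @ramp_itv R v ltac:(lra).
      by rewrite ramp_le.
    by rewrite -Ex ramp_ge ?ltxx.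
  have : 1 - u = 1 - v by apply: low; rewrite ?hump_sym//; lra.
  lra.
have /andP[su0 su1] := @ramp_itv R u ltac:(lra).
have /andP[v4 v3] : 4^-1 <= v <= 3 / 4 by apply: ramp_in; rewrite -Ex su0 su1.
case: (ltgtP u v) => // uv.
  by have := slt u v ltac:(lra) uv v3; rewrite Ex ltxx.
by have := slt v u v4 uv ltac:(lra); rewrite Ex ltxx.
Qed.

End Injectivity.

(** * Cutting the curve off at the circle *)

Section Construction.
Variable R : realType.

(** The circle may be met several times; [s] is the last time in [[a, b]] at which [g] is
    nonnegative. *)
Lemma entry_point (g : R -> R) (a b : R) : continuous g -> a < b -> 0 < g a -> g b < 0 ->
  exists s, [/\ a < s < b, g s = 0 & forall t, s < t -> t <= b -> g t < 0].
Proof.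
move=> cg ab ga gb.
pose E := [set t | a <= t <= b /\ 0 <= g t].
have Ea : E a by split; [rewrite lexx ltW|exact: ltW].
have Eb : ubound E b by move=> t [/andP[_ tb] _].
have hE : has_sup E by split; [exists a|exists b].
pose s := sup E.
have sE t : E t -> t <= s by move=> Et; exact: (ub_le_sup hE.2).
have as_ : a <= s by exact: sE.
have sb : s <= b by exact: (ge_sup hE.1 Eb).
have after t : s < t -> t <= b -> g t < 0.
  move=> st tb; rewrite ltNge; apply/negP => gt0.
  have := sE t; rewrite leNgt st => H; suff: false by [].
  by apply: H; split => //; rewrite tb (le_trans as_)// ltW.
have gs : 0 <= g s.
  rewrite leNgt; apply/negP => gs0.
  have /nbhs_ballP[d /= d0 hd] : \forall t \near s, g t < 0 by exact: (cvgr_lt (g s) (cg s)).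
  have [e Ee es] := sup_adherent d0 hE.
  have : g e < 0.
    by apply: hd; rewrite -ball_normE/= ger0_norm ?subr_ge0 ?sE// ltrBlDr addrC -ltrBlDr.
  by rewrite ltNge; case: Ee => _ ->.
have sltb : s < b by rewrite lt_neqAle sb andbT; apply: contraTneq gb => <-; rewrite -leNgt.
have gs0 : g s = 0.
  apply/eqP; rewrite eq_le gs andbT leNgt; apply/negP => gspos.
  have [||c] := @IVT R g s b 0 sb.
  - exact: continuous_subspaceT.
  - by rewrite ge_min le_max (ltW gb) orbT gs.
  rewrite in_itv/= => /andP[sc cb] gc.
  move: sc; rewrite le_eqVlt => /orP[/eqP sc|/after/(_ cb)]; last by rewrite gc ltxx.
  by move: gspos; rewrite sc gc ltxx.
exists s; split => //; rewrite sltb andbT lt_neqAle as_ andbT.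
by apply: contraTneq ga => ->; rewrite gs0 ltxx.
Qed.

Lemma exit_point (g : R -> R) (a b : R) : continuous g -> a < b -> g a < 0 -> 0 < g b ->
  exists s, [/\ a < s < b, g s = 0 & forall t, a <= t -> t < s -> g t < 0].
Proof.
move=> cg ab ga gb.
have cg' : continuous (fun t => g (- t)).
  by move=> t; apply: (continuous_comp (f := -%R) (g := g)); [exact: opp_continuous|exact: cg].
have [|||s [sab gs ht]] := @entry_point (fun t => g (- t)) (- b) (- a) cg'; rewrite ?opprK//.
  by rewrite ltrN2.
exists (- s); split => //; first by move: sab; lra.
by move=> t at_ ts; have := ht (- t); rewrite opprK; apply; lra.
Qed.

(** The open half circle is a graph over its vertical coordinate. *)
Lemma right_arc_connected (c r : R) :
  connected [set z : R * R | disk_boundary (c, 0) r z /\ c < z.1].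
Proof.
pose f (y : R) : R * R := (c + Num.sqrt (r ^+ 2 - y ^+ 2), y).
have -> : [set z : R * R | disk_boundary (c, 0) r z /\ c < z.1] = f @` `](- `|r|), `|r|[.
  apply/seteqP; split.
    move=> [x y] [/=]; rewrite /disk_boundary/= subr0 => xy cx.
    exists y; last first.
      rewrite /f; congr pair; have -> : r ^+ 2 - y ^+ 2 = (x - c) ^+ 2 by lra.
      by rewrite sqrtr_sqr gtr0_norm ?subr_gt0// addrC subrK.
    rewrite /= in_itv/= -ltr_norml -ltr_sqr ?nnegrE// !real_normK ?num_real//.
    by rewrite -xy ltrDr exprn_gt0// subr_gt0.
  move=> _ [y /= + <-]; rewrite in_itv/= -ltr_norml => yr.
  have h : 0 < r ^+ 2 - y ^+ 2.
    by rewrite subr_gt0 -[y ^+ 2]real_normK ?num_real// -[r ^+ 2]real_normK ?num_real// ltr_sqr ?nnegrE.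
  rewrite /disk_boundary /f/= subr0; split; last by rewrite ltrDl sqrtr_gt0.
  by rewrite addrAC subrr add0r sqr_sqrtr ?ltW// subrK.
apply: connected_continuous_connected; first by apply/connected_intervalP; exact: interval_is_interval.
apply: continuous_subspaceT; apply: cont_all => y; apply: cont_pair; last exact: cvg_id.
apply: cont_add; first exact: cst_continuous.
apply: (continuous_comp (g := Num.sqrt)); last exact: sqrt_continuous.
apply: cont_add; first exact: cst_continuous.
by apply: cont_opp; exact: exprn_continuous.
Qed.

(** [g] is negative inside the disk. Between times 1 and [n] the curve stays over [[1, n]], hence
    inside, while its two ends are outside; this yields the entry and exit times. The last clauses
    keep the new ends off the diameter and in opposite halves of the circle. *)
Lemma curve_in_disk (n : nat) (pi : 'S_n) (cx := curve_x n (crossing R pi)) (cy := curve_y n (arc_height R pi))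
    (r := disk_radius R n) (c := disk_center R n) (g := fun t => (cx t - c) ^+ 2 + cy t ^+ 2 - r ^+ 2) : (1 <= n)%N ->
  exists u0 u1, [/\ 0 < u0 < 1, n%:R < u1 < n.+1%:R & g u0 = 0 /\ g u1 = 0] /\
    [/\ forall t, u0 < t < u1 -> g t < 0, cy u0 != 0, cy u1 != 0 & cx u0 < c < cx u1].
Proof.
move=> n1.
pose H : R := 4 ^+ n.+1.
have r0 : 0 < r := disk_radius_gt0 R n.
have nR : 1 <= n%:R :> R by rewrite ler1n.
have H0 : 0 < H by rewrite exprn_gt0.
have rE : r = n%:R + 1 + H by [].
have cE : c = 2^-1 * (n%:R + 1) by rewrite /c/disk_center natr1.
have SnE : n.+1%:R = n%:R + 1 :> R by rewrite natr1.
have econt (f : R -> R) : elem f -> continuous f.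
  move=> /elem_derive[f' _ hf] x; apply: differentiable_continuous.
  by apply/derivable1_diffP; have [] := hf x.
have ecx : elem cx := curve_x_elem n _; have ecy : elem cy := curve_y_elem n _.
have cg : continuous g.
  apply: econt; apply: elem_add; last exact: elem_cst.
  have e2 (f : R -> R) : elem f -> elem (fun t => f t ^+ 2).
    by move=> ef; under eq_fun do rewrite expr2; exact: elem_mul.
  by apply: elem_add; apply: e2 => //; apply: elem_add => //; exact: elem_cst.
have i01 : 0 <= (0 : R) <= 1 by rewrite lexx ler01.
have i11 : 0 <= (1 : R) <= 1 by rewrite lexx ler01.
have cxk k : (k <= n)%N -> cx k%:R = crossing R pi k.
  by move=> kn; rewrite -[k%:R]addr0 /cx curve_xE// ramp_le ?mulr0 ?addr0.
have cyk k : (k <= n)%N -> cy k%:R = 0.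
  by move=> kn; rewrite -[k%:R]addr0 /cy curve_yE// hump0 mulr0.
have cxn : cx n.+1%:R = crossing R pi n.+1.
  by rewrite SnE /cx curve_xE// ramp_ge ?mulr1 1?addrC ?subrK//; lra.
have cyn : cy n.+1%:R = 0.
  by rewrite SnE /cy curve_yE// -[1]subr0 hump_sym hump0 mulr0.
have cyb k u : (k <= n)%N -> 0 <= u <= 1 -> cy (k%:R + u) ^+ 2 <= H ^+ 2.
  move=> kn u01; rewrite /cy curve_yE// exprMn sqrr_sign mul1r.
  have h1 := hump_le (arc_height_ge1 R pi k) u01; have h2 := arc_height_le R pi kn.
  have h3 : 0 <= hump (arc_height R pi k) u.
    have [->|un] := eqVneq u 0; first by rewrite hump0.
    have [->|un1] := eqVneq u 1; first by rewrite -[1]subr0 hump_sym hump0.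
    by apply/ltW/hump_gt0; rewrite ?arc_height_ge1// !lt_def un eq_sym un1.
  by rewrite ler_sqr ?nnegrE//; [exact: le_trans h1 h2|exact: ltW].
have inside x y : 1 <= x <= n%:R -> y ^+ 2 <= H ^+ 2 -> (x - c) ^+ 2 + y ^+ 2 - r ^+ 2 < 0.
  move=> xn yH; have : (x - c) ^+ 2 <= n%:R ^+ 2 by rewrite cE; nra.
  by rewrite rE; nra.
have posi k : (0 < k <= n)%N -> 1 <= crossing R pi k <= n%:R := @crossing_inner R n pi k.
have mids t : 1 <= t <= n%:R -> g t < 0.
  move=> /andP[t1 tn]; have [|k [u [tE u0 u1]]] := @nat_part R t; first by lra.
  have u01 : 0 <= u <= 1 by rewrite u0 ltW.
  have kn : (k <= n)%N by rewrite -(ler_nat R); lra.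
  have k0 : (0 < k)%N.
    by rewrite -(ltr_nat R); lra.
  rewrite /g {2}tE; apply: inside; last by exact: cyb.
  rewrite tE /cx curve_xE//.
  have pk := posi k; rewrite k0 kn in pk; have {}pk := pk isT.
  have [kn'|kn'] := ltnP k n.
    have := posi k.+1; rewrite kn' => /(_ isT) pk1.
    have s01 := ramp01 u; nra.
  have kE : k = n by apply/eqP; rewrite eqn_leq kn.
  have uz : u = 0 by move: tn; rewrite tE kE; lra.
  by rewrite uz ramp_le ?mulr0 ?addr0.
have g0 : 0 < g 0.
  by rewrite /g -[0]/(0%:R) cxk// cyk// /crossing /= -/c -/r; nra.
have gn : 0 < g n.+1%:R.
  by rewrite /g cxn cyn /crossing eqxx /= -/c -/r; nra.
have [u0 [u0i gu0 hu0]] := entry_point cg ltr01 g0 (mids 1 ltac:(by rewrite lexx)).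
have [u1 [u1i gu1 hu1]] : exists s, [/\ n%:R < s < n.+1%:R, g s = 0 & forall t, n%:R <= t -> t < s -> g t < 0].
  by apply: exit_point => //; [rewrite ltr_nat|apply: mids; rewrite nR lexx].
have gneg t : u0 < t < u1 -> g t < 0.
  move=> /andP[t0 t1]; have [t2|t2] := leP t 1; first exact: hu0.
  by have [t3|t3] := leP n%:R t; [exact: hu1|apply: mids; rewrite !ltW].
have u01 : 0 <= u0 <= 1 by move: u0i; clear; lra.
have v01 : 0 < u1 - n%:R < 1 by move: u1i; rewrite SnE; clear; lra.
have v01' : 0 <= u1 - n%:R <= 1 by move: v01; clear; lra.
have uE : u0 = 0%:R + u0 by rewrite add0r.
have vE : u1 = n%:R + (u1 - n%:R) by rewrite addrC subrK.
have cyu0 : 0 < cy u0.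
  by rewrite uE /cy curve_yE// expr0 mul1r hump_gt0 ?arc_height_ge1.
have cyu1 : cy u1 != 0.
  by rewrite vE /cy curve_yE// mulf_neq0 ?signr_eq0// gt_eqF// hump_gt0 ?arc_height_ge1.
(* Otherwise this point would lie between the center and the first crossing, hence over [[1, n]] and
   strictly inside. *)
have cxu0 : cx u0 < c.
  rewrite ltNge; apply/negP => cxc; suff : g u0 < 0 by rewrite gu0 ltxx.
  apply: inside; last by rewrite uE; exact: cyb.
  have p1 := posi 1%N; rewrite n1 in p1; have {}p1 := p1 isT.
  have cx1 : cx u0 <= crossing R pi 1.
    rewrite uE /cx curve_xE//.
    by move: (ramp01 u0) (crossing0 R pi) p1; clear; nra.
  by apply/andP; split; move: cxc cx1 p1 nR cE; clear; lra.
have cxu1 : c < cx u1.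
  rewrite ltNge; apply/negP => cxc; suff : g u1 < 0 by rewrite gu1 ltxx.
  apply: inside; last by rewrite vE; exact: cyb.
  have p1 := posi n; rewrite n1 leqnn in p1; have {}p1 := p1 isT.
  have cx1 : crossing R pi n <= cx u1.
    rewrite vE /cx curve_xE//.
    by move: (ramp01 (u1 - n%:R)) (crossing_last R pi) p1; clear; nra.
  by apply/andP; split; move: cxc cx1 p1 nR cE; clear; lra.
exists u0, u1; split; split=> //; [by rewrite gt_eqF|by rewrite cxu0].
Qed.

End Construction.

(** * The meander of an idempotent matrix *)

Section Realization.
Variables (R : realType) (n : nat) (pi : 'S_n).

Local Notation cx := (curve_x n (crossing R pi)).
Local Notation cy := (curve_y n (arc_height R pi)).

Lemma curve_at_nat k : (0 < k <= n)%N -> cx k%:R = crossing R pi k /\ cy k%:R = 0.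
Proof.
move=> /andP[k0 kn]; have i01 : 0 <= (0 : R) <= 1 by rewrite lexx ler01.
rewrite -[k%:R]addr0 curve_xE// curve_yE// ramp_le ?invr_ge0// hump0 !mulr0.
by rewrite addr0.
Qed.

Lemma curve_velocity (t : R) : 0 <= t < n.+1%:R ->
  exists a b, [/\ is_derive t 1 cx a, is_derive t 1 cy b, (a != 0) || (b != 0)
    & cy t = 0 -> b != 0 /\ exists2 k, (k <= n)%N & t = k%:R].
Proof.
move=> /andP[t0 tn]; have [k [u [tE u0 u1]]] := nat_part t0.
have kn : (k <= n)%N by rewrite -ltnS -(ltr_nat R); apply: le_lt_trans tn; rewrite tE lerDl.
have u01 : 0 <= u <= 1 by rewrite u0 ltW.
have [a [b [da db ab b0]]] := curve_immersion (arc_height_ge1 R pi) (@crossing_inj R n pi) kn u01.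
exists a, b; rewrite tE; split=> //; rewrite curve_yE// => /eqP.
rewrite mulf_eq0 signr_eq0 /= => hu; have uz : u = 0.
  by apply/eqP; apply: contraTT hu => un; rewrite gt_eqF// hump_gt0 ?arc_height_ge1// u1 lt_def un u0.
by split; [exact: b0|exists k; rewrite ?uz ?addr0].
Qed.

End Realization.

Lemma derive1_pair (R : realType) (f g : R -> R) (t a b : R) : is_derive t 1 f a -> is_derive t 1 g b ->
  derive1 (fun s => (f s, g s) : R * R) t = (a, b).
Proof. by move=> hf hg; rewrite derive1E; have [_ ->] := is_derive_pair hf hg. Qed.

Lemma idempotent_meandric (R : realType) (n : nat) (pi : 'S_n) : (1 <= n)%N ->
  (inversion_mx pi ^+ 2 = inversion_mx pi)%R -> meandric R pi.
Proof.
move=> n1 idem; pose cx := curve_x n (crossing R pi); pose cy := curve_y n (arc_height R pi).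
have [u0 [u1 [[u0i u1i [gu0 gu1]] [gneg cyu0 cyu1 /andP[cxu0 cxu1]]]]] :=
  curve_in_disk R pi n1.
pose r := disk_radius R n; pose c := disk_center R n; have r0 : 0 < r := disk_radius_gt0 R n.
have nR : 1 <= n%:R :> R by rewrite ler1n.
have du : 0 < u1 - u0 by move: u0i u1i nR; clear; lra.
(* [T] maps [[0, 1]] onto the time spent in the disk, [L] onto the horizontal diameter. *)
pose T a := (u1 - u0) * a + u0; pose L b := 2 * r * b + (c - r).
pose mu a : R * R := (cx (T a), cy (T a)); pose ell b : R * R := (L b, 0).
have Ti (a : R) : 0 <= a <= 1 -> u0 <= T a <= u1 by move: du; rewrite /T; clear; nra.
have Tn (a : R) : 0 <= a <= 1 -> 0 <= T a < n.+1%:R.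
  by move=> /Ti; move: u0i u1i; clear; lra.
have T0 : T 0 = u0 by rewrite /T mulr0 add0r.
have T1 : T 1 = u1 by rewrite /T mulr1 subrK.
have L0 : L 0 = c - r by rewrite /L mulr0 add0r.
have L1 : L 1 = c + r by rewrite /L; ring.
have affine_elem (a b : R) : elem (fun x => a * x + b).
  apply: elem_add; last exact: elem_cst.
  by apply: elem_mul; [exact: elem_cst|exact: elem_id].
have dmu (a : R) : 0 <= a <= 1 -> exists x y, [/\ derive1 mu a = (x * (u1 - u0), y * (u1 - u0)),
    (x != 0) || (y != 0) & cy (T a) = 0 -> y != 0 /\ exists2 k, (k <= n)%N & T a = k%:R].
  move=> /Tn aT; have [x [y [dx dy xy yk]]] := curve_velocity pi aT; exists x, y; split=> //.
  have dT := affine_derive (u1 - u0) u0 a.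
  by have := derive1_pair (isd_comp (g := T) dx dT) (isd_comp (g := T) dy dT); exact.
have dell b : derive1 ell b = (2 * r, 0).
  by have := derive1_pair (affine_derive (2 * r) (c - r) b) (isd_cst 0 b); exact.
have meet (a b : R) : 0 <= a <= 1 -> mu a = ell b -> exists2 i : 'I_n, T a = i.+1%:R & mu a = ((pi i).+1%:R, 0).
  move=> a01 mE; have [x [y [_ _ yk]]] := dmu a a01.
  have y0 : cy (T a) = 0 by have := congr1 snd mE.
  have [_ [k kn TE]] := yk y0.
  have k0 : (0 < k)%N.
    by rewrite -(ltr_nat R) -TE; have := Ti a a01; move: u0i; clear; lra.
  have kn' : (k.-1 < n)%N by rewrite prednK.
  exists (Ordinal kn'); first by rewrite /= prednK.
  have := @crossing_ord R n pi (Ordinal kn'); rewrite /= prednK// => <-.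
  have [xE yE] := @curve_at_nat R n pi k ltac:(by rewrite k0).
  by rewrite /mu TE /cx /cy xE yE.
pose Ta (i : 'I_n) := (i.+1%:R - u0) / (u1 - u0); pose Lb (i : 'I_n) := (i.+1%:R - (c - r)) / (2 * r).
have ni (i : 'I_n) : 1 <= i.+1%:R :> R /\ i.+1%:R <= n%:R :> R by rewrite ler1n ler_nat ltn_ord.
have TaE i : T (Ta i) = i.+1%:R by rewrite /T /Ta mulrC divfK ?subrK// gt_eqF.
have LbE i : L (Lb i) = i.+1%:R.
  by rewrite /L /Lb mulrC divfK ?subrK// gt_eqF// mulr_gt0.
have Ta01 i : Ta i \in `[0, 1]%R.
  have [i1 i2] := ni i; rewrite in_itv/= /Ta divr_ge0 ?ler_pdivrMr//; move: i1 i2 u0i u1i; clear; lra.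
have r2 : 0 < 2 * r by rewrite mulr_gt0.
have cr : c - r < 1 /\ n%:R < c + r.
  have e0 : 0 < 4 ^+ n.+1 :> R by rewrite exprn_gt0.
  rewrite /c /r /disk_center /disk_radius -[n.+1%:R]natr1; move: e0 nR; clear; lra.
have Lb01 i : Lb i \in `[0, 1]%R.
  have [i1 i2] := ni i; rewrite in_itv/= /Lb divr_ge0 ?ler_pdivrMr//; move: i1 i2 cr r0; clear; lra.
have muT i : mu (Ta i) = ((pi i).+1%:R, 0).
  have [xE yE] := @curve_at_nat R n pi i.+1 ltac:(by rewrite ltn_ord).
  by rewrite /mu TaE /cx /cy xE yE crossing_ord.
pose P (i : 'I_n) : R * R := (i.+1%:R, 0).
have Pinj : injective P.
  by move=> i j [/eqP]; rewrite eqr_nat eqSS => /eqP/val_inj.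
have XE : range P = intersection mu ell.
  apply/seteqP; split.
    move=> _ [i _ <-]; split; last by exists (Lb i); [exact: Lb01|rewrite /ell LbE].
    by exists (Ta (perm_inv pi i)); [exact: Ta01|rewrite muT permKV].
  move=> z [[a /= a01 <-] [b /= b01 /esym mE]].
  have [i _ ->] : exists2 i : 'I_n, T a = i.+1%:R & mu a = ((pi i).+1%:R, 0).
    by apply: meet mE; move: a01; rewrite in_itv.
  by exists (pi i).
have bnd0 : disk_boundary (c, 0) r (mu 0).
  rewrite /disk_boundary/= T0 subr0; apply/eqP; rewrite -subr_eq0; exact/eqP.
have bnd1 : disk_boundary (c, 0) r (mu 1).
  rewrite /disk_boundary/= T1 subr0; apply/eqP; rewrite -subr_eq0; exact/eqP.
have bnd2 : disk_boundary (c, 0) r (ell 0).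
  by rewrite /disk_boundary/= L0; ring.
have bnd3 : disk_boundary (c, 0) r (ell 1).
  by rewrite /disk_boundary/= L1; ring.
have muinj : {in `[0, 1]%R &, injective mu}.
  move=> a b; rewrite !in_itv/= => /Tn a01 /Tn b01 [ex ey].
  have := curve_inj idem a01 b01 ex ey; rewrite /T => /addIr/mulfI; apply.
  by rewrite gt_eqF.
have uniq4 : uniq [:: mu 0; mu 1; ell 0; ell 1].
  have y0 b : mu 0 != ell b.
    by apply/eqP => -[_]; rewrite T0; apply/eqP.
  have y1 b : mu 1 != ell b.
    by apply/eqP => -[_]; rewrite T1; apply/eqP.
  rewrite /= !inE !negb_or !y0 !y1 !andbT /=; apply/andP; split.
    apply/eqP => /muinj; rewrite !in_itv/= !lexx !ler01 => /(_ isT isT)/eqP.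
    by rewrite eq_sym oner_eq0.
  apply/eqP => -[]; rewrite L0 L1; move: r0; clear; lra.
(* Both final points are in the open right half of the circle, a connected arc that avoids the two
   removed points. *)
have comp : let B := disk_boundary (c, 0) r `\` [set mu 0; ell 0] in
    exists2 x, B x & connected_component B x (mu 1) /\ connected_component B x (ell 1).
  move=> B; pose A := [set z : R * R | disk_boundary (c, 0) r z /\ c < z.1].
  have AB : A `<=` B.
    move=> z [zb zc]; split=> // -[] zE; move: zc; rewrite zE /=.
      by rewrite T0 ltNge ltW.
    by rewrite L0; move: r0; clear; lra.
  have A1 : A (ell 1) by split=> //=; rewrite L1 ltrDl.
  have A2 : A (mu 1) by split=> //=; rewrite T1.
  exists (ell 1); first exact: AB.
  have := connected_component_max A1 AB (@right_arc_connected R c r).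
  by move=> h; split; exact: h.
have muE : proper_embedding (c, 0) r mu.
  split=> //.
  - by apply: elem_smooth; (apply: elem_comp; last exact: affine_elem);
      [exact: curve_x_elem|exact: curve_y_elem].
  - move=> a; rewrite in_itv/= => /dmu[x [y [-> xy _]]]; apply/eqP => -[/eqP + /eqP].
    rewrite !mulf_eq0 (gt_eqF du) !orbF => x0 y0; move: xy.
    by rewrite x0 y0.
  - move=> a; rewrite in_itv/= => a01; rewrite /disk/= subr0 -subr_le0; have /andP[] := Ti a a01.
    rewrite (le_eqVlt u0) (le_eqVlt (T a)) => /orP[/eqP <- _|a0 /orP[/eqP ->|a1]].
    + by rewrite /cx /cy gu0.
    + by rewrite /cx /cy gu1.
    + by apply/ltW/gneg; rewrite a0.
  - move=> a; rewrite in_itv/= => a01; split; last by move=> [->|->].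
    have /andP[] := Ti a a01; rewrite /disk_boundary/= subr0 => /[swap].
    have i2 (x : R) : x * (u1 - u0) = 0 -> x = 0.
      by move=> /eqP; rewrite mulf_eq0 (gt_eqF du) orbF => /eqP.
    rewrite le_eqVlt => /orP[/eqP aE _ _|a1].
      right; apply/eqP; rewrite -subr_eq0; apply/eqP/i2.
      have -> : (a - 1) * (u1 - u0) = T a - u1 by rewrite /T; ring.
      by rewrite aE subrr.
    rewrite le_eqVlt => /orP[/eqP aE _|a0 bE].
      left; apply: i2; have -> : a * (u1 - u0) = T a - u0 by rewrite /T; ring.
      by rewrite -aE subrr.
    by have := gneg (T a); rewrite a0 a1 => /(_ isT); rewrite bE subrr ltxx.
have ellE : proper_embedding (c, 0) r ell.
  split.
  - by apply: elem_smooth; [exact: affine_elem|exact: elem_cst].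
  - by move=> a b _ _ [/addIr/mulfI]; apply; rewrite gt_eqF.
  - by move=> b _; rewrite dell; apply/eqP => -[] /eqP; rewrite gt_eqF.
  - move=> b; rewrite in_itv/= /disk/= /L subr0 expr0n addr0.
    have -> : 2 * r * b + (c - r) - c = r * (2 * b - 1) by ring.
    move=> b01; rewrite exprMn ler_piMr ?sqr_ge0//; move: b01; clear; nra.
  - move=> b _; split; last by move=> [->|->].
    rewrite /disk_boundary/= /L subr0 expr0n addr0.
    have -> : 2 * r * b + (c - r) - c = r * (2 * b - 1) by ring.
    move=> bE; have : r ^+ 2 * 4 * (b * (b - 1)) = 0.
      by rewrite -[RHS](subrr (r ^+ 2)) -[X in _ = X - _]bE; ring.
    move=> /eqP; rewrite !mulf_eq0 (gt_eqF r0) pnatr_eq0/= subr_eq0.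
    by move=> /orP[]/eqP ->; [left|right].
have trans : transverse mu ell.
  move=> a b; rewrite !in_itv/= => a01 _ mE w.
  have [x [y [-> _ yk]]] := dmu a a01; rewrite dell.
  have [y0 _] := yk (congr1 snd mE).
  (* [ell] is horizontal, so the second coordinate determines the coefficient of the velocity of
     [mu], whose vertical part is nonzero on the axis. *)
  exists (w.2 / (y * (u1 - u0))), ((w.1 - w.2 / y * x) / (2 * r)).
  rewrite [LHS]surjective_pairing; congr pair; rewrite /= /GRing.scale/=.
    by field; rewrite y0 (gt_eqF du) gt_eqF.
  by rewrite mulr0 addr0 divfK// mulf_neq0// gt_eqF.
have card : (intersection mu ell #= `I_n)%card.
  rewrite -XE; apply: card_eq_trans (card_esym card_II).
  by apply: inj_card_eq => i j _ _; exact: Pinj.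
pose m := @Meander R n (c, 0) r (mu 0) (mu 1) (ell 0) (ell 1) mu ell r0 bnd0 bnd1 bnd2 bnd3
  uniq4 comp muE ellE erefl erefl erefl erefl trans card.
exists m, P, (fun k => P (pi k)); split=> //=.
- split=> //; exists Lb; split=> // [i j ij|i]; last by rewrite /ell LbE.
  by rewrite /Lb ltr_pM2r ?invr_gt0// ltrD2r ltr_nat ltnS.
- split.
    rewrite -XE; apply/seteqP; split=> [_ [i _ <-]|_ [i _ <-]]; first by exists (pi i).
    by exists (perm_inv pi i); rewrite ?permKV.
  exists Ta; split=> // i j ij.
  by rewrite /Ta ltr_pM2r ?invr_gt0// ltrD2r ltr_nat ltnS.
Qed.

Theorem theorem5p4 (R : realType) (n : nat) (hn : (1 <= n)%N) (pi : 'S_n) :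
  meandric R pi <-> (inversion_mx pi ^+ 2 = inversion_mx pi)%R.
Proof. by split; [exact: meandric_idempotent|exact: idempotent_meandric hn]. Qed.
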